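(* There is a function $f_1(k,\lambda)$, polylogarithmic in $k$ and $1/\lambda$, such that for every $k$-edge-connected graph $G=(V,E)$ ($k>1$), every $0<\lambda<1$, every $(k,\lambda,T)$-LCH $\mathcal T$ of $G$, every $h>0$, every $X\in\{0,1\}^{h\times V}$ with $\sum_e\|X_e\|^2>0$ and every semiorthogonal $U\in\mathbb R^{E\times h}$, $$\frac{\sum_{t\in T}\frac{1}{|\mathcal O(t)|}\Big(\sum_{e\in\mathcal O(t)}\langle U^e,X_e\rangle\Big)^2}{\sum_{e\in E}\|X_e\|_2^2}\ \le\ \frac{f_1(k,\lambda)}{k}.$$
   Context: Graphs are finite, undirected, unweighted, loopless, possibly with parallel edges; $k$-edge-connected means every cut $(S,\overline S)$, $\emptyset\ne S\subsetneq V$, has at least $k$ edges. Each edge $e=\{u,v\}$ has a fixed orientation $u\to v$. A matrix $U\in\mathbb R^{E\times h}$ is semiorthogonal if $UU^\intercal=I$; $U^e$ is its row indexed by $e$. For $X\in\{0,1\}^{h\times V}$, $X_v$ is the column of $v$ and $X_e=X_u-X_v$. A hierarchy of $G$ is a rooted tree $\mathcal T$ in which every non-leaf node has at least two children and whose leaves are in bijection with $V$. For a node $t$: $V(t)$ is the set of vertices at the leaves of its subtree; $E(t)$ the edges inside $V(t)$; $G(t)=(V(t),E(t))$; $\mathcal P(t)=E(V(t),V\setminus V(t))$; for non-root $t$ with parent $t^*$, $\mathcal O(t)=E(V(t),V(t^* )\setminus V(t))$. For a set $T$ of non-root nodes, $\mathcal T$ is a $(k,\lambda,T)$-LCH if $G(t)$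 is $k$-edge-connected for every node $t$ and $|\mathcal O(t)|\ge\lambda|\mathcal P(t)|$ for all $t\in T$. *)

(* Defs.v *)
From Stdlib Require Import Reals.
From mathcomp Require Import all_boot.
Open Scope R_scope.

Set Implicit Arguments.
Unset Strict Implicit.
Unset Printing Implicit Defensive.

Definition sumR (I : finType) (P : pred I) (F : I -> R) : R :=
  \big[Rplus/R0]_(i | P i) F i.

Section Graph.
Variables (V E : finType) (src tgt : E -> V).
(* A multigraph: edge e = {src e, tgt e} oriented src e -> tgt e. *)

Definition cut_edges (A B : {set V}) : {set E} :=
  [set e | ((src e \in A) && (tgt e \in B)) || ((src e \in B) && (tgt e \in A))].

Definition k_edge_connected_on (k : nat) (W : {set V}) : Prop :=
  forall S : {set V}, S \subset W -> S != set0 -> S != W ->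
    (k <= #|cut_edges S (W :\: S)|)%N.

Definition k_edge_connected (k : nat) : Prop :=
  k_edge_connected_on k [set: V].

Variables (N : finType) (root : N) (par : N -> N) (leaf : V -> N).
(* A hierarchy: rooted tree on node set N, with root [root], parent map [par]
   (par root = root by convention), and [leaf] the bijection V -> leaves. *)

Definition is_child (c t : N) : bool := (c != root) && (par c == t).

Definition is_leaf (t : N) : bool := [forall c, ~~ is_child c t].

Definition is_hierarchy : Prop :=
  par root = root /\
  (forall t, t != root -> par t != t) /\
  (forall t, exists n, iter n par t = root) /\
  (forall t, ~~ is_leaf t -> (2 <= #|[set c | is_child c t]|)%N) /\
  injective leaf /\
  (forall t, is_leaf t <-> exists v, leaf v = t).

Definition Vt (t : N) : {set V} := [set v | fconnect par (leaf v) t].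

Definition Pt (t : N) : {set E} := cut_edges (Vt t) (~: Vt t).

Definition Ot (t : N) : {set E} := cut_edges (Vt t) (Vt (par t) :\: Vt t).

Definition is_LCH (k : nat) (lam : R) (T : {set N}) : Prop :=
  is_hierarchy /\ root \notin T /\
  (forall t, k_edge_connected_on k (Vt t)) /\
  (forall t, t \in T -> (INR #|Ot t| >= lam * INR #|Pt t|)).

End Graph.

Definition Xe (V E : finType) (src tgt : E -> V) (h : nat)
  (X : 'I_h -> V -> R) (e : E) (i : 'I_h) : R :=
  (X i (src e) - X i (tgt e)).

Definition semiorthogonal (E : finType) (h : nat) (U : E -> 'I_h -> R) : Prop :=
  forall e e' : E,
    sumR predT (fun i => (U e i * U e' i)) = (if e == e' then 1 else 0).

(* Main.v *)
(** Expanding the squares, it is enough to bound the weighted energies <U^e, X_e>^2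
    of the edges leaving a node towards its parent, for one orientation at a time.
    Edges much longer or much shorter than the average of their node are handled by
    Cauchy-Schwarz; the others fall into polylogarithmically many classes, in each of
    which the edges of one node share a scale and different scales are far apart.

    In a class, X_u - X_v is chained through nets of decreasing radius.  A piece of
    the chain at a given level is a difference of net points (labels), and by
    Bessel's inequality the energy of vectors taken from a span is at most its
    dimension times their squared norm; so it suffices to confine the pieces to spans
    of few labels.  The reference is a spanning tree that is connected in every
    cluster of the hierarchy and costs at most 2/k times the whole graph; it is found
    by repeatedly merging along a cheapest edge, k-edge-connectivity providing many
    edges to choose from.  Every edge of the class lies near an anchor: an end of a
    long tree edge, a point charged to the cut of its node or to the tree edges
    crossing it, or one of a greedily chosen family of places.  The number of
    labels around an anchor is bounded except for labels whose radii sum to O(tree length).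

    The main point is that the radii of the places sum to at most the tree length.
    Around a place there is a walk inside its cluster and a tree walk outside it.  If
    both flip many common coordinates, or if many coordinates are constant between
    the ends of the place while walks inside the cluster that do not flip them stay
    near it, then an acyclicity argument in each coordinate charges the place to tree
    edges.  Otherwise a potential argument charges it to the balls of smaller places
    that were collapsed around it, whose total weight is again O(tree length). *)
From Stdlib Require Import Reals Lra.
Require Import Defs.
From mathcomp Require Import all_boot all_order all_algebra zify ring lra Rstruct.
Open Scope R_scope.
Set Implicit Arguments.
Unset Strict Implicit.
Unset Printing Implicit Defensive.

(** Only the tree is cheaper than the graph by a factor [k], so every charge must be linear in tree
    length; charging to graph edges would lose the whole gain. The ratio condition of the hierarchy
    enters as |P(t)| k <= |O(t)| K with [K] about k / lam. Spots of a node that each meet [K] edges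
    of P(t) of their own number at most |O(t)| / k, which the weight 1 / |O(t)| absorbs. Around the
    other spots fewer than [K] edges leave the cluster, and these are the candidates for places. The
    ratio [Q] of consecutive scales is polynomial in [k] and 1 / lam: it must beat [K], since a
    place may spoil [K + 2] points at every smaller scale, and [2 ^ J], the ratio between the
    largest and the smallest net radius. There are [J], about log k, net levels because a remainder
    whose squared norm is a 1 / k fraction of the edge length needs no dimension count. The exponent
    4 is 2 + 2: the number [W] = log [Q] of classes and the number of net levels both enter squared,
    once by Cauchy-Schwarz and once by summation. *)

Module Multigraph.
Local Open Scope nat_scope.

Lemma card_setU_le (T : finType) (A B : {set T}) : #|A :|: B| <= #|A| + #|B|.
Proof. exact: leq_of_leqif (leq_card_setU A B). Qed.

Lemma card_bigcup_leq_sum (T I : finType) (P : pred I) (F : I -> {set T}) :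
  #|\bigcup_(i | P i) F i| <= \sum_(i | P i) #|F i|.
Proof.
elim/big_rec2: _ => [|i n S _ h]; first by rewrite cards0.
by apply: leq_trans (card_setU_le _ _) _; rewrite leq_add2l.
Qed.

(** * Connectivity and forests in a multigraph *)

Section Multigraph.
Variables (Y E : finType) (p q : E -> Y).
Implicit Types (P S : pred E) (u v w a b : Y) (e : E).

Definition lnk e u v : bool :=
  ((p e == u) && (q e == v)) || ((p e == v) && (q e == u)).

Definition eadj P : rel Y := fun u v => [exists e, P e && lnk e u v].

Definition conn P : rel Y := connect (eadj P).

Definition in2 (W : {set Y}) e := (p e \in W) && (q e \in W).

Lemma lnkC e u v : lnk e u v = lnk e v u.
Proof. by rewrite /lnk orbC. Qed.

Lemma lnk_pq e : lnk e (p e) (q e).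
Proof. by rewrite /lnk !eqxx. Qed.

Lemma lnkP e u v : lnk e u v -> (p e = u /\ q e = v) \/ (p e = v /\ q e = u).
Proof. by case/orP=> /andP[/eqP-> /eqP->]; [left | right]. Qed.

Lemma eadjC P u v : eadj P u v = eadj P v u.
Proof. by apply: eq_existsb => e; rewrite lnkC. Qed.

Lemma conn_refl P u : conn P u u.
Proof. exact: connect0. Qed.

Lemma conn_trans P u v w : conn P u v -> conn P v w -> conn P u w.
Proof. exact: connect_trans. Qed.

Lemma conn_sym P u v : conn P u v = conn P v u.
Proof.
have sP : symmetric (eadj P) by move=> a b; exact: eadjC.
by rewrite /conn (sym_connect_sym sP).
Qed.

Lemma conn_lnk P e u v : P e -> lnk e u v -> conn P u v.
Proof. by move=> Pe h; apply: connect1; apply/existsP; exists e; rewrite Pe. Qed.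

Lemma conn1 P e : P e -> conn P (p e) (q e).
Proof. by move=> Pe; apply: conn_lnk Pe (lnk_pq e). Qed.

Lemma conn_closed P (S : Y -> Prop) u v :
    (forall e a b, P e -> lnk e a b -> S a -> S b) ->
  conn P u v -> S u -> S v.
Proof.
move=> cl /connectP[s]; elim: s u => [|w s IH] u /=; first by move=> _ ->.
case/andP=> /existsP[e /andP[Pe l]] ps ev Su.
exact: IH ps ev (cl e u w Pe l Su).
Qed.

Lemma conn_mono P P' u v :
  (forall e, P e -> conn P' (p e) (q e)) -> conn P u v -> conn P' u v.
Proof.
move=> h c; apply: (conn_closed (S := conn P' u)) c (conn_refl _ _).
move=> e a b Pe /lnkP[] [<- <-] ua; apply: conn_trans ua _; first exact: h.
by rewrite conn_sym; exact: h.
Qed.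

Lemma conn_sub P P' u v :
  (forall e, P e -> P' e) -> conn P u v -> conn P' u v.
Proof. by move=> h; apply: conn_mono => e /h; exact: conn1. Qed.

(** Besides the exit edge this records that the walk up to it stays inside [W]; later uses stop a
    walk where it leaves a ball, a cluster or a colour class. Without such an edge, the points
    reached within [W] would be closed under [P]. *)
Lemma conn_exit P (W : {set Y}) u v :
    conn P u v -> u \in W -> v \notin W ->
  exists e a b, [/\ P e, lnk e a b, a \in W, b \notin W &
    conn (fun e => P e && in2 W e) u a].
Proof.
move=> c uW vW.
set C := conn (fun e => P e && in2 W e) u.
have [/existsP[e /existsP[a /existsP[b /and5P[h1 h2 h3 h4 h5]]]]|/existsPn nex] :=
  boolP [exists e, exists a, exists b, [&& P e, lnk e a b, a \in W, b \notin W & C a]].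
  by exists e, a, b; split.
suff /andP[] : C v && (v \in W) by rewrite (negPf vW).
apply: (conn_closed (S := fun v => C v && (v \in W))) c _; last first.
  by rewrite uW /C conn_refl.
move=> e a b Pe l /andP[Ca aW].
have /existsPn/(_ a)/existsPn/(_ b) := nex e.
rewrite Pe l aW Ca /= andbT negbK => bW; rewrite bW andbT.
apply: conn_trans Ca (conn_lnk _ l); rewrite Pe /in2.
by case/lnkP: l => [[-> ->]|[-> ->]]; rewrite aW bW.
Qed.

Definition merge (f : Y -> Y) e : Y -> Y := fun v => if f v == f (p e) then f (q e) else f v.

(** Kruskal contraction: [f] colours the contracted components. Each edge of [s] joins two different
    colours, so each [merge] loses one, and equally coloured points stay connected. *)
Lemma forest_colouring (s : seq E) :
    (forall s1 e s2, s = s1 ++ e :: s2 -> ~~ conn (fun e => e \in s1) (p e) (q e)) ->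
  exists f : Y -> Y, #|f @: [set: Y]| + size s <= #|Y| /\
    forall u v, f u = f v -> conn (fun e => e \in s) u v.
Proof.
elim/last_ind: s => [|s e IH] h.
  exists id; split; first by rewrite imset_id cardsT addn0.
  by move=> u v ->; exact: conn_refl.
have [|f [cf hf]] := IH.
  by move=> s1 e1 s2 es; apply: (h s1 e1 (rcons s2 e)); rewrite es rcons_cat.
have npq : f (p e) != f (q e).
  apply/eqP => /hf; apply/negP; apply: (h s e [::]); by rewrite cats1.
have sub u v : conn (fun e => e \in s) u v -> conn (fun e0 => e0 \in rcons s e) u v.
  by apply: conn_sub => e0 e0s; rewrite mem_rcons inE e0s orbT.
have cpq : conn (fun e0 => e0 \in rcons s e) (p e) (q e).
  by apply: conn1; rewrite mem_rcons inE eqxx.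
exists (merge f e); split.
  rewrite size_rcons addnS -addSn; apply: leq_trans cf; rewrite leq_add2r.
  apply: proper_card; apply/properP; split.
    by apply/subsetP => _ /imsetP[v _ ->]; rewrite /merge; case: ifP => _; exact: imset_f.
  exists (f (p e)); first exact: imset_f.
  apply/imsetP => -[v _]; rewrite /merge; case: ifP => [_ | /eqP ne] E1.
    by rewrite E1 eqxx in npq.
  by rewrite E1 in ne.
have fE w w' : f w = f w' -> conn (fun e0 => e0 \in rcons s e) w w'.
  by move/hf; exact: sub.
move=> u v; rewrite /merge; case: eqP => [eu|_]; case: eqP => [ev|_] E1.
- by apply: fE; rewrite eu ev.
- apply: conn_trans (fE _ _ eu) _; apply: conn_trans cpq _; exact: fE.
- rewrite conn_sym; apply: conn_trans (fE _ _ ev) _; apply: conn_trans cpq _.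
  by apply: fE.
- exact: fE.
Qed.

(** Ties may be sorted either way, hence the weak inequality together with [e' != e]; the acyclicity
    hypotheses below have the same form. *)
Lemma sorted_key_prefix (S : {set E}) (key : E -> nat) s1 e s2 :
    sort (fun e e' => key e <= key e') (enum S) = s1 ++ e :: s2 ->
  e \in S /\ forall e', e' \in s1 -> [&& e' \in S, e' != e & key e' <= key e].
Proof.
set r := (fun e e' => key e <= key e') => es.
have eS : e \in S by rewrite -mem_enum -(mem_sort r) es mem_cat mem_head orbT.
split=> // e1 e1s.
have -> /= : e1 \in S by rewrite -mem_enum -(mem_sort r) es mem_cat e1s.
have u1 : uniq (s1 ++ e :: s2) by rewrite -es sort_uniq enum_uniq.
have -> /= : e1 != e.
  apply/eqP => E1; move: u1; rewrite cat_uniq => /and3P[_ /hasPn/(_ e (mem_head _ _)) /= /negP].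
  by rewrite -E1.
have rtot : total r by move=> a b; exact: leq_total.
have rtr : transitive r by move=> a b c; exact: leq_trans.
have := sort_sorted rtot (enum S); rewrite es sorted_pairwise // pairwise_cat.
by case/and3P=> /allrelP/(_ e1 e e1s (mem_head _ _)).
Qed.

(* Scanning [S] by increasing key, no edge closes a cycle. *)
Lemma forest_count_in (S : {set E}) (W : {set Y}) (key : E -> nat) :
    (forall e, e \in S -> in2 W e) ->
    (forall e, e \in S ->
      ~~ conn (fun e' => [&& e' \in S, e' != e & key e' <= key e]) (p e) (q e)) ->
  exists f : Y -> Y, #|f @: W| + #|S| <= #|W|.
Proof.
move=> SW h.
have [|f [cf hf]] := @forest_colouring (sort (fun e e' => key e <= key e') (enum S)).
  move=> s1 e s2 es; have [eS es1] := sorted_key_prefix es.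
  by apply: contra (h e eS); apply: conn_sub.
rewrite size_sort -cardE in cf.
(* Points outside [W] meet no edge of [S], so each keeps a colour of its own and can be discounted
   on both sides. *)
have {}hf u v : f u = f v -> u != v -> u \in W.
  move=> /hf c; apply: contraR => uW.
  apply/eqP; apply: (conn_closed (S := fun w => u = w)) c erefl.
  move=> e a b; rewrite mem_sort mem_enum => /SW /andP[pW qW] l ua; subst a.
  by case/lnkP: l uW => [[<- _]|[_ <-]]; rewrite ?pW ?qW.
exists f; rewrite -(leq_add2r #|~: W|) (cardsC W); apply: leq_trans cf.
rewrite addnAC leq_add2r.
have -> : #|~: W| = #|f @: ~: W|.
  rewrite card_in_imset // => u v; rewrite !inE => uW vW fE; apply/eqP.
  by apply: contraNT uW; exact: hf fE.
rewrite -cardsUI (_ : _ :&: _ = set0) ?cards0 ?addn0; last first.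
  apply/setP => w; rewrite !inE; apply/andP => -[/imsetP[u uW ->] /imsetP[v vW fE]].
  move: vW; rewrite inE; apply/negP; rewrite negbK.
  have [<-//|nuv] := eqVneq u v; apply: (hf v u) => //; by rewrite eq_sym.
by apply: subset_leq_card; rewrite subUset !imsetS ?subsetT.
Qed.

Lemma forest_count (S : {set E}) (key : E -> nat) :
    (forall e, e \in S ->
      ~~ conn (fun e' => [&& e' \in S, e' != e & key e' <= key e]) (p e) (q e)) ->
  #|S| <= #|Y|.-1.
Proof.
move=> h; have [e0 e0S|S0] := pickP (fun e => e \in S); last first.
  by rewrite (eq_card0 S0).
have [|f] := @forest_count_in S [set: Y] key _ h; first by move=> e _; rewrite /in2 !inE.
have : 0 < #|f @: [set: Y]| by apply/card_gt0P; exists (f (p e0)); exact: imset_f.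
rewrite cardsT; lia.
Qed.

(** Contracting an edge removes at most one colour, and a connected graph ends with a single
    colour. *)
Lemma connected_count (S : {set E}) :
  (forall u v, conn (fun e => e \in S) u v) -> #|Y| <= #|S|.+1.
Proof.
move=> cS.
have [f [cf hf]] : exists f : Y -> Y, #|Y| <= #|f @: [set: Y]| + size (enum S) /\
    forall e, e \in enum S -> f (p e) = f (q e).
  elim: (enum S) => [|e s [f [cf hf]]]; first by exists id; rewrite imset_id cardsT addn0.
  exists (merge f e); split.
    rewrite /= addnS -addSn; apply: leq_trans cf _; rewrite leq_add2r.
    have sub : f @: setT \subset f (p e) |: merge f e @: setT.
      apply/subsetP => _ /imsetP[v _ ->]; rewrite !inE.
      case: eqP => //= nv; apply/imsetP; exists v => //.
      by rewrite /merge; case: eqP.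
    apply: leq_trans (subset_leq_card sub) _; rewrite cardsU1; lia.
  move=> e1; rewrite inE /merge => /predU1P[->|/hf ->] //.
  by rewrite eqxx; case: eqP.
have f1 : #|f @: [set: Y]| <= 1.
  apply/card_le1_eqP => _ _ /imsetP[u _ ->] /imsetP[v _ ->]; apply/eqP.
  apply: (conn_closed (S := fun w => f w == f u)) (cS u v) (eqxx _).
  move=> e a b eS; rewrite -mem_enum in eS; have := hf e eS.
  by move=> E1 /lnkP[[<- <-]|[<- <-]]; rewrite E1.
by rewrite cardE; apply: leq_trans cf _; rewrite -add1n leq_add2r.
Qed.

End Multigraph.

(** * The Hamming metric on vertices *)

Section Metric.
Variables (V I : finType) (x : V -> I -> bool).
Implicit Types (u v w : V) (i : I).

Definition diff u v : {set I} := [set i | x u i != x v i].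
Definition dist u v : nat := #|diff u v|.

Lemma distC u v : dist u v = dist v u.
Proof. by congr #|pred_of_set _|; apply/setP => i; rewrite !inE eq_sym. Qed.

Lemma distxx u : dist u u = 0.
Proof. by apply/eqP; rewrite cards_eq0; apply/eqP/setP => i; rewrite !inE eqxx. Qed.

Lemma diff_tri u v w : diff u w \subset diff u v :|: diff v w.
Proof.
apply/subsetP => i; rewrite !inE.
by case: (x u i); case: (x v i); case: (x w i).
Qed.

Lemma dist_tri v u w : dist u w <= dist u v + dist v w.
Proof.
apply: leq_trans (subset_leq_card (diff_tri u v w)) _.
by rewrite cardsU leq_subr.
Qed.

Definition ball (c : V) (r : nat) : {set V} := [set v | dist c v <= r].

Lemma in_ball c r v : (v \in ball c r) = (dist c v <= r).
Proof. by rewrite inE. Qed.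

Lemma conn_cut (E : finType) (p q : E -> V) P u v i :
    conn p q P u v -> x u i != x v i ->
  exists e, P e /\ x (p e) i != x (q e) i.
Proof.
move=> c ne.
have [||e [a [b [Pe l]]]] := conn_exit (W := [set w | x w i == x u i]) c.
- by rewrite inE.
- by rewrite inE eq_sym.
rewrite !inE => /eqP aE bE _; exists e; split=> //.
by case/lnkP: l => [[-> ->]|[-> ->]]; rewrite aE // eq_sym.
Qed.

End Metric.

End Multigraph.
Import Multigraph.

(** * Amortised coarsening of a cover of the edges *)

Module Coarsening.
Local Open Scope nat_scope.

Lemma sum_rcons (T : Type) (s : seq T) a (P : pred T) (F : T -> nat) :
  \sum_(i <- rcons s a | P i) F i = \sum_(i <- s | P i) F i + (if P a then F a else 0).
Proof. by rewrite -cats1 big_cat /= big_cons big_nil addn0. Qed.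

Section Coarsening.
Variables (E Ev V : finType) (Bs : {set E}).
Variables (hset : E + Ev -> {set V}) (hsize : E + Ev -> nat).
Variable (sel : Ev -> pred (E + Ev)).
Implicit Types (cov : E -> E + Ev) (z : Ev) (s : seq Ev) (j : E + Ev).

(* A cover sends every base edge to the piece containing it: the edge itself ([inl])
   or the set of an event ([inr]).  A step at [z] fuses the selected pieces into
   [inr z] when their total size is at least 33/32 times its size; the total size of
   the pieces then drops by a fixed fraction of the fused weight, so that all fused
   weights together are bounded by the initial total. *)
Definition alive cov : {set E + Ev} := cov @: Bs.
Definition picked cov z : {set E + Ev} := [set j in alive cov | sel z j].
Definition weight cov z : nat := \sum_(j in picked cov z) hsize j.
Definition total cov : nat := \sum_(j in alive cov) hsize j.
Definition collapses cov z : bool := 33 * hsize (inr z) <= 32 * weight cov z.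
Definition step cov z : E -> E + Ev :=
  fun e => if collapses cov z && sel z (cov e) then inr z else cov e.
Definition cover s : E -> E + Ev := foldl step inl s.
Definition before s z : E -> E + Ev := cover (take (index z s) s).

Lemma cover_rcons s z : cover (rcons s z) = step (cover s) z.
Proof. by rewrite /cover -cats1 foldl_cat. Qed.

Lemma before_rcons s a z : z \in s -> before (rcons s a) z = before s z.
Proof.
move=> zs; rewrite /before -cats1 index_cat zs take_cat.
by rewrite index_mem zs.
Qed.

Lemma before_last s z : z \notin s -> before (rcons s z) z = cover s.
Proof.
by move=> zs; rewrite /before -cats1 index_cat (negPf zs) /= eqxx addn0 take_size_cat.
Qed.

Lemma total_step cov z :
  collapses cov z -> total (step cov z) + weight cov z <= total cov + hsize (inr z).
Proof.
move=> cz.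
have sub : alive (step cov z) \subset inr z |: (alive cov :\: picked cov z).
  apply/subsetP => _ /imsetP[e eB ->]; rewrite /step cz /=.
  case: ifP => sj; first by rewrite !inE eqxx.
  by rewrite !inE sj !andbF /= imset_f ?orbT.
have -> : total cov = \sum_(j in picked cov z) hsize j
    + \sum_(j in alive cov :\: picked cov z) hsize j.
  rewrite /total (big_setID (picked cov z)) /=; congr (_ + _).
  by apply: eq_bigl => j; rewrite !inE andbA andbb.
have : total (step cov z) <= hsize (inr z) + \sum_(j in alive cov :\: picked cov z) hsize j.
  apply: leq_trans (_ : \sum_(j in inr z |: (alive cov :\: picked cov z)) hsize j <= _).
    rewrite /total [X in _ <= X](big_setID (alive (step cov z))) /=.
    by rewrite (setIidPr sub) leq_addr.
  have [h|h] := boolP (inr z \in alive cov :\: picked cov z).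
    by rewrite (setUidPr _) ?sub1set // leq_addl.
  by rewrite big_setU1.
rewrite -/(weight cov z); lia.
Qed.

Lemma coarsening_weight s : uniq s ->
  \sum_(z <- s | collapses (before s z) z) weight (before s z) z
   <= 33 * \sum_(e in Bs) hsize (inl e).
Proof.
move=> us.
have t0 : total inl = \sum_(e in Bs) hsize (inl e).
  by rewrite /total /alive big_imset //= => a b _ _ [].
(* The potential is the weight fused so far plus 33 times [total]: a collapse lowers [total] by at
   least 1 / 33 of the weight, because the new piece has at most 32 / 33 of it. *)
suff : \sum_(z <- s | collapses (before s z) z) weight (before s z) z
    + 33 * total (cover s) <= 33 * total inl by rewrite t0; lia.
elim/last_ind: s us => [|s a IH]; first by rewrite big_nil.
rewrite rcons_uniq => /andP[as_ us]; have {IH} := IH us.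
rewrite sum_rcons before_last //.
have -> : \sum_(i <- s | collapses (before (rcons s a) i) i) weight (before (rcons s a) i) i
     = \sum_(z <- s | collapses (before s z) z) weight (before s z) z.
  rewrite big_seq_cond [RHS]big_seq_cond; apply: eq_big => [z|z].
    by have [zs|] := boolP (z \in s); rewrite //= before_rcons.
  by case/andP=> zs _; rewrite before_rcons.
rewrite cover_rcons; have := @total_step (cover s) a.
rewrite /collapses; case: ifP => [cz /(_ isT)|cz _]; first by lia.
by rewrite /step /collapses cz /= addn0.
Qed.

Lemma cover_inl s e e' : cover s e = inl e' -> e' = e.
Proof.
elim/last_ind: s => [[]//|s z IH]; rewrite cover_rcons /step.
by case: ifP.
Qed.

Lemma cover_inr s e z : cover s e = inr z -> z \in s.
Proof.
elim/last_ind: s => [//|s a IH]; rewrite cover_rcons /step mem_rcons inE.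
by case: ifP => [_ [->]|_ /IH ->]; rewrite ?eqxx ?orbT.
Qed.

Lemma cover_hset s e v : (forall z j, sel z j -> hset j \subset hset (inr z)) ->
  v \in hset (inl e) -> v \in hset (cover s e).
Proof.
move=> hsel ve; elim/last_ind: s => [//|s z IH]; rewrite cover_rcons /step.
by case: ifP => // /andP[_ /hsel/subsetP]; apply.
Qed.

(** The cover changes only at collapses, so [Phi] grows by at most what these pay. This serves for
    the count of disagreements around a place. *)
Lemma cover_potential s (Phi : (E -> E + Ev) -> nat) (inc : Ev -> nat) : uniq s ->
    (forall s1 z s2, s = s1 ++ z :: s2 -> collapses (cover s1) z ->
       Phi (step (cover s1) z) <= Phi (cover s1) + inc z) ->
  Phi (cover s) <= Phi inl + \sum_(z <- s | collapses (before s z) z) inc z.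
Proof.
elim/last_ind: s => [|s a IH]; first by rewrite big_nil addn0.
rewrite rcons_uniq => /andP[as_ us] H.
have {}IH : Phi (cover s) <= Phi inl + \sum_(z <- s | collapses (before s z) z) inc z.
  by apply: IH => // s1 z s2 es; apply: (H s1 z (rcons s2 a)); rewrite es rcons_cat.
rewrite sum_rcons before_last //.
have -> : \sum_(i <- s | collapses (before (rcons s a) i) i) inc i
     = \sum_(z <- s | collapses (before s z) z) inc z.
  rewrite big_seq_cond [RHS]big_seq_cond; apply: eq_bigl => z.
  by have [zs|] := boolP (z \in s); rewrite //= before_rcons.
rewrite cover_rcons addnA; case: ifP => cz.
  apply: leq_trans (H s a [::] _ cz) _; first by rewrite cats1.
  by rewrite leq_add2r.
by rewrite addn0 /step cz.
Qed.

End Coarsening.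

End Coarsening.
Import Coarsening.

(** * Percolation along separated links of geometric scales *)

Module Percolation.
Local Open Scope nat_scope.

Section Percolation.
Variables (V I Z Y : finType) (x : V -> I -> bool).
Variables (ctr : Z -> V) (a b : Z -> Y) (pos : Y -> V) (sc : Z -> nat).
Variables (R0 Q : nat) (S : {set Z}).
Notation d := (dist x).
Notation R n := (R0 * Q ^ n).
Hypothesis Q16 : 16 <= Q.
Hypothesis R0pos : 0 < R0.
Hypothesis a_near : forall z, z \in S -> d (ctr z) (pos (a z)) <= R (sc z).
Hypothesis b_near : forall z, z \in S -> d (ctr z) (pos (b z)) <= R (sc z).
Hypothesis sep : forall z z', z \in S -> z' \in S -> sc z = sc z' -> z != z' ->
  4 * R (sc z) <= d (ctr z) (ctr z').

Definition belowS n z := (z \in S) && (sc z < n).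

(** Components of lower scale have diameter at most 5/16 of [R n], and the ends of a link lie within
    [R n] of its centre. As centres of one scale are [4 * R n] apart, a walk meets at most one link
    of scale [n], though perhaps repeatedly. *)
Lemma percolation_step n u v :
    (forall u v, conn a b (belowS n) u v -> d (pos u) (pos v) * Q <= 5 * R n) ->
    conn a b (belowS n.+1) u v ->
  conn a b (belowS n) u v \/
  exists z e1 e2, [/\ z \in S, sc z = n, (e1 == a z) || (e1 == b z), (e2 == a z) || (e2 == b z)
    & conn a b (belowS n) u e1 /\ conn a b (belowS n) v e2].
Proof.
move=> bd c.
have near z e1 : z \in S -> (e1 == a z) || (e1 == b z) -> d (ctr z) (pos e1) <= R (sc z).
  by move=> zS /orP[] /eqP ->; [exact: a_near | exact: b_near].
apply: (conn_closed (S := fun v => conn a b (belowS n) u v \/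
  exists z e1 e2, [/\ z \in S, sc z = n, (e1 == a z) || (e1 == b z),
    (e2 == a z) || (e2 == b z)
    & conn a b (belowS n) u e1 /\ conn a b (belowS n) v e2])) c _; last first.
  by left; exact: conn_refl.
move=> z s t /andP[zS zn] l Hs.
have endz : ((s == a z) || (s == b z)) /\ ((t == a z) || (t == b z)).
  by case/lnkP: l => [[-> ->]|[-> ->]]; rewrite !eqxx ?orbT.
move: zn; rewrite ltnS leq_eqVlt => /orP[/eqP zn|zn]; last first.
  have st : conn a b (belowS n) s t by apply: conn_lnk l; rewrite /belowS zS.
  case: Hs => [us|[z' [e1 [e2 [z'S z'n h1 h2 [c1 c2]]]]]].
    by left; exact: conn_trans us st.
  right; exists z', e1, e2; split=> //; split=> //.
  by apply: conn_trans c2; rewrite conn_sym.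
case: Hs => [us|[z' [e1 [e2 [z'S z'n h1 h2 [c1 c2]]]]]].
  right; exists z, s, t; split=> //; [exact: endz.1 | exact: endz.2 |].
  by split=> //; exact: conn_refl.
suff ez : z = z'.
  subst z'; right; exists z, e1, t; split=> //; first exact: endz.2.
  by split=> //; exact: conn_refl.
apply/eqP; apply: contraT => nz.
have h := sep zS z'S (etrans zn (esym z'n)) nz.
have h3 := bd _ _ c2.
have h4 := near _ _ zS endz.1; have h5 := near _ _ z'S h2.
have h6 := dist_tri x (pos s) (ctr z) (ctr z').
have h7 := dist_tri x (pos e2) (pos s) (ctr z').
rewrite (distC x (pos e2)) in h7.
rewrite zn in h h4; rewrite z'n in h5.
have h8 : d (pos s) (pos e2) * 16 <= 5 * R n by apply: leq_trans h3; rewrite leq_mul2l Q16 orbT.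
have Rpos : 0 < R n by rewrite muln_gt0 R0pos expn_gt0 (leq_trans _ Q16).
by move: (R n) h h4 h5 h8 Rpos => r; move: h6 h7; clear; lia.
Qed.

(* Centres of one scale are separated and the scales grow geometrically, so pieces
   connected by edges of scale below [n] remain small compared with [R n]. *)
Lemma percolation n u v :
  conn a b (belowS n) u v -> d (pos u) (pos v) * Q <= 5 * R n.
Proof.
elim: n u v => [|n IH] u v c.
  suff -> : u = v by rewrite distxx.
  by apply: (conn_closed (S := fun v => u = v)) c erefl => e s t; rewrite /belowS ltn0 andbF.
have eR : R n.+1 = Q * R n by rewrite expnS; lia.
case: (percolation_step IH c) => [/IH h|]; first by rewrite eR; apply: leq_trans h _; rewrite leq_mul2l leq_pmull // (leq_trans _ Q16).
move=> [z [e1 [e2 [zS zn h1 h2 [/IH c1 /IH c2]]]]].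
have near e : (e == a z) || (e == b z) -> d (ctr z) (pos e) <= R n.
  by rewrite -zn => /orP[] /eqP ->; [exact: a_near | exact: b_near].
have := near _ h1; have := near _ h2.
have h6 := dist_tri x (pos e1) (pos u) (pos v).
have h7 := dist_tri x (ctr z) (pos e1) (pos v).
have h8 := dist_tri x (pos e2) (ctr z) (pos v).
rewrite (distC x (pos e1) (ctr z)) in h7.
rewrite (distC x (pos e2) (pos v)) in h8.
have h9 : d (pos u) (pos e1) * 16 <= 5 * R n by apply: leq_trans c1; rewrite leq_mul2l Q16 orbT.
have h10 : d (pos v) (pos e2) * 16 <= 5 * R n by apply: leq_trans c2; rewrite leq_mul2l Q16 orbT.
move=> h11 h12; rewrite eR (mulnC Q) mulnA leq_mul2r.
by apply/orP; right; move: (R n) h9 h10 h11 h12 => r; move: h6 h7 h8; clear; lia.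
Qed.

End Percolation.

End Percolation.
Import Percolation.

(** * The total radius of the places *)

Module Places.
Local Open Scope nat_scope.

Lemma sum_level_ge n a : \sum_(s < n) (a <= s) = n - a.
Proof.
elim: n => [|n IH]; first by rewrite big_ord0.
rewrite big_ord_recr /= IH; case: (leqP a n) => h; rewrite /=; clear -h; lia.
Qed.

Lemma sum_level_window n a b : \sum_(s < n) (a <= s < a + b) <= b.
Proof.
have h : \sum_(s < n) (a <= s < a + b) + \sum_(s < n) (a + b <= s) = \sum_(s < n) (a <= s).
  rewrite -big_split /=; apply: eq_bigr => s _.
  case: (leqP a s); case: (leqP (a + b) s); rewrite //=; clear; lia.
rewrite !sum_level_ge in h; clear -h; lia.
Qed.

Lemma sum_card_exchange (E I : finType) (S : {set E}) (P : E -> I -> bool) :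
  \sum_(z in S) #|[set i | P z i]| = \sum_i #|[set z in S | P z i]|.
Proof.
under eq_bigr => z _ do rewrite -sum1_card big_mkcond.
rewrite exchange_big; apply: eq_bigr => i _; rewrite -sum1_card -big_mkcondr /=.
by apply: eq_bigl => z; rewrite !inE.
Qed.

Lemma card_sub3 (T : finType) (A B C D : {set T}) :
  A \subset B :|: C :|: D -> #|A| <= #|B| + #|C| + #|D|.
Proof.
move/subset_leq_card => h; apply: (leq_trans h).
by apply: leq_trans (card_setU_le _ _) _; rewrite leq_add2r card_setU_le.
Qed.

(** A discrete co-area inequality: the distances from [c] to points of [H] lie between their minimum
    and this minimum plus [b]. *)
Lemma level_crossings (V I : finType) (x : V -> I -> bool) (H : {set V}) b c n :
    {in H &, forall u v, dist x u v <= b} ->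
  \sum_(s < n) [exists u in H, exists v in H, dist x c u <= s < dist x c v] <= b.
Proof.
move=> diam; have [u0 hu0|h0] := pickP (mem H); last first.
  rewrite big1 // => s _; apply/eqP; rewrite eqb0; apply/existsP => -[u /andP[]].
  by have := h0 u; rewrite /= => ->.
case: (@arg_minnP _ u0 (mem H) (dist x c) hu0) => u hu umin.
apply: leq_trans (sum_level_window n (dist x c u) b).
apply: leq_sum => s _; case: existsP => // -[a /andP[ha /existsP[v /andP[hv /andP[h1 h2]]]]].
have h3 := umin a ha; have h4 := diam u v hu hv; have h5 := dist_tri x u c v.
by rewrite (leq_trans h3 h1) (leq_trans h2) // (leq_trans h5) // leq_add2l.
Qed.

Lemma sum_bool_card (T : finType) (S : {set T}) (P : pred T) :
  \sum_(j in S) P j = #|[set j in S | P j]|.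
Proof.
rewrite -sum1_card (eq_bigr (fun j => if P j then 1 else 0)); last by move=> j _; case: P.
by rewrite -big_mkcondr; apply: eq_bigl => j; rewrite inE.
Qed.

Lemma sum_injective_le (T : finType) (S : {set T}) (m : T -> nat) n (F : nat -> nat) :
    {in S &, injective m} -> (forall z, z \in S -> m z < n) ->
  \sum_(z in S) F (m z) <= \sum_(k < n) F k.
Proof.
move=> inj lt.
have -> : \sum_(z in S) F (m z) = \sum_(z in S) \sum_(k < n) (m z == k) * F k.
  apply: eq_bigr => z zS; rewrite (bigD1 (Ordinal (lt z zS))) //= eqxx mul1n.
  rewrite big1 ?addn0 // => k nk; rewrite eq_sym.
  by have /negPf -> : nat_of_ord k != m z by apply: contra nk => /eqP h; apply/eqP/val_inj.
rewrite exchange_big; apply: leq_sum => k _; rewrite -big_distrl /=.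
rewrite -[X in _ <= X]mul1n leq_mul2r; apply/orP; right.
rewrite sum_bool_card; apply/card_le1_eqP => a b.
rewrite !inE => /andP[aS /eqP ea] /andP[bS /eqP eb]; apply: inj => //.
by rewrite ea eb.
Qed.

Lemma sum_geometric_le Q n : 2 <= Q -> \sum_(k < n.+1) Q ^ k <= 2 * Q ^ n.
Proof.
move=> Q2; elim: n => [|n IH]; first by rewrite big_ord_recr big_ord0.
rewrite big_ord_recr /=; apply: leq_trans (leq_add IH (leqnn _)) _.
rewrite [2 * _ ^ n.+1]mul2n -addnn leq_add2r expnS leq_mul2r Q2 orbT //.
Qed.

(* A place is an edge [z] leaving the cluster [A z] inside its parent cluster [B z].
   Within a radius of order [L z] of [p z] one finds neither all of [A z] (N1) nor the
   whole tree component of [q z] in [B z :\: A z] (N2), no tree edge leaving [A z] in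
   [B z] (N3), no long tree edge (N4), no end of a larger place (N5), and no edge
   leaving the cluster of a larger place close to that place (N6).
   [Vf f] is the smallest cluster containing the tree edge [f]. *)
Record place_system (V E I : finType) (p q : E -> V) (x : V -> I -> bool)
    (TT ZZ : {set E}) (sc : E -> nat) (A B Vf : E -> {set V}) (L0 Q : nat) : Prop :=
  PlaceSystem {
    ps_L0 : 0 < L0;
    ps_Q : 1024 <= Q;
    ps_connT : forall u v, conn p q (mem TT) u v;
    ps_cardT : #|V| = #|TT|.+1;
    ps_connA : forall z, z \in ZZ -> {in A z &, forall u v,
       conn p q (fun f => (f \in TT) && in2 p q (A z) f) u v};
    ps_connB : forall z, z \in ZZ -> {in B z &, forall u v,
       conn p q (fun f => (f \in TT) && in2 p q (B z) f) u v};
    ps_VfB : forall f z, f \in TT -> z \in ZZ -> in2 p q (B z) f -> #|Vf f| <= #|B z|;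
    ps_BVf : forall f z, f \in TT -> z \in ZZ -> (p f \in B z) || (q f \in B z) ->
       #|Vf f| <= #|B z| -> in2 p q (B z) f;
    ps_AB : forall z, z \in ZZ -> A z \subset B z;
    ps_pA : forall z, z \in ZZ -> p z \in A z;
    ps_qB : forall z, z \in ZZ -> q z \in B z;
    ps_qA : forall z, z \in ZZ -> q z \notin A z;
    ps_len : forall z, z \in ZZ -> dist x (p z) (q z) <= L0 * Q ^ sc z;
    ps_sep : forall z z', z \in ZZ -> z' \in ZZ -> sc z = sc z' -> z != z' ->
       4096 * (L0 * Q ^ sc z) <= dist x (p z) (p z');
    ps_N1 : forall z, z \in ZZ -> exists2 v, v \in A z &
       1024 * (L0 * Q ^ sc z) <= dist x (p z) v;
    ps_N2 : forall z, z \in ZZ -> exists2 v,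
       conn p q (fun f => (f \in TT) && in2 p q (B z :\: A z) f) (q z) v &
       1024 * (L0 * Q ^ sc z) <= dist x (p z) v;
    ps_N3 : forall z f a b, z \in ZZ -> f \in TT -> in2 p q (B z) f -> lnk p q f a b ->
       a \in A z -> b \notin A z -> 2048 * (L0 * Q ^ sc z) < dist x (p z) a;
    ps_N4 : forall z f a b, z \in ZZ -> f \in TT -> lnk p q f a b ->
       dist x (p z) a <= 2048 * (L0 * Q ^ sc z) ->
       dist x (p f) (q f) <= 4 * (L0 * Q ^ sc z);
    ps_N5 : forall z z', z \in ZZ -> z' \in ZZ -> sc z < sc z' ->
       2048 * (L0 * Q ^ sc z) < dist x (p z) (p z') /\
       2048 * (L0 * Q ^ sc z) < dist x (p z) (q z');
    ps_N6 : forall z z' g b c, z \in ZZ -> z' \in ZZ -> sc z < sc z' ->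
       lnk p q g b c -> b \in A z' -> c \notin A z' ->
       dist x b (p z) <= 2048 * (L0 * Q ^ sc z) -> 2048 * (L0 * Q ^ sc z') < dist x b (p z')
  }.

Section Places.
Variables (V E I : finType) (p q : E -> V) (x : V -> I -> bool).
Variables (TT ZZ : {set E}) (sc : E -> nat) (A B Vf : E -> {set V}) (L0 Q : nat).
Hypothesis PS : place_system p q x TT ZZ sc A B Vf L0 Q.
Notation d := (dist x).
Notation len e := (dist x (p e) (q e)).
Notation L z := (L0 * Q ^ sc z).
Notation conn := (conn p q).
Notation lnk := (lnk p q).
Notation in2 := (in2 p q).
Notation cut e i := (x (p e) i != x (q e) i).

Lemma L_gt0 z : 0 < L z.
Proof.
by rewrite muln_gt0 (ps_L0 PS) expn_gt0 (leq_trans _ (ps_Q PS)).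
Qed.

Lemma L_lt z z' : sc z < sc z' -> 1024 * L z <= L z'.
Proof.
move=> lt; rewrite mulnCA leq_mul2l; apply/orP; right.
rewrite -(subnK lt) addnS -addSn expnD; apply: leq_mul => //.
have h := ps_Q PS.
by rewrite expnS; apply: (leq_trans h); rewrite leq_pmulr // expn_gt0 (leq_trans _ h).
Qed.

Definition inner_edge z e := in2 (A z) e && ((e \in TT) || ((e \in ZZ) && (sc e < sc z))).
Definition alpha_edge z e := inner_edge z e && in2 (ball x (p z) (1024 * L z)) e.
Definition kappa_edge z f :=
  [&& f \in TT, in2 (B z :\: A z) f & in2 (ball x (p z) (1024 * L z)) f].
Definition alpha z v := conn (alpha_edge z) (p z) v.
Definition kappa z v := conn (kappa_edge z) (q z) v.

Definition alpha_item z i e := [&& alpha_edge z e, alpha z (p e) & cut e i].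
Definition kappa_item z i e := [&& kappa_edge z e, kappa z (p e) & cut e i].
Definition parallel z : {set I} :=
  [set i | [exists e, alpha_item z i e] && [exists e, kappa_item z i e]].

Lemma alpha_ball z v : alpha z v -> d (p z) v <= 1024 * L z.
Proof.
move=> c; apply: (conn_closed (S := fun v => d (p z) v <= 1024 * L z)) c _.
  move=> e a b /andP[_ /andP[h1 h2]] l _.
  by case/lnkP: l h1 h2 => [[_ <-]|[<- _]]; rewrite !in_ball.
by rewrite distxx.
Qed.

Lemma qz_ball z : z \in ZZ -> d (p z) (q z) <= 1024 * L z.
Proof. by move/(ps_len PS) => h; apply: leq_trans h _; rewrite leq_pmull. Qed.

Lemma kappa_ball z v : z \in ZZ -> kappa z v -> d (p z) v <= 1024 * L z.
Proof.
move=> zZ c; apply: (conn_closed (S := fun v => d (p z) v <= 1024 * L z)) c _.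
  move=> e a b /and3P[_ _ /andP[h1 h2]] l _.
  by case/lnkP: l h1 h2 => [[_ <-]|[<- _]]; rewrite !in_ball.
exact: qz_ball.
Qed.

Lemma alpha_kappa_conn z u v : z \in ZZ -> (alpha z u || kappa z u) ->
  (alpha z v || kappa z v) -> conn (in2 (ball x (p z) (1024 * L z))) u v.
Proof.
move=> zZ; set P := in2 _.
have zP : P z by rewrite /P /Multigraph.in2 !in_ball distxx qz_ball.
have toz w : alpha z w || kappa z w -> conn P (p z) w.
  case/orP => c; first by apply: conn_sub c => e /andP[].
  have pq : conn P (p z) (q z) by apply: conn1.
  apply: (conn_trans pq); by apply: conn_sub c => e /and3P[].
by move=> /toz cu /toz; apply: conn_trans; rewrite conn_sym.
Qed.

(* Link a flipped edge on the [alpha] side of each parallel place to one on its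
   [kappa] side.  The links form a forest: on a cycle, the place of largest scale
   would have the other ones percolating near it and leaving its cluster, against N6. *)
Lemma parallel_coordinate i :
  #|[set z in ZZ | i \in parallel z]| <= #|[set e in TT :|: ZZ | cut e i]|.
Proof.
pose fA z := odflt z [pick e | alpha_item z i e].
pose fK z := odflt z [pick e | kappa_item z i e].
set S := [set z in ZZ | _].
have SZ z : z \in S -> z \in ZZ by rewrite inE => /andP[].
have fAP z : z \in S -> alpha_item z i (fA z).
  rewrite !inE /fA => /and3P[_ /existsP[e he] _]; case: pickP => [//|/(_ e)].
  by rewrite he.
have fKP z : z \in S -> kappa_item z i (fK z).
  rewrite !inE /fK => /and3P[_ _ /existsP[e he]]; case: pickP => [//|/(_ e)].
  by rewrite he.
have [||f] := @forest_count_in _ _ fA fK S [set e in TT :|: ZZ | cut e i] sc; last by clear; lia.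
  move=> z zS; have /and3P[/andP[/andP[_ h1] _] _ h2] := fAP z zS.
  have /and3P[/and3P[h3 _ _] _ h4] := fKP z zS.
  rewrite /Multigraph.in2 !inE h2 h3 h4 /= !andbT.
  by case/orP: h1 => [->//|/andP[-> _]]; rewrite orbT.
move=> z zS; apply/negP => c.
have zZ := SZ z zS.
pose S' := S :\ z.
have {}c : Multigraph.conn fA fK (belowS sc S' (sc z).+1) (fA z) (fK z).
  by apply: conn_sub c => z' /and3P[h1 h2 h3]; rewrite /belowS in_setD1 h1 h2 ltnS.
have S'S z' : z' \in S' -> z' \in S by rewrite in_setD1 => /andP[].
have a_near z' : z' \in S -> d (p z') (p (fA z')) <= 1024 * L0 * Q ^ sc z'.
  move/fAP=> /and3P[/andP[_ /andP[h _]] _ _].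
  by rewrite in_ball mulnA in h.
have b_near z' : z' \in S -> d (p z') (p (fK z')) <= 1024 * L0 * Q ^ sc z'.
  move/fKP=> /and3P[/and3P[_ _ /andP[h _]] _ _].
  by rewrite in_ball mulnA in h.
have sep z1 z2 : z1 \in S -> z2 \in S -> sc z1 = sc z2 -> z1 != z2 ->
    4 * (1024 * L0 * Q ^ sc z1) <= d (p z1) (p z2).
  move=> /SZ h1 /SZ h2 h3 h4; apply: leq_trans (ps_sep PS h1 h2 h3 h4).
  by rewrite -!mulnA; move: (L0 * Q ^ _) => l; clear; lia.
have Q16 : 16 <= Q by apply: leq_trans (ps_Q PS).
have L0' : 0 < 1024 * L0 by rewrite muln_gt0 (ps_L0 PS).
have perc := @percolation V I E E x p fA fK p sc (1024 * L0) Q S' Q16 L0'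
  (fun z' h => a_near z' (S'S z' h)) (fun z' h => b_near z' (S'S z' h))
  (fun z1 z2 h1 h2 => sep z1 z2 (S'S z1 h1) (S'S z2 h2)).
have /(_ (sc z) (fA z) (fK z) (perc (sc z)) c)  := @percolation_step V I E E x p fA fK p sc (1024 * L0) Q S' Q16 L0'
  (fun z' h => a_near z' (S'S z' h)) (fun z' h => b_near z' (S'S z' h))
  (fun z1 z2 h1 h2 => sep z1 z2 (S'S z1 h1) (S'S z2 h2)).
have dQ v w n : d v w * Q <= 5 * (1024 * L0 * Q ^ n) -> d v w * 1024 <= 5 * (1024 * (L0 * Q ^ n)).
  by rewrite -(mulnA 1024) => h; apply: leq_trans h; rewrite leq_mul2l (ps_Q PS) orbT.
(* A second link of the scale of [z] is refuted first, by separation. In the other case the walk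
   leaves [A z] along a link of smaller scale. *)
case=> [{}c|[z1 [e1 [e2 [z1S z1n h1 _ [c1 _]]]]]]; last first.
  move: (z1S); rewrite in_setD1 => /andP[n1 z1S'].
  have := ps_sep PS (SZ _ z1S') zZ z1n n1; have := dQ _ _ _ (perc _ _ _ c1).
  have := a_near z zS; have : d (p z1) (p e1) <= 1024 * L0 * Q ^ sc z.
    by rewrite -z1n; case/orP: h1 => /eqP ->; [exact: a_near | exact: b_near].
  have := dist_tri x (p e1) (p z1) (p z); have := dist_tri x (p (fA z)) (p e1) (p z).
  rewrite (distC x (p e1) (p (fA z))) (distC x (p (fA z)) (p z)) z1n.
  have := L_gt0 z; rewrite -!mulnA; move: (L z) => l; clear; lia.
have [||zj [s [t [Pzj l]]]] := conn_exit (W := [set e | p e \in A z]) c.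
- by rewrite inE; have /and3P[/andP[/andP[/andP[]]]] := fAP z zS.
- rewrite inE; have /and3P[/and3P[_ /andP[h _] _] _ _] := fKP z zS.
  by move: h; rewrite inE => /andP[].
rewrite !inE => sA tA c1.
have {}c1 : Multigraph.conn fA fK (belowS sc S' (sc z)) (fA z) s by apply: conn_sub c1 => ? /andP[].
have ds := dQ _ _ _ (perc _ _ _ c1).
case/andP: Pzj => /S'S zjS zjn; have zjZ := SZ _ zjS.
have kA : alpha zj (p (fA zj)) by case/and3P: (fAP zj zjS).
have kK : kappa zj (p (fK zj)) by case/and3P: (fKP zj zjS).
have c2 : conn (in2 (ball x (p zj) (1024 * L zj))) (p s) (p t).
  by case/lnkP: l => [[<- <-]|[<- <-]]; apply: alpha_kappa_conn; rewrite ?kA ?kK ?orbT.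
have [g [b [c0 [gb lg bA cA _]]]] := conn_exit c2 sA tA.
have db : d (p zj) b <= 1024 * L zj.
  by case/andP: gb; rewrite !in_ball; case/lnkP: lg => [[-> ->]|[-> ->]].
have dzs : d (p zj) (p s) <= 1024 * L zj.
  by rewrite mulnA; case/lnkP: l => [[<- _]|[_ <-]]; [exact: a_near | exact: b_near].
have h1 : d b (p zj) <= 2048 * L zj by rewrite distC; apply: leq_trans db _; rewrite leq_mul2r orbT.
have := ps_N6 PS zjZ zZ zjn lg bA cA h1; have := L_lt zjn.
have := a_near z zS; rewrite -mulnA.
have := dist_tri x (p zj) b (p z); have := dist_tri x (p s) (p zj) (p z).
have := dist_tri x (p (fA z)) (p s) (p z).
rewrite (distC x (p (fA z)) (p z)) (distC x b (p zj)) (distC x (p s) (p (fA z))).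
have := L_gt0 z; move: (L z) (L zj) ds db dzs => l1 l2; clear; lia.
Qed.

(** The places stand on the right as well, since they may be steps on the [alpha] side; the
    constants of [places_sum] absorb them. *)
Lemma sum_parallel : \sum_(z in ZZ) #|parallel z| <= \sum_(e in TT :|: ZZ) len e.
Proof.
rewrite (sum_card_exchange ZZ (fun z i => [exists e, alpha_item z i e] && [exists e, kappa_item z i e])).
rewrite (sum_card_exchange (TT :|: ZZ) (fun e i => cut e i)).
apply: leq_sum => i _; apply: leq_trans (parallel_coordinate i).
by apply: subset_leq_card; apply/subsetP => z; rewrite !inE.
Qed.

Definition tip_at z i := (x (p z) i == x (q z) i) &&
  [forall v, conn (fun e => inner_edge z e && ~~ cut e i) (p z) v ==>
     (d (p z) v <= 1024 * L z)].

Definition tip z : {set I} := [set i | tip_at z i].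

(** A place in the tree would be a tree edge leaving its own cluster at distance 0, against N3. *)
Lemma ZZ_notin_TT z : z \in ZZ -> z \notin TT.
Proof.
move=> zZ; apply/negP => zT.
have pA := ps_pA PS zZ.
have zB : in2 (B z) z.
  by rewrite /Multigraph.in2 (ps_qB PS zZ) (subsetP (ps_AB PS zZ) _ pA).
have := ps_N3 PS zZ zT zB (lnk_pq _ _ z) pA (ps_qA PS zZ).
by rewrite distxx.
Qed.

Lemma tree_acyclic f : f \in TT ->
  ~~ conn (fun e => (e \in TT) && (e != f)) (p f) (q f).
Proof.
move=> fT; apply/negP => c.
have : #|V| <= #|TT :\ f|.+1.
  apply: (@connected_count _ _ p q) => u v; apply: conn_mono (ps_connT PS u v) => e eT.
  have [->|ne] := eqVneq e f; first by apply: conn_sub c => g; rewrite !inE andbC.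
  by apply: conn1; rewrite !inE ne.
rewrite (ps_cardT PS) (cardsD1 f) fT; clear; lia.
Qed.

(** Doubling breaks ties in favour of tree edges. A place scanned before a tree edge has a parent
    cluster too small to contain that edge, while a tree edge scanned before a place and meeting its
    parent cluster lies inside that cluster. *)
Definition tip_key e := if e \in ZZ then (#|B e|).*2.+1 else (#|Vf e|).*2.

(* The uncut tree edges and the tip places form a forest on [V], and the uncut tree
   edges alone leave exactly one component more than there are cut tree edges. *)
Lemma tip_coordinate i :
  #|[set z in ZZ | i \in tip z]| <= #|[set e in TT | cut e i]|.
Proof.
set Zi := [set z in ZZ | _].
set S := [set e in TT | ~~ cut e i] :|: Zi.
have ZiP z : z \in Zi -> z \in ZZ /\ tip_at z i by rewrite !inE => /andP.
have Suncut e : e \in S -> ~~ cut e i.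
  rewrite in_setU => /orP[|/ZiP[_ /andP[/eqP->]]]; last by rewrite eqxx.
  by rewrite !inE => /andP[].
have cS : #|S| = #|[set e in TT | ~~ cut e i]| + #|Zi|.
  rewrite -cardsUI (_ : _ :&: _ = set0) ?cards0 ?addn0 //.
  apply/setP => e; rewrite in_setI in_set0; apply/negbTE/andP => -[].
  by rewrite inE => /andP[eT _] /ZiP[/ZZ_notin_TT]; rewrite eT.
have cT : #|TT| = #|[set e in TT | ~~ cut e i]| + #|[set e in TT | cut e i]|.
  rewrite -cardsUI (_ : _ :&: _ = set0) ?cards0 ?addn0 //; last first.
    by apply/setP => e; rewrite !inE; case: (_ == _) => /=; rewrite ?andbF.
  by congr #|pred_of_set _|; apply/setP => e; rewrite !inE; case: (_ == _); rewrite ?andbT ?andbF ?orbF.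
suff : #|S| <= #|V|.-1 by rewrite (ps_cardT PS) cS cT /=; clear; lia.
apply: (@forest_count _ _ p q S tip_key) => e eS; apply/negP => c.
have [eZ|eZ] := boolP (e \in ZZ); last first.
  have eT : e \in TT.
    move: eS; rewrite in_setU => /orP[|/ZiP[]]; last by rewrite (negPf eZ).
    by rewrite inE => /andP[].
  apply/negP: (tree_acyclic eT); rewrite negbK.
  (* Each place on the cycle is replaced by the tree walk in its parent cluster, which avoids [e]
     because that cluster does not contain it. *)
  apply: conn_mono c => g /and3P[gS ge kg].
  have [gZ|gZ] := boolP (g \in ZZ); last first.
    apply: conn1; rewrite ge andbT; move: gS; rewrite in_setU => /orP[|/ZiP[]].
      by rewrite inE => /andP[].
    by rewrite (negPf gZ).
  have pB : p g \in B g by apply: (subsetP (ps_AB PS gZ)); exact: (ps_pA PS).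
  apply: conn_sub (ps_connB PS gZ pB (ps_qB PS gZ)) => f /andP[fT fB].
  rewrite fT /=; apply/eqP => fe; subst f.
  have := ps_VfB PS fT gZ fB; move: kg; rewrite /tip_key gZ (negPf eZ).
  clear; lia.
have [_ /andP[_ /forallP tipe]] : e \in ZZ /\ tip_at e i.
  apply: ZiP; move: eS; rewrite in_setU => /orP[|//].
  by rewrite inE (negPf (ZZ_notin_TT eZ)).
(* The first edge by which the cycle leaves the cluster of [e] is near [e], as walks that do not
   flip a tip coordinate stay near. A tree edge there contradicts N3; a place of smaller, larger or
   equal scale contradicts N6, N5 or separation. *)
have [g [a [b [/and3P[gS ge kg] lg aA bA c1]]]] := conn_exit c (ps_pA PS eZ) (ps_qA PS eZ).
have lz0 := L_gt0 e.
have c2 v : conn (fun e0 => (e0 \in S) && (e0 != e) && (tip_key e0 <= tip_key e) && in2 (A e) e0) (p e) v ->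
    conn (fun e0 => inner_edge e e0 && ~~ cut e0 i) (p e) v.
  move=> cv; apply: (conn_closed (S := fun v =>
    conn (fun e0 => inner_edge e e0 && ~~ cut e0 i) (p e) v)) cv (conn_refl _ _ _ _).
  move=> h s t /andP[/andP[/andP[hS he] kh] hA] lh cs.
  apply: (conn_trans cs); apply: (conn_lnk _ lh).
  rewrite (Suncut _ hS) andbT /inner_edge hA /=.
  have [hZ|hZ] := boolP (h \in ZZ); last first.
    move: hS; rewrite in_setU => /orP[|/ZiP[]]; last by rewrite (negPf hZ).
    by rewrite inE => /andP[-> _].
  rewrite orbC /=; apply/orP; left.
  have ds : d (p e) s <= 1024 * L e by move: (tipe s); rewrite cs.
  rewrite ltnNge leq_eqVlt; apply/negP => /orP[/eqP es|lt].
    have ne : e != h by rewrite eq_sym.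
    have := ps_sep PS eZ hZ es ne; have := ps_len PS hZ; rewrite -es.
    have : d s (p h) <= len h.
      by case/lnkP: lh => [[<- _]|[_ <-]]; rewrite ?distxx // distC.
    have := dist_tri x s (p e) (p h); move: (L e) lz0 ds => l; clear; lia.
  have [n1 n2] := ps_N5 PS eZ hZ lt.
  have : 2048 * L e < d (p e) s by case/lnkP: lh => [[<- _]|[_ <-]].
  move: (L e) lz0 ds => l; clear; lia.
have da : d (p e) a <= 1024 * L e.
  have := tipe a; rewrite c2 //.
  by apply: conn_sub c1 => h /andP[/and3P[-> -> ->] ->].
have [gZ|gZ] := boolP (g \in ZZ); last first.
  have gT : g \in TT.
    move: gS; rewrite in_setU => /orP[|/ZiP[]]; last by rewrite (negPf gZ).
    by rewrite inE => /andP[].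
  have gB : in2 (B e) g.
    apply: (ps_BVf PS gT eZ).
      have aB := subsetP (ps_AB PS eZ) _ aA.
      by case/lnkP: lg => [[-> _]|[_ ->]]; rewrite aB ?orbT.
    move: kg; rewrite /tip_key eZ (negPf gZ); clear; lia.
  have := ps_N3 PS eZ gT gB lg aA bA; move: (L e) lz0 da => l; clear; lia.
case: (ltngtP (sc g) (sc e)) => [lt|lt|es].
- have h1 : d a (p g) <= L g.
    apply: leq_trans (ps_len PS gZ).
    by case/lnkP: lg => [[<- _]|[_ <-]]; rewrite ?distxx // distC.
  have h2 : d a (p g) <= 2048 * L g.
    by apply: (leq_trans h1); rewrite leq_pmull.
  have := ps_N6 PS gZ eZ lt lg aA bA h2; rewrite distC; move: (L e) lz0 da => l; clear; lia.
- have [n1 n2] := ps_N5 PS eZ gZ lt.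
  have : 2048 * L e < d (p e) a by case/lnkP: lg => [[<- _]|[_ <-]].
  move: (L e) lz0 da => l; clear; lia.
have ne : e != g by rewrite eq_sym.
have := ps_sep PS eZ gZ (esym es) ne; have := ps_len PS gZ; rewrite es.
have : d a (p g) <= len g.
  by case/lnkP: lg => [[<- _]|[_ <-]]; rewrite ?distxx // distC.
have := dist_tri x a (p e) (p g); move: (L e) lz0 da => l; clear; lia.
Qed.

Lemma sum_tip : \sum_(z in ZZ) #|tip z| <= \sum_(e in TT) len e.
Proof.
rewrite (sum_card_exchange ZZ tip_at) (sum_card_exchange TT (fun e i => cut e i)).
apply: leq_sum => i _; apply: leq_trans (tip_coordinate i).
by apply: subset_leq_card; apply/subsetP => z; rewrite !inE.
Qed.

(** The radius 1028 is 1024 for the walks plus 4 for the size of a piece that meets them, see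
    [cover_small]; 2056 is the resulting diameter. *)
Definition hset (j : E + E) : {set V} :=
  match j with inl e => [set p e; q e] | inr z => ball x (p z) (1028 * L z) end.
Definition hsize (j : E + E) : nat :=
  match j with inl e => len e | inr z => 2056 * L z end.
Definition sel z j := hset j \subset ball x (p z) (1028 * L z).
Let Bs := TT :|: ZZ.
Notation alive := (alive Bs).
Notation picked := (picked Bs sel).
Notation weight := (weight Bs hsize sel).
Notation collapses := (collapses Bs hsize sel).
Notation step := (step Bs hsize sel).
Notation cover := (cover Bs hsize sel).
Notation before := (before Bs hsize sel).

Definition schedule := sort (fun e e' => sc e <= sc e') (enum ZZ).

Lemma mem_schedule z : (z \in schedule) = (z \in ZZ).
Proof. by rewrite mem_sort mem_enum. Qed.

Lemma uniq_schedule : uniq schedule.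
Proof. by rewrite sort_uniq enum_uniq. Qed.

Lemma schedule_prefix s1 z s2 : schedule = s1 ++ z :: s2 ->
  [/\ z \in ZZ, before schedule z = cover s1, z \notin s1 &
   forall z', z' \in s1 -> [/\ z' \in ZZ, z' != z & sc z' <= sc z]].
Proof.
move=> es; have [zZ h] := sorted_key_prefix es.
have z1 : z \notin s1.
  have := uniq_schedule; rewrite es cat_uniq => /and3P[_ /hasPn/(_ z (mem_head _ _)) //].
split=> // [|z' /h /and3P[h1 h2 h3] //].
by rewrite /Coarsening.before es index_cat (negPf z1) /= eqxx addn0 take_size_cat.
Qed.

Lemma hset_diam j u v : u \in hset j -> v \in hset j -> d u v <= hsize j.
Proof.
case: j => [e|z] /=; last first.
  rewrite !in_ball => h1 h2; have := dist_tri x (p z) u v; rewrite (distC x u (p z)).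
  move: (L z) h1 h2 => l; clear; lia.
by rewrite !inE => /orP[] /eqP-> /orP[] /eqP->; rewrite ?distxx // distC.
Qed.

Lemma sel_hset z j : sel z j -> hset j \subset hset (inr z).
Proof. by []. Qed.

Lemma lnk_hset s e u v : lnk e u v -> (u \in hset (cover s e)) /\ (v \in hset (cover s e)).
Proof.
move=> l; split; apply: cover_hset => //; first [exact: sel_hset | idtac];
by case/lnkP: l => [[h1 h2]|[h1 h2]]; rewrite /= !inE -?h1 -?h2 eqxx ?orbT.
Qed.

Section AtPlace.
Variable z : E.
Variables (s1 s2 : seq E).
Hypothesis split_schedule : schedule = s1 ++ z :: s2.
Notation c := (p z).
Notation l := (L z).

Let zZ : z \in ZZ.
Proof. by have [] := schedule_prefix split_schedule. Qed.

Let s1P z' : z' \in s1 -> [/\ z' \in ZZ, z' != z & sc z' <= sc z].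
Proof. by have [_ _ _] := schedule_prefix split_schedule; apply. Qed.

(** Places of one scale are too far apart for the ball of one to meet the walks of the other. So the
    earlier place has smaller scale, where its radius is negligible. *)
Lemma near_earlier z' u : z' \in s1 -> d c u <= 1024 * l -> d (p z') u <= 1028 * L z' ->
  sc z' < sc z /\ d c (p z') <= 1100 * l.
Proof.
move=> /s1P[z'Z ne le] h1 h2.
have h3 := dist_tri x u c (p z'); rewrite (distC x u (p z')) in h3.
have l0 := L_gt0 z.
have lt : sc z' < sc z.
  rewrite ltn_neqAle le andbT; apply/eqP => es; rewrite eq_sym in ne.
  have := ps_sep PS zZ z'Z (esym es) ne; move: h1 h2 h3 l0; rewrite es.
  move: l; clear; lia.
split=> //; have := L_lt lt; move: h1 h2 h3 l0; move: (L z') l (d c (p z')) (d c u) (d (p z') u) => a b; clear; lia.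
Qed.

(** Tree edges are controlled by N4, smaller places by the growth of the scales, fused balls by
    [near_earlier]. *)
Lemma cover_small t e u v : {subset t <= s1} ->
    (e \in TT) || ((e \in ZZ) && (sc e < sc z)) ->
    lnk e u v -> d c u <= 1024 * l ->
  hsize (cover t e) <= 4 * l.
Proof.
move=> ts eT le du; have [hu hv] := lnk_hset t le.
case E1 : (cover t e) => [e'|z'] /=; last first.
  move: hu; rewrite E1 in_ball => hu.
  have [lt _] := near_earlier (ts _ (cover_inr E1)) du hu.
  have := L_lt lt; move: (L z') l; clear; lia.
rewrite (cover_inl E1); case/orP: eT => [eT|/andP[eZ lt]].
  by apply: (ps_N4 PS zZ eT le); apply: (leq_trans du); rewrite leq_mul2r orbT.
have := ps_len PS eZ; have := L_lt lt; move: (L e) l (len e); clear; lia.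
Qed.

Lemma cover_picked e u v :
    (e \in TT) || ((e \in ZZ) && (sc e < sc z)) ->
    lnk e u v -> d c u <= 1024 * l ->
  cover s1 e \in picked (cover s1) z.
Proof.
move=> eT le du; have [hu hv] := lnk_hset s1 le.
rewrite inE /Coarsening.alive imset_f /=; last first.
  by rewrite in_setU; case/orP: eT => [->//|/andP[->]]; rewrite orbT.
have small := cover_small (fun _ h => h) eT le du.
apply/subsetP => w hw; rewrite in_ball; have := hset_diam hu hw.
have := dist_tri x u c w; move: l du small; clear; lia.
Qed.

Definition alpha_crossing s e u v := [&& inner_edge z e, lnk e u v, alpha z u & d c u <= s < d c v].
Definition kappa_crossing s e u v :=
  [&& (e \in TT) && in2 (B z :\: A z) e, lnk e u v, kappa z u & d c u <= s < d c v].

Lemma alpha_crossing_ex s : s < 1024 * l -> exists e u v, alpha_crossing s e u v.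
Proof.
move=> sR; have [v vA dv] := ps_N1 PS zZ.
have [||e [a [b [/andP[eT eA] le aW bW ca]]]] :=
   conn_exit (W := ball x c s) (ps_connA PS zZ (ps_pA PS zZ) vA).
- by rewrite in_ball distxx.
- by rewrite in_ball -ltnNge (leq_trans sR).
exists e, a, b; rewrite /alpha_crossing le /inner_edge eT eA /=.
rewrite !in_ball -?ltnNge in aW bW; rewrite aW bW !andbT.
apply: conn_sub ca => f /andP[/andP[fT fA] /andP[pb qb]].
rewrite !in_ball in pb qb.
rewrite /alpha_edge /inner_edge fA fT /Multigraph.in2 !in_ball.
by rewrite (leq_trans pb (ltnW sR)) (leq_trans qb (ltnW sR)).
Qed.

Lemma kappa_crossing_ex s : l <= s -> s < 1024 * l -> exists e u v, kappa_crossing s e u v.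
Proof.
move=> ls sR; have [v cv dv] := ps_N2 PS zZ.
have [||e [a [b [/andP[eT eA] le aW bW ca]]]] := conn_exit (W := ball x c s) cv.
- by rewrite in_ball (leq_trans (ps_len PS zZ)).
- by rewrite in_ball -ltnNge (leq_trans sR).
exists e, a, b; rewrite /kappa_crossing le eT eA /=.
rewrite !in_ball -?ltnNge in aW bW; rewrite aW bW !andbT.
apply: conn_sub ca => f /andP[/andP[fT fA] /andP[pb qb]].
rewrite !in_ball in pb qb.
rewrite /kappa_edge fA fT /Multigraph.in2 !in_ball.
by rewrite (leq_trans pb (ltnW sR)) (leq_trans qb (ltnW sR)).
Qed.

Lemma alpha_cut u i : alpha z u -> x c i != x u i -> exists e, alpha_item z i e.
Proof.
move=> cu ne.
have [||e [a [b [Pe le aW bW ca]]]] := conn_exit (W := [set w | x w i == x c i]) cu.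
- by rewrite inE.
- by rewrite inE eq_sym.
rewrite !inE in aW bW.
have ca' : alpha z a by apply: conn_sub ca => f /andP[].
have cb' : alpha z b by apply: (conn_trans ca'); apply: conn_lnk le.
exists e; rewrite /alpha_item Pe /=.
case/lnkP: le => [[-> ->]|[-> ->]]; rewrite ?ca' ?cb' /=.
  by rewrite (eqP aW) eq_sym.
by rewrite (eqP aW).
Qed.

Lemma kappa_cut u i : kappa z u -> x (q z) i != x u i -> exists e, kappa_item z i e.
Proof.
move=> cu ne.
have [||e [a [b [Pe le aW bW ca]]]] := conn_exit (W := [set w | x w i == x (q z) i]) cu.
- by rewrite inE.
- by rewrite inE eq_sym.
rewrite !inE in aW bW.
have ca' : kappa z a by apply: conn_sub ca => f /andP[].
have cb' : kappa z b by apply: (conn_trans ca'); apply: conn_lnk le.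
exists e; rewrite /kappa_item Pe /=.
case/lnkP: le => [[-> ->]|[-> ->]]; rewrite ?ca' ?cb' /=.
  by rewrite (eqP aW) eq_sym.
by rewrite (eqP aW).
Qed.

(** A coordinate in which [u] differs from [p z] but agrees with [v], and which [z] does not flip,
    is flipped on both walks and hence parallel. *)
Lemma alpha_kappa_far u v : alpha z u -> kappa z v ->
  d c u <= d u v + l + #|parallel z|.
Proof.
move=> cu cv.
have sub : diff x c u \subset diff x u v :|: diff x c (q z) :|: parallel z.
  apply/subsetP => i; rewrite !in_setU => iu.
  have [//|iuv] := boolP (i \in diff x u v).
  have [//|iq] := boolP (i \in diff x c (q z)).
  rewrite !inE !negbK /= in iuv iq iu *.
  apply/andP; split; apply/existsP; first exact: alpha_cut iu.
  by apply: (kappa_cut cv); rewrite -(eqP iq) -(eqP iuv).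
have := card_sub3 sub; rewrite -!/(dist x _ _); have := ps_len PS zZ.
move: l (d _ _) (d _ _) (d _ _) #|_|; clear; lia.
Qed.

Definition crosses j s := [exists u in hset j, exists v in hset j, d c u <= s < d c v].

Lemma crosses_count n j : \sum_(s < n) crosses j s <= hsize j.
Proof.
by apply: level_crossings => u v; exact: hset_diam.
Qed.

Lemma crossing_crosses e u v s : lnk e u v -> d c u <= s < d c v -> crosses (cover s1 e) s.
Proof.
move=> le h; have [hu hv] := lnk_hset s1 le.
by apply/existsP; exists u; rewrite hu; apply/existsP; exists v; rewrite hv.
Qed.

Lemma inner_edge_type e : inner_edge z e -> (e \in TT) || ((e \in ZZ) && (sc e < sc z)).
Proof. by case/andP. Qed.

(** A common piece would have size at most [4 * l], so by [alpha_kappa_far] it would lie within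
    [41 * l] of [p z], below level [s]. *)
Lemma crossings_distinct s e u v e' u' v' : #|parallel z| < 32 * l -> 64 * l <= s ->
  alpha_crossing s e u v -> kappa_crossing s e' u' v' -> cover s1 e != cover s1 e'.
Proof.
move=> par sl /and4P[/inner_edge_type he le au /andP[us sv]] /and4P[/andP[he' _] le' ku _].
apply/eqP => E1.
have du := alpha_ball au.
have small := cover_small (fun _ h => h) he le du.
have [hu hv] := lnk_hset s1 le; have [hu' hv'] := lnk_hset s1 le'.
rewrite -E1 in hu' hv'.
have := hset_diam hu hv; have := hset_diam hu hu'; have := alpha_kappa_far au ku.
have := dist_tri x u c v; have := L_gt0 z.
move: #|parallel z| (hsize _) l par sl us sv small; clear; lia.
Qed.

(* If a level is crossed by two pieces only, a single piece meets the [alpha] walks;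
   most coordinates being neither parallel nor tip, its inner ends disagree in many.  [Phi] counts these disagreements over all levels;
   it vanishes initially and only grows through collapses at smaller nearby places. *)
Definition inner_ends (cov : E -> E + E) s j : {set V} :=
  [set u | [exists e, exists v, (cov e == j) && alpha_crossing s e u v]].
Definition nonconst (W : {set V}) : {set I} :=
  [set i | [exists u in W, exists v in W, x u i != x v i]].
Definition Phi (cov : E -> E + E) : nat :=
  \sum_(s < 1024 * l) \sum_(j in alive cov) #|nonconst (inner_ends cov s j)|.

Hypothesis not_coll : ~~ collapses (cover s1) z.
Hypothesis not_par : #|parallel z| < 32 * l.
Hypothesis not_tip : #|tip z| < 64 * l.

Let cr s := #|[set j in picked (cover s1) z | crosses j s]|.
Let two s := (512 * l <= s) && (cr s == 2).

Lemma level_ge2 s : 64 * l <= s -> s < 1024 * l -> 2 <= cr s.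
Proof.
move=> sl sR.
have [e [u [v ac]]] := alpha_crossing_ex sR.
have l0 := L_gt0 z.
have [|e' [u' [v' kc]]] := kappa_crossing_ex _ sR.
  by apply: leq_trans sl; rewrite leq_pmull.
have ne := crossings_distinct not_par sl ac kc.
have <- : #|[set cover s1 e; cover s1 e']| = 2 by rewrite cards2 ne.
apply: subset_leq_card; apply/subsetP => j; rewrite !inE.
case/and4P: ac => [/inner_edge_type he le au hs].
case/and4P: kc => [/andP[he' _] le' ku hs'].
have := cover_picked he le (alpha_ball au).
have := @cover_picked e' u' v'; rewrite he' => /(_ isT le' (kappa_ball zZ ku)).
rewrite !inE => h1 h2.
by case/orP=> /eqP ->; rewrite ?h1 ?h2 (crossing_crosses le hs, crossing_crosses le' hs').
Qed.

Lemma sum_levels : \sum_(s < 1024 * l) cr s <= weight (cover s1) z.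
Proof.
have -> : \sum_(s < 1024 * l) cr s
   = \sum_(j in picked (cover s1) z) \sum_(s < 1024 * l) crosses j s.
  rewrite [RHS]exchange_big; apply: eq_bigr => s _; rewrite /cr -sum1_card.
  rewrite [RHS](eq_bigr (fun j => if crosses j s then 1 else 0)); last by move=> j _; case: crosses.
  by rewrite -big_mkcondr; apply: eq_bigl => j; rewrite inE.
by apply: leq_sum => j _; exact: crosses_count.
Qed.

(** Without a collapse the weight is below [2121 * l]. The levels from [64 * l] on use two pieces
    each, [1920 * l] in all, so a third piece occurs on about [201 * l] levels at most, out of the
    [512 * l] levels considered by [two]. *)
Lemma many_two : 256 * l <= \sum_(s < 1024 * l) two s.
Proof.
have h : \sum_(s < 1024 * l) ((64 * l <= s) + (64 * l <= s) + (512 * l <= s)) <= \sum_(s < 1024 * l) (cr s + two s).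
  apply: leq_sum => s _; have := @level_ge2 s; rewrite /two.
  case: (leqP (64 * l) s) => h1; last first.
    have -> : (512 * l <= s) = false by move: (nat_of_ord s) h1; move: l; clear; lia.
    by [].
  move=> /(_ isT (ltn_ord s)); case: (leqP (512 * l) s) => h2 /=.
    case: (eqVneq (cr s) 2) => h3; move: (cr s) h3; clear; lia.
  by rewrite /= !addn0.
have w := sum_levels.
rewrite !big_split /= !sum_level_ge in h.
move: not_coll; rewrite /Coarsening.collapses -ltnNge /=.
move: l (weight (cover s1) z) (\sum_(s < 1024 * l) cr s) (\sum_(s < 1024 * l) two s) w h.
clear; lia.
Qed.

(** One of the two pieces belongs to the [kappa] side, so all [alpha] crossings share the other. If
    [u] differs from [p z] in a coordinate that is neither tip nor flipped by [z], some walk that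
    does not flip it reaches radius [1024 * l] and crosses level [s] at an inner end disagreeing
    with [u]. About 512 - 4 - 64 - 1 times [l] such coordinates remain. *)
Lemma two_nonconst s : s < 1024 * l -> two s ->
  exists2 j, j \in alive (cover s1) & 256 * l <= #|nonconst (inner_ends (cover s1) s j)|.
Proof.
move=> sR /andP[sl /eqP c2].
have [e [u [v ac]]] := alpha_crossing_ex sR.
have l0 := L_gt0 z.
have [|e' [u' [v' kc]]] := kappa_crossing_ex _ sR.
  by apply: leq_trans sl; rewrite leq_pmull.
have sl64 : 64 * l <= s by apply: leq_trans sl; rewrite leq_mul2r orbT.
have /and4P[he le au /andP[us sv]] := ac.
have /and4P[/andP[he' _] le' ku hs'] := kc.
set j := cover s1 e; exists j.
  rewrite /Coarsening.alive imset_f // in_setU.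
  by case/orP: (inner_edge_type he) => [->//|/andP[-> _]]; rewrite orbT.
have single f a b : alpha_crossing s f a b -> cover s1 f = j.
  move=> afc; apply/eqP; apply: contraT => nj.
  have : 2 < cr s; last by rewrite c2.
  have k1 := crossings_distinct not_par sl64 ac kc.
  have k2 := crossings_distinct not_par sl64 afc kc.
  have <- : #|j |: [set cover s1 f; cover s1 e']| = 3.
    by rewrite cardsU1 cards2 k2 !inE (eq_sym j) (negPf nj) (negPf k1).
  apply: subset_leq_card; apply/subsetP => j'; rewrite !inE.
  case/and4P: afc => [/inner_edge_type hf lf af hs].
  have := cover_picked hf lf (alpha_ball af).
  have := cover_picked (inner_edge_type he) le (alpha_ball au).
  have := @cover_picked e' u' v'; rewrite he' => /(_ isT le' (kappa_ball zZ ku)).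
  rewrite !inE -/j => h1 h2 h3.
  have us' : d c u <= s < d c v by rewrite us sv.
  have k3 := crossing_crosses le us'; rewrite -/j in k3.
  have k4 := crossing_crosses lf hs.
  have k5 := crossing_crosses le' hs'.
  by case/or3P=> /eqP ->; rewrite ?h1 ?h2 ?h3 ?k3 ?k4 ?k5.
set W := inner_ends _ _ _.
have uW : u \in W.
  by rewrite inE; apply/existsP; exists e; apply/existsP; exists v; rewrite eqxx.
have sub : diff x c u \subset tip z :|: nonconst W :|: diff x c (q z).
  apply/subsetP => i iu; rewrite !in_setU.
  have [_|iW] := boolP (i \in nonconst W); first by rewrite orbT.
  have [_|iq] := boolP (i \in diff x c (q z)); first by rewrite orbT.
  rewrite !orbF !inE /tip_at; rewrite inE negbK in iq; rewrite iq /=.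
  apply/forallP => w; apply/implyP => cw; rewrite leqNgt; apply/negP => wR.
  have [||f [a [b [/andP[ef nf] lf aW bW ca]]]] := conn_exit (W := ball x c s) cw.
  - by rewrite in_ball distxx.
  - by rewrite in_ball -ltnNge (ltn_trans sR).
  rewrite !in_ball -?ltnNge in aW bW.
  have ala : alpha z a.
    apply: conn_sub ca => g /andP[/andP[ig _] /andP[pb qb]].
    rewrite !in_ball in pb qb.
    rewrite /alpha_edge ig /Multigraph.in2 !in_ball.
    by rewrite (leq_trans pb (ltnW sR)) (leq_trans qb (ltnW sR)).
  have afc : alpha_crossing s f a b by rewrite /alpha_crossing ef lf ala aW bW.
  have aWW : a \in W.
    rewrite inE; apply/existsP; exists f; apply/existsP; exists b.
    by rewrite afc (single _ _ _ afc) eqxx.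
  have : x c i = x a i.
    apply/eqP; apply: contraT => ne.
    have [g [/andP[/andP[_ ng] _]]] := conn_cut ca ne.
    by rewrite (negPf ng).
  move: iW; rewrite inE => /existsPn/(_ u); rewrite uW => /existsPn/(_ a); rewrite aWW negbK.
  by move=> /eqP ua ca'; move: iu; rewrite inE ua ca' eqxx.
have small := cover_small (fun _ h => h) (inner_edge_type he) le (alpha_ball au).
have [hu hv] := lnk_hset s1 le.
have := hset_diam hu hv; have := dist_tri x u c v; have := ps_len PS zZ.
have := card_sub3 sub; rewrite -!/(dist x _ _).
move: not_tip sl small sv.
move: l (d _ _) (d _ _) (d _ _) #|_| #|_| (hsize _); clear; lia.
Qed.

Lemma Phi_ge : 256 * l * (256 * l) <= Phi (cover s1).
Proof.
apply: leq_trans (_ : \sum_(s < 1024 * l) two s * (256 * l) <= _).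
  by rewrite -big_distrl leq_mul2r many_two orbT.
apply: leq_sum => s _; case: (boolP (two s)) => //= h.
have [j jA hj] := two_nonconst (ltn_ord s) h.
by rewrite mul1n (bigD1 j) //= (leq_trans hj) // leq_addr.
Qed.

End AtPlace.
Lemma nonconst_sub (W W' : {set V}) : W \subset W' -> nonconst W \subset nonconst W'.
Proof.
move=> sub; apply/subsetP => i; rewrite !inE => /existsP[u /andP[uW /existsP[v /andP[vW ne]]]].
apply/existsP; exists u; rewrite (subsetP sub) //=; apply/existsP; exists v.
by rewrite (subsetP sub).
Qed.

(** Fix a representative in each nonempty [W j]. A coordinate varying on the union varies within
    some [W j] or separates a representative from [w0]; the latter costs [b] per nonempty [W j]. *)
Lemma nonconst_bigcup (J : finType) (D : {set J}) (W : J -> {set V}) (W0 : {set V}) b :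
    (forall u, u \in W0 -> exists2 j, j \in D & u \in W j) ->
    (forall j j' u v, j \in D -> j' \in D -> u \in W j -> v \in W j' -> d u v <= b) ->
  #|nonconst W0| <= \sum_(j in D) (#|nonconst (W j)| + (W j != set0) * b).
Proof.
move=> cov db.
have [w0 hw0|n0] := pickP (mem W0); last first.
  rewrite (_ : nonconst W0 = set0) ?cards0 //; apply/setP => i; rewrite !inE.
  by apply/existsP => -[u]; have := n0 u; rewrite /= => ->.
have [j0 j0D w0W] := cov _ hw0.
pose rep j := odflt w0 [pick u in W j].
have repP j : W j != set0 -> rep j \in W j.
  by case/set0Pn=> u uj; rewrite /rep; case: pickP => [//|/(_ u)]; rewrite uj.
have neW j u : u \in W j -> W j != set0 by move=> uj; apply/set0Pn; exists u.
have sub : nonconst W0 \subset \bigcup_(j in D) (nonconst (W j) :|: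
     (if W j != set0 then diff x (rep j) w0 else set0)).
  apply/subsetP => i; rewrite inE => /existsP[u /andP[uW /existsP[v /andP[vW ne]]]].
  have [j jD uj] := cov _ uW; have [j' j'D vj] := cov _ vW.
  have [h|h] := boolP (i \in \bigcup_(j in D) (nonconst (W j) :|:
     (if W j != set0 then diff x (rep j) w0 else set0))) => //.
  have notin k a : k \in D -> a \in W k -> x a i = x w0 i.
    move=> kD ak; apply/eqP; apply: contraNT h => na; apply/bigcupP; exists k => //.
    rewrite (neW _ _ ak) inE; have [nr|nr] := eqVneq (x (rep k) i) (x w0 i); last first.
      by rewrite [X in _ || X]inE nr orbT.
    rewrite inE; apply/orP; left; apply/existsP; exists a; rewrite ak /=.
    by apply/existsP; exists (rep k); rewrite repP ?nr // (neW _ _ ak).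
  by rewrite (notin _ _ jD uj) (notin _ _ j'D vj) eqxx in ne.
apply: leq_trans (subset_leq_card sub) _.
apply: leq_trans (card_bigcup_leq_sum _ _) _; apply: leq_sum => j jD.
apply: leq_trans (card_setU_le _ _) _; rewrite leq_add2l.
case: ifP => hj; rewrite ?cards0 //= mul1n.
by apply: (db j j0) => //; exact: repP.
Qed.

Section AtPlace.
Variable z : E.
Variables (s1 s2 : seq E).
Hypothesis split_schedule : schedule = s1 ++ z :: s2.
Notation c := (p z).
Notation l := (L z).

Let s1P z' : z' \in s1 -> [/\ z' \in ZZ, z' != z & sc z' <= sc z].
Proof. by have [_ _ _] := schedule_prefix split_schedule; apply. Qed.

(** An initial piece is a single edge, and at a given level only one of its ends is the inner
    one. *)
Lemma Phi_inl : Phi z inl = 0.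
Proof.
rewrite /Phi big1 // => s _; rewrite big1 // => j _.
apply/eqP; rewrite cards_eq0 -subset0; apply/subsetP => i; rewrite !inE.
case/existsP=> u /andP[+ /existsP[v /andP[]]].
rewrite !inE => /existsP[e /existsP[a /andP[/eqP ej /and4P[_ le _ /andP[us sa]]]]].
move=> /existsP[e' /existsP[a' /andP[/eqP ej' /and4P[_ le' _ /andP[us' sa']]]]].
have ee : e' = e by move: ej'; rewrite -ej => -[].
subst e'; case/lnkP: le => [[h1 h2]|[h1 h2]]; case/lnkP: le' => [[h1' h2']|[h1' h2']].
- by rewrite -h1 -h1' eqxx.
- move: us sa us' sa'; rewrite -h1 -h2 -h1' -h2' => a1 a2 a3 a4.
  by have := leq_ltn_trans a1 a4; rewrite ltnn.
- move: us sa us' sa'; rewrite -h1 -h2 -h1' -h2' => a1 a2 a3 a4.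
  by have := leq_ltn_trans a1 a4; rewrite ltnn.
- by rewrite -h2 -h2' eqxx.
Qed.

Definition inc (wt : E -> nat) z' : nat :=
  if (sc z' < sc z) && (d c (p z') <= 1100 * l) then 2056 * L z' * wt z' else 0.

Lemma inner_ends_hset t s j u :
  u \in inner_ends z (cover t) s j -> u \in hset j /\ crosses z j s /\ alpha z u.
Proof.
rewrite inE => /existsP[e /existsP[v /andP[/eqP <- /and4P[_ le au us]]]].
have [hu hv] := lnk_hset t le.
by split=> //; split=> //; apply/existsP; exists u; rewrite hu; apply/existsP; exists v; rewrite hv.
Qed.

(** By [nonconst_bigcup], fusing at [z'] adds at one level at most [2056 * L z'] per fused piece
    with an inner end there. A piece crosses no more levels than its size, so all levels together
    add [2056 * L z'] times the fused weight, and only if [z'] is smaller than and near [z]. *)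
Lemma Phi_step t1 z' t2 (wt : E -> nat) : s1 = t1 ++ z' :: t2 ->
    wt z' = weight (cover t1) z' -> collapses (cover t1) z' ->
  Phi z (step (cover t1) z') <= Phi z (cover t1) + inc wt z'.
Proof.
move=> es wtE coll.
have z's : z' \in s1 by rewrite es mem_cat mem_head orbT.
have uS := uniq_schedule.
have z't1 : z' \notin t1.
  move: uS; rewrite split_schedule es -catA cat_uniq => /and3P[_ /hasPn/(_ z')].
  by rewrite mem_head => /(_ isT).
set cov := cover t1; set cov' := step cov z'; set D := picked cov z'.
have sub : alive cov' \subset inr z' |: (alive cov :\: D).
  apply/subsetP => _ /imsetP[e eB ->]; rewrite /cov' /Coarsening.step coll /=.
  case: ifP => sj; first by rewrite !inE eqxx.
  by rewrite !inE sj !andbF /= imset_f ?orbT.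
have off s j : j != inr z' -> inner_ends z cov' s j \subset inner_ends z cov s j.
  move=> nj; apply/subsetP => u; rewrite !inE => /existsP[e /existsP[v /andP[/eqP ej ac]]].
  apply/existsP; exists e; apply/existsP; exists v; rewrite ac andbT.
  move: ej nj; rewrite /cov' /Coarsening.step; case: ifP => _ <-; first by rewrite eqxx.
  by rewrite eqxx.
have new s u : u \in inner_ends z cov' s (inr z') ->
    exists2 j, j \in D & u \in inner_ends z cov s j.
  rewrite inE => /existsP[e /existsP[v /andP[/eqP ej ac]]].
  have eB : e \in Bs.
    case/and4P: ac => /andP[_ h] _ _ _; rewrite in_setU.
    by case/orP: h => [->//|/andP[->]]; rewrite orbT.
  exists (cov e); last first.
    by rewrite inE; apply/existsP; exists e; apply/existsP; exists v; rewrite eqxx.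
  rewrite inE imset_f //=; move: ej; rewrite /cov' /Coarsening.step coll /=.
  by case: ifP => // _ /cover_inr; rewrite (negPf z't1).
have dD s j j' u v : j \in D -> j' \in D -> u \in inner_ends z cov s j ->
    v \in inner_ends z cov s j' -> d u v <= 2056 * L z'.
  rewrite inE => /andP[_ sj]; rewrite inE => /andP[_ sj'].
  move=> /inner_ends_hset[hu _] /inner_ends_hset[hv _].
  exact: (@hset_diam (inr z')) (subsetP sj _ hu) (subsetP sj' _ hv).
have level s : \sum_(j in alive cov') #|nonconst (inner_ends z cov' s j)|
    <= \sum_(j in alive cov) #|nonconst (inner_ends z cov s j)|
       + \sum_(j in D) (inner_ends z cov s j != set0) * (2056 * L z').
  have nb := nonconst_bigcup (new s) (dD s).
  rewrite big_split /= in nb.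
  apply: leq_trans (_ : \sum_(j in inr z' |: (alive cov :\: D)) #|nonconst (inner_ends z cov' s j)| <= _).
    rewrite [X in _ <= X](big_setID (alive cov')) /=.
    by rewrite (setIidPr sub) leq_addr.
  have z'n : inr z' \notin alive cov :\: D.
    rewrite inE; apply/nandP; right; apply/imsetP => -[e _ /esym/cover_inr].
    by rewrite (negPf z't1).
  rewrite big_setU1 //= [X in _ <= X + _](big_setID D) /=.
  have -> : alive cov :&: D = D by apply/setIidPr/subsetP => j; rewrite inE => /andP[].
  rewrite addnAC; apply: leq_add; first exact: nb.
  apply: leq_sum => j; rewrite in_setD => /andP[_ jA].
  apply: subset_leq_card; apply: nonconst_sub; apply: off.
  by apply/eqP => ej; move: jA; rewrite ej => /imsetP[e _ /esym/cover_inr]; rewrite (negPf z't1).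
apply: leq_trans (leq_sum _ _) _; first by move=> s _; exact: level.
rewrite big_split /= leq_add2l.
rewrite /inc; case: ifPn => [_|far]; last first.
  rewrite big1 // => s _; rewrite big1 // => j; rewrite inE => /andP[_ sj].
  rewrite (_ : (_ != set0) = false) //; apply: contraNF far => /set0Pn[u].
  move=> /inner_ends_hset[hu [_ /alpha_ball au]].
  have := subsetP sj _ hu; rewrite in_ball => hu'.
  by have [-> ->] := near_earlier split_schedule z's au hu'.
rewrite wtE (mulnC (2056 * L z')).
under eq_bigr => s _ do rewrite -big_distrl /=.
rewrite -big_distrl /= leq_mul2r; apply/orP; right.
rewrite exchange_big; apply: leq_sum => j _.
apply: leq_trans (crosses_count z (1024 * l) j).
apply: leq_sum => s _; case: (boolP (_ == set0)) => //= /set0Pn[u].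
by move=> /inner_ends_hset[_ [-> _]].
Qed.

End AtPlace.

Lemma before_cat t1 t2 z : z \in t1 -> before (t1 ++ t2) z = before t1 z.
Proof.
move=> zt; rewrite /Coarsening.before index_cat zt take_cat index_mem zt //.
Qed.

Definition wt z := weight (before schedule z) z.
Definition coll z := collapses (before schedule z) z.

Lemma spread_bound z : z \in ZZ -> ~~ coll z ->
    #|parallel z| < 32 * L z -> #|tip z| < 64 * L z ->
  256 * L z * (256 * L z) <= \sum_(z' in ZZ | coll z') inc z wt z'.
Proof.
move=> zZ; rewrite -(mem_schedule) in zZ.
case/splitPr: {-1}schedule / zZ (erefl schedule) => s1 s2 es.
have [zZ bz zs1 s1P] := schedule_prefix es.
rewrite /coll bz => nc np nt.
apply: leq_trans (Phi_ge es nc np nt) _.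
have uS := uniq_schedule.
have us1 : uniq s1 by move: uS; rewrite es cat_uniq => /andP[].
have H := @cover_potential _ _ Bs hsize sel s1 (Phi z) (inc z wt) us1.
apply: (leq_trans (H _)).
  move=> t1 z' t2 e1 co; apply: (Phi_step es e1) => //.
  by rewrite /wt; have [_ -> _ _] := schedule_prefix (etrans es (etrans (congr1 (cat^~ _) e1) (esym (catA _ _ _)))).
rewrite Phi_inl add0n.
have -> : \sum_(z0 <- s1 | collapses (before s1 z0) z0) inc z wt z0
    = \sum_(z0 <- s1 | coll z0) inc z wt z0.
  rewrite big_seq_cond [RHS]big_seq_cond; apply: eq_bigl => z'.
  by case: (boolP (z' \in s1)) => //= h; rewrite /coll es before_cat.
have pe : perm_eq (enum ZZ) schedule by rewrite perm_sym perm_sort.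
have -> : \sum_(z' in ZZ | coll z') inc z wt z' = \sum_(z' <- s1 ++ z :: s2 | coll z') inc z wt z'.
  by rewrite -es -(perm_big _ pe) /= big_enum_cond.
by rewrite big_cat leq_addr.
Qed.

Let spread := [set z in ZZ | [&& ~~ coll z, #|parallel z| < 32 * L z & #|tip z| < 64 * L z]].
Let M := (\max_(z in ZZ) sc z).+1.
Let near z z' := (sc z' < sc z) && (d (p z) (p z') <= 1100 * L z).

Lemma sc_M z : z \in ZZ -> sc z < M.
Proof. by move=> zZ; rewrite ltnS; exact: (leq_bigmax_cond (F := sc)). Qed.

(* The factor [Q ^ M] clears the denominators [Q ^ (sc z - sc z')]. *)
Lemma spread_scaled z : z \in spread ->
  256 * 256 * (L z * Q ^ M) <= 
  2056 * \sum_(z' in ZZ | coll z') near z z' * (wt z' * Q ^ (M - (sc z - sc z'))).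
Proof.
rewrite inE => /and4P[zZ nc np nt].
have h := spread_bound zZ nc np nt.
have l0 := L_gt0 z; rewrite -(leq_pmul2l l0).
have -> : L z * (256 * 256 * (L z * Q ^ M)) = 256 * L z * (256 * L z) * Q ^ M.
  by move: (L z) (Q ^ M) 256 => l m n; clear; lia.
apply: leq_trans (_ : (\sum_(z' in ZZ | coll z') inc z wt z') * Q ^ M <= _).
  by rewrite leq_mul2r h orbT.
rewrite big_distrl !big_distrr /=; apply: leq_sum => z' /andP[z'Z _].
rewrite /inc -/(near z z'); case: ifP => [|//]; case/andP=> lt _; rewrite mul1n.
have e1 : L z = L z' * Q ^ (sc z - sc z').
  by rewrite -mulnA -expnD subnKC // ltnW.
have e2 : Q ^ M = Q ^ (sc z - sc z') * Q ^ (M - (sc z - sc z')).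
  rewrite -expnD subnKC //; have := sc_M zZ; rewrite /M; clear; lia.
rewrite e2 e1; move: (L z') (wt z') (Q ^ _) (Q ^ _) 2056 => a b r s n; clear; lia.
Qed.

(** By separation, [z'] is near at most one spread place of each larger scale, so after exchanging
    the sums its weight is charged with ratios 1/Q, 1/Q^2, and so on, of sum at most 2/Q;
    [Q >= 1024] then leaves ample room. *)
Lemma spread_sum : 2048 * \sum_(z in spread) L z <= \sum_(z in ZZ | coll z) wt z.
Proof.
have Q1 := ps_Q PS; have Q2 : 2 <= Q by apply: leq_trans Q1.
have h : 256 * 256 * (Q ^ M * \sum_(z in spread) L z) <=
    2056 * (2 * Q ^ M.-1 * \sum_(z' in ZZ | coll z') wt z').
  rewrite mulnA big_distrr /=.
  apply: leq_trans (_ : \sum_(z in spread) (2056 * \sum_(z' in ZZ | coll z')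
     near z z' * (wt z' * Q ^ (M - (sc z - sc z')))) <= _).
    by apply: leq_sum => z zs; rewrite -mulnA (mulnC (Q ^ M)); exact: spread_scaled.
  rewrite -big_distrr leq_mul2l; apply/orP; right.
  rewrite exchange_big big_distrr /=; apply: leq_sum => z' /andP[z'Z _].
  apply: leq_trans (_ : wt z' * \sum_(z in spread | near z z') Q ^ (M - (sc z - sc z')) <= _).
    rewrite big_distrr big_mkcondr /=; apply: leq_sum => z _.
    by case: (near z z'); rewrite //= ?mul1n.
  rewrite mulnC leq_mul2r; apply/orP; right.
  apply: leq_trans (sum_geometric_le M.-1 Q2).
  rewrite prednK //.
  rewrite (eq_bigl (fun z => z \in [set z in spread | near z z'])); last by move=> z; rewrite [in RHS]in_set.
  apply: (@sum_injective_le _ _ (fun z => M - (sc z - sc z')) M (fun k => Q ^ k)).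
    move=> z1 z2; rewrite !in_set -!/(_ \in spread).
    move=> /andP[s1 /andP[l1 n1]] /andP[s2 /andP[l2 n2]] em.
    have {s1} z1Z : z1 \in ZZ by case/andP: s1.
    have {s2} z2Z : z2 \in ZZ by case/andP: s2.
    have es : sc z1 = sc z2.
      by move: (sc_M z1Z) (sc_M z2Z) em l1 l2; move: M (sc z1) (sc z2) (sc z'); clear; lia.
    apply/eqP; apply: contraT => ne.
    have := ps_sep PS z1Z z2Z es ne; have := L_gt0 z2.
    have := dist_tri x (p z') (p z1) (p z2); rewrite (distC x (p z') (p z2)).
    move: n1 n2; rewrite es; move: (L z2); clear; lia.
  move=> z; rewrite in_set => /andP[_ /andP[lt _]]; rewrite /M.
  by move: (\max_(z in ZZ) sc z) (sc z) (sc z') lt; clear; lia.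
have qE : Q ^ M = Q * Q ^ M.-1 by rewrite -expnS.
have q0 : 0 < Q ^ M.-1 by rewrite expn_gt0 (leq_trans _ Q2).
rewrite qE in h.
set X := \sum_(z in spread) _ in h *; set Y := \sum_(z in ZZ | _) _ in h *.
have {}h : 256 * 256 * (Q * X) <= 4112 * Y.
  rewrite -(leq_pmul2l q0).
  have -> : Q ^ M.-1 * (256 * 256 * (Q * X)) = 256 * 256 * (Q * Q ^ M.-1 * X).
    by rewrite mulnCA (mulnC Q (Q ^ _)) -(mulnA (Q ^ _)).
  suff -> : Q ^ M.-1 * (4112 * Y) = 2056 * (2 * Q ^ M.-1 * Y) by [].
  by rewrite mulnCA -(mulnA 2) (mulnA 2056).
have h2 : 1024 * X <= Q * X by rewrite leq_mul2r Q1 orbT.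
move: (Q * X) h h2; move: X Y; clear; lia.
Qed.

Theorem places_sum : \sum_(z in ZZ) L z <= \sum_(e in TT) len e.
Proof.
have hp := sum_parallel; have ht := sum_tip; have hs := spread_sum.
have hw := coarsening_weight (TT :|: ZZ) hsize sel
  (uniq_schedule).
have {}hw : \sum_(z in ZZ | coll z) wt z <= 33 * \sum_(e in TT :|: ZZ) len e.
  apply: leq_trans hw; rewrite -big_enum_cond /=.
  have pe : perm_eq (enum ZZ) (schedule) by rewrite perm_sym perm_sort.
  by rewrite (perm_big _ pe).
have hu : \sum_(e in TT :|: ZZ) len e <= \sum_(e in TT) len e + \sum_(z in ZZ) L z.
  apply: leq_trans (_ : \sum_(e in TT) len e + \sum_(e in ZZ) len e <= _).
    rewrite (big_setID TT) /= setUK; rewrite leq_add2l.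
    rewrite [X in _ <= X](big_setID TT) /= setDUl setDv set0U; exact: leq_addl.
  by rewrite leq_add2l; apply: leq_sum => z; exact: (ps_len PS).
(* Each place is paid in one of four ways: by 33 * 2056 / 32 > 2048 if it collapses, by 64 * 32 for
   parallel coordinates, by 32 * 64 for tip coordinates, or by [spread_sum]. The places return on
   the right with coefficient 33 + 64 + 33, far below 2048. *)
have hz : 2048 * \sum_(z in ZZ) L z <= \sum_(z in ZZ | coll z) wt z
   + 64 * \sum_(z in ZZ) #|parallel z| + 32 * \sum_(z in ZZ) #|tip z|
   + 2048 * \sum_(z in spread) L z.
  have -> : \sum_(z in spread) L z = \sum_(z in ZZ) (if z \in spread then L z else 0).
    rewrite -big_mkcondr; apply: eq_bigl => z; rewrite inE.
    by case: (z \in ZZ).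
  rewrite big_mkcondr !big_distrr -!big_split; apply: leq_sum => z zZ.
  rewrite inE zZ /=; case: (boolP (coll z)) => [|_] /=.
    by rewrite /coll /collapses -/(wt z) /=; move: (wt z) (L z); clear; lia.
  case: ltnP => h1 /=; last by move: (L z) h1; clear; lia.
  case: ltnP => h2 /=; last by move: (L z) h2; clear; lia.
  by rewrite leq_addl.
move: hp ht hs hw hu hz.
move: (\sum_(z in spread) L z) (\sum_(z in ZZ | coll z) wt z).
move: (\sum_(e in TT :|: ZZ) len e) (\sum_(z in ZZ) L z) (\sum_(e in TT) len e).
clear; lia.
Qed.

End Places.

End Places.
Import Places.

(** * Anchors for the edges of one class *)

Module Anchor.
Local Open Scope nat_scope.

(** Scanning by decreasing key, a rejected element is incompatible with a chosen one of at least its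
    key. Ties come in arbitrary order, whence symmetry at equal keys. A constant key yields maximal
    separated sets, that is, nets. *)
Lemma greedy_selection (E : finType) (C : {set E}) (key : E -> nat) (compat : rel E) :
    (forall e e', key e = key e' -> compat e e' = compat e' e) ->
  exists2 Z : {set E}, Z \subset C &
    {in Z &, forall z z', z != z' -> key z <= key z' -> compat z z'} /\
    {in C, forall e, e \in Z \/ exists2 z, z \in Z & key e <= key z /\ ~~ compat e z}.
Proof.
move=> csym; pose r := fun e e' => key e' <= key e.
have [Z [ZC [h1 h2]]] : exists Z : {set E}, {subset Z <= sort r (enum C)} /\
    {in Z &, forall z z', z != z' -> key z <= key z' -> compat z z'} /\
    {in sort r (enum C), forall e, e \in Z \/ exists2 z, z \in Z & key e <= key z /\ ~~ compat e z}.
  have : pairwise r (sort r (enum C)).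
    have rtr : transitive r by move=> a b c ab bc; exact: leq_trans bc ab.
    by rewrite -sorted_pairwise // sort_sorted // => a b; exact: leq_total.
  elim/last_ind: (sort r (enum C)) => [_|s a IH].
    by exists set0; split=> [z|]; [rewrite inE | split=> z; rewrite ?inE].
  rewrite -cats1 pairwise_cat => /and3P[/allrelP sa ps _].
  have {}sa e : e \in s -> key a <= key e by move=> es; apply: sa; rewrite ?inE.
  have [Z [Zs [h1 h2]]] := IH ps.
  have [/forallP ha|/forallPn[z]] := boolP [forall z, (z \in Z) ==> compat a z]; last first.
    rewrite negb_imply => /andP[zZ nc]; exists Z; split.
      by move=> e /Zs; rewrite mem_cat => ->.
    split=> // e; rewrite mem_cat inE => /orP[/h2 //|/eqP ->].
    by right; exists z => //; split=> //; apply: sa; exact: Zs.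
  exists (a |: Z); split.
    by move=> e; rewrite !inE mem_cat inE => /orP[->|/Zs ->]; rewrite ?orbT.
  split.
    move=> z z'; rewrite !inE => /predU1P[->|zZ] /predU1P[->|z'Z]; first by rewrite eqxx.
    - by move=> _ _; move/implyP: (ha z'); apply.
    - move=> _ le; rewrite csym; first by move/implyP: (ha z); apply.
      by apply/eqP; rewrite eqn_leq le sa // Zs.
    - exact: h1.
  move=> e; rewrite mem_cat inE => /orP[/h2 [eZ|[z zZ hz]]|/eqP ->].
  - by left; rewrite !inE eZ orbT.
  - by right; exists z => //; rewrite !inE zZ orbT.
  - by left; rewrite !inE eqxx.
exists Z; first by apply/subsetP => z /ZC; rewrite mem_sort mem_enum.
by split=> // e eC; apply: h2; rewrite mem_sort mem_enum.
Qed.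

Section Anchors.
Variables (V E I N : finType) (p q : E -> V) (x : V -> I -> bool).
Variables (TT CE : {set E}) (sc : E -> nat) (nd : E -> N).
Variables (Vt : N -> {set V}) (par : N -> N) (L0 Q K : nat).
Notation d := (dist x).
Notation len e := (dist x (p e) (q e)).
Notation L n := (L0 * Q ^ n).
Notation conn := (conn p q).
Notation lnk := (lnk p q).
Notation in2 := (in2 p q).
Hypothesis L0pos : 0 < L0.
Hypothesis Q1024 : 1024 <= Q.
Hypothesis QK : 2 * (K + 2) <= Q.
Hypothesis connT : forall u v, conn (mem TT) u v.
Hypothesis cardT : #|V| = #|TT|.+1.
Hypothesis connV : forall t, {in Vt t &, forall u v,
  conn (fun f => (f \in TT) && in2 (Vt t) f) u v}.
Hypothesis laminar : forall t t' v, v \in Vt t -> v \in Vt t' ->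
  Vt t \subset Vt t' \/ Vt t' \subset Vt t.
Hypothesis Vtop : exists r, Vt r = setT.
Hypothesis Vpar : forall t, Vt t \subset Vt (par t).
Hypothesis CEp : forall e, e \in CE -> p e \in Vt (nd e).
Hypothesis CEq : forall e, e \in CE -> q e \in Vt (par (nd e)) :\: Vt (nd e).
Hypothesis CEsc : {in CE &, forall e e', nd e = nd e' -> sc e = sc e'}.
Hypothesis CElen : forall e, e \in CE -> len e <= L (sc e).

Definition crossV t g := (p g \in Vt t) != (q g \in Vt t).
Definition treedeg t := #|[set f in TT | in2 (Vt (par t)) f && crossV t f]|.

Let A z := Vt (nd z).
Let B z := Vt (par (nd z)).

(* An edge [z] of the class that is not a place is anchored as follows.  If at least
   [K] edges leave its cluster nearby ([fine]), separated such edges are few by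
   counting the cut; if N1, N2 or N3 fails, at an end of a tree edge crossing the
   cluster ([exc_anchors]); if N4 fails, at an end of a long tree edge; if it is
   incompatible with a larger place, at one of the at most [K + 2] points of
   [far_witness], whose cost is absorbed by the geometric growth of the scales. *)
Definition touching z : {set E} := [set g | [exists b, exists c,
  [&& lnk g b c, b \in A z, c \notin A z & d (p z) b <= 2048 * L (sc z)]]].
Definition fine z := K <= #|touching z|.

Lemma lnk_cross t g b c : lnk g b c -> b \in Vt t -> c \notin Vt t -> crossV t g.
Proof.
rewrite /crossV => /lnkP[[-> ->]|[-> ->]] bA cA; by rewrite bA (negPf cA).
Qed.

Lemma lnk_uniq t g b c b' c' : lnk g b c -> lnk g b' c' -> b \in Vt t -> c \notin Vt t ->
  b' \in Vt t -> c' \notin Vt t -> b = b'.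
Proof.
move=> /lnkP[[<- <-]|[<- <-]] /lnkP[[<- <-]|[<- <-]] // bA cA b'A; rewrite ?b'A ?bA // in cA.
Qed.

Lemma fine_anchors t : exists2 W : {set V},
    #|W| * K <= #|[set g | crossV t g]| &
    forall e, e \in CE -> nd e = t -> fine e -> exists2 w, w \in W & d (p e) w <= 4096 * L (sc e).
Proof.
have [|Z ZC [h1 h2]] := @greedy_selection E [set e in CE | (nd e == t) && fine e]
   (fun=> 0) (fun e e' => 4096 * maxn (L (sc e)) (L (sc e')) < d (p e) (p e')).
  by move=> e e' _; rewrite (maxnC (L (sc e))) (distC x (p e)).
have ZP z : z \in Z -> [/\ z \in CE, nd z = t & fine z].
  by move/(subsetP ZC); rewrite inE => /and3P[? /eqP ? ?].
have fE e : e \in CE -> nd e = t -> fine e -> exists2 z, z \in Z & d (p e) (p z) <= 4096 * maxn (L (sc e)) (L (sc z)).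
  move=> eC et fe; case: (h2 e) => [|eZ|[z zZ [_ nc]]]; first by rewrite inE eC et eqxx fe.
    by exists e => //; rewrite distxx.
  by exists z => //; rewrite leqNgt.
have maxE e e' : e \in CE -> e' \in CE -> nd e = t -> nd e' = t ->
    4096 * maxn (L (sc e)) (L (sc e')) = 4096 * L (sc e).
  by move=> h3 h4 h5 h6; rewrite (CEsc h3 h4 (etrans h5 (esym h6))) maxnn.
exists (p @: Z); last first.
  move=> e eC et fe; have [z zZ dz] := fE e eC et fe; have [zC zt _] := ZP z zZ.
  by exists (p z); [exact: imset_f | rewrite maxE in dz].
have touchC z : z \in Z -> touching z \subset [set g | crossV t g].
  move=> /ZP[_ zt _]; apply/subsetP => g; rewrite !inE.
  case/existsP=> b /existsP[c /and4P[lg bA cA _]]; rewrite /A zt in bA cA.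
  exact: lnk_cross lg bA cA.
(* A cut edge has only one end in the cluster; touched by two selected edges, it would bring these
   within twice 2048 radii of each other. *)
have disj g : #|[set z in Z | g \in touching z]| <= 1.
  apply/card_le1_eqP => z z' /setIdP[zZ zg] /setIdP[z'Z z'g].
  apply/eqP; apply: contraT => ne.
  have [zC zt _] := ZP z zZ; have [z'C z't _] := ZP z' z'Z.
  rewrite eq_sym in ne; have := h1 z z' zZ z'Z ne isT; rewrite (maxE z z' zC z'C zt z't) => far.
  move: zg; rewrite inE => /existsP[b /existsP[c /and4P[lg bA cA db]]].
  move: z'g; rewrite inE => /existsP[b' /existsP[c' /and4P[lg' b'A c'A db']]].
  rewrite /A zt in bA cA; rewrite /A z't in b'A c'A.
  have eb := lnk_uniq lg lg' bA cA b'A c'A; subst b'.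
  have := dist_tri x b (p z) (p z'); rewrite (distC x b (p z')).
  move: db' db far; rewrite (CEsc z'C zC); last by rewrite zt z't.
  move: (L (sc z)); clear; lia.
apply: leq_trans (_ : #|Z| * K <= _); first by rewrite leq_mul2r leq_imset_card orbT.
apply: leq_trans (_ : \sum_(z in Z) #|touching z| <= _).
  by rewrite -sum_nat_const; apply: leq_sum => z /ZP[].
have -> : \sum_(z in Z) #|touching z| = \sum_(g in [set g | crossV t g]) #|[set z in Z | g \in touching z]|.
  under [RHS]eq_bigr => g _ do rewrite -sum_bool_card.
  rewrite exchange_big /=; apply: eq_bigr => z zZ; rewrite sum_bool_card.
  congr #|pred_of_set _|; apply/setP => g; rewrite in_set; case: (boolP (g \in touching z)) => h.
    by rewrite (subsetP (touchC z zZ)).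
  by rewrite andbF.
by rewrite -sum1_card; apply: leq_sum => g _; exact: disj.
Qed.

Definition exc_anchors t : {set V} :=
  \bigcup_(f in [set f in TT | in2 (Vt (par t)) f && crossV t f]) [set p f; q f].

Lemma card_exc_anchors t : #|exc_anchors t| <= 2 * treedeg t.
Proof.
rewrite /exc_anchors /treedeg; set S := [set f in TT | _].
apply: leq_trans (card_bigcup_leq_sum _ _) _; rewrite mulnC -sum_nat_const.
by apply: leq_sum => f _; rewrite cards2; case: (_ != _).
Qed.

(** The default is never taken, as some cluster is all of [V]. *)
Definition lnode f := odflt (nd f) [pick t | in2 (Vt t) f && [forall t', in2 (Vt t') f ==> (#|Vt t| <= #|Vt t'|)]].

Lemma lnodeP f : in2 (Vt (lnode f)) f /\ forall t, in2 (Vt t) f -> #|Vt (lnode f)| <= #|Vt t|.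
Proof.
have [r hr] := Vtop.
have r0 : in2 (Vt r) f by rewrite hr /Multigraph.in2 !inE.
rewrite /lnode; case: pickP => [t /andP[h1 /forallP h2]|no] /=.
  by split=> // t' h; have := h2 t'; rewrite h.
case: (@arg_minnP _ r (fun t => in2 (Vt t) f) (fun t => #|Vt t|) r0) => t h1 h2.
by have := no t; rewrite h1 /=; case/forallP=> t'; apply/implyP; exact: h2.
Qed.

(** N1 to N4 concern [z] alone and are tested here; N5 and N6 compare [z] with a larger place and
    are left to [apart]. *)
Definition loc z : bool :=
  [&& [exists v in A z, 1024 * L (sc z) <= d (p z) v],
      [exists v, conn (fun f => (f \in TT) && in2 (B z :\: A z) f) (q z) v &&
         (1024 * L (sc z) <= d (p z) v)],
      [forall f in TT, forall a, forall b,
         [&& in2 (B z) f, lnk f a b, a \in A z & b \notin A z] ==> (2048 * L (sc z) < d (p z) a)] &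
      [forall f in TT, forall a, forall b,
         lnk f a b && (d (p z) a <= 2048 * L (sc z)) ==> (len f <= 4 * L (sc z))]].

Definition apart z z' : bool :=
  [&& 2048 * L (sc z) < d (p z) (p z'), 2048 * L (sc z) < d (p z) (q z') &
     [forall g, forall b, forall c,
       [&& lnk g b c, b \in A z', c \notin A z' & d b (p z) <= 2048 * L (sc z)] ==>
       (2048 * L (sc z') < d b (p z'))]].

Definition compat z z' : bool :=
  if sc z < sc z' then apart z z'
  else if sc z == sc z' then 4096 * L (sc z) <= d (p z) (p z') else true.

(** If N1 or N2 fails, the tree walk in the parent cluster between [p z] and [q z] still crosses the
    boundary of the cluster, and the end of this crossing on the failing side is not far. Failures
    of N3 and N4 name their edge directly. *)
Lemma loc_fail z : z \in CE -> ~~ loc z ->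
  (exists2 w, w \in exc_anchors (nd z) & d (p z) w <= 2048 * L (sc z)) \/
  (exists f w, [/\ f \in TT, (w == p f) || (w == q f), 4 * L (sc z) < len f & d (p z) w <= 2048 * L (sc z)]).
Proof.
move=> zC.
have pA : p z \in A z := CEp zC.
have /setDP[qB qA] := CEq zC.
have ABz : A z \subset B z := Vpar (nd z).
have exc f a b : f \in TT -> in2 (B z) f -> lnk f a b -> a \in A z -> b \notin A z ->
    a \in exc_anchors (nd z) /\ b \in exc_anchors (nd z).
  move=> fT fB lf aA bA.
  have fS : f \in [set f in TT | in2 (Vt (par (nd z))) f && crossV (nd z) f].
    by rewrite inE fT fB (lnk_cross lf aA bA).
  by split; apply/bigcupP; exists f => //; case/lnkP: lf => [[h1 h2]|[h1 h2]]; rewrite !inE -?h1 -?h2 eqxx ?orbT.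
have l12 : 1024 * L (sc z) <= 2048 * L (sc z) by rewrite leq_mul2r orbT.
rewrite !negb_and => /or4P[h|h|h|h].
- left; have [||f [a [b [/andP[fT fB] lf aA bA _]]]] := conn_exit (W := A z) (connV (subsetP ABz _ pA) qB) => //.
  exists a; first by have [] := exc f a b fT fB lf aA bA.
  rewrite leqNgt; apply: contra h => da; apply/existsP; exists a; rewrite aA /=.
  by rewrite (leq_trans l12) // ltnW.
- left.
  have [||f [a [b [/andP[fT fB] lf aA bA ca]]]] :=
     conn_exit (W := ~: A z) (connV qB (subsetP ABz _ pA)); rewrite ?inE ?negbK //.
  rewrite !inE negbK in aA bA.
  have lf' : lnk f b a by rewrite lnkC.
  have [_ ha] := exc f b a fT fB lf' bA aA; exists a => //.
  rewrite leqNgt; apply: contra h => da; apply/existsP; exists a.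
  rewrite (leq_trans l12) ?(ltnW da) // andbT.
  apply: conn_sub ca => g /andP[/andP[-> /andP[g1 g2]] /andP[g3 g4]].
  by rewrite /Multigraph.in2 !in_setD g1 g2 -!in_setC g3 g4.
- left; case/forallPn: h => f; rewrite negb_imply => /andP[fT /forallPn[a /forallPn[b]]].
  rewrite negb_imply -leqNgt => /andP[/and4P[fB lf aA bA] da].
  by exists a => //; have [] := exc f a b fT fB lf aA bA.
right; case/forallPn: h => f; rewrite negb_imply => /andP[fT /forallPn[a /forallPn[b]]].
rewrite negb_imply -ltnNge => /andP[/andP[lf da] lenf].
exists f, a; split=> //.
by case/lnkP: lf => [[-> _]|[_ ->]]; rewrite eqxx ?orbT.
Qed.

Definition far_witness z : {set V} := p z |: (q z |:
  [set b | [exists g, exists c, [&& lnk g b c, b \in A z, c \notin A z & d (p z) b <= 2048 * L (sc z)]]]).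

(** A leaving edge has only one end in the cluster, so choosing an edge for each such end is
    injective into [touching z]; the 2 stands for the ends of [z]. *)
Lemma card_far_witness z : ~~ fine z -> #|far_witness z| <= K + 2.
Proof.
rewrite /fine -ltnNge => h; rewrite /far_witness !cardsU1.
set S := [set b | _].
suff : #|S| <= #|touching z| by move: h; case: (_ \notin _); case: (_ \notin _); rewrite /=; clear; lia.
pose G b := odflt z [pick g | [exists c, [&& lnk g b c, b \in A z, c \notin A z & d (p z) b <= 2048 * L (sc z)]]].
have GP b : b \in S -> exists c, [&& lnk (G b) b c, b \in A z, c \notin A z & d (p z) b <= 2048 * L (sc z)].
  rewrite inE => /existsP[g hg]; rewrite /G; case: pickP => [g' /existsP[c hc]|/(_ g)]; last by rewrite hg.
  by exists c.
rewrite -(card_in_imset (f := G) (D := S)).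
  apply: subset_leq_card; apply/subsetP => _ /imsetP[b /GP[c hc] ->].
  by rewrite inE; apply/existsP; exists b; apply/existsP; exists c.
move=> b b' /GP[c /and4P[h1 h2 h3 _]] /GP[c' /and4P[h1' h2' h3' _]] eG.
by rewrite -eG in h1'; exact: lnk_uniq h1 h1' h2 h3 h2' h3'.
Qed.

Lemma compat_fail z z' : sc z <= sc z' -> ~~ compat z z' ->
  (sc z < sc z' /\ exists2 w, w \in far_witness z' & d (p z) w <= 2048 * L (sc z)) \/
  (sc z = sc z' /\ d (p z) (p z') <= 4096 * L (sc z)).
Proof.
rewrite /compat leq_eqVlt; case: (ltngtP (sc z) (sc z')) => //= [lt _|es _]; last first.
  by rewrite -ltnNge => h; right; split=> //; exact: ltnW.
rewrite !negb_and => h; left; split=> //; case/or3P: h => h.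
- by exists (p z'); [rewrite !inE eqxx | rewrite leqNgt].
- by exists (q z'); [rewrite !inE eqxx orbT | rewrite leqNgt].
case/forallPn: h => g /forallPn[b /forallPn[c]]; rewrite negb_imply -leqNgt.
case/andP=> /and4P[lg bA cA db] db'; exists b; last by rewrite distC.
rewrite !inE; apply/orP; right; apply/orP; right; apply/existsP; exists g; apply/existsP; exists c.
by rewrite lg bA cA distC.
Qed.

Lemma place_system_greedy (ZZ : {set E}) : ZZ \subset [set e in CE | loc e] ->
    {in ZZ &, forall z z', z != z' -> sc z <= sc z' -> compat z z'} ->
  place_system p q x TT ZZ sc A B (fun f => Vt (lnode f)) L0 Q.
Proof.
move=> ZC cmp.
have ZP z : z \in ZZ -> z \in CE /\ loc z by move/(subsetP ZC); rewrite inE => /andP.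
split=> //.
- by move=> z /ZP[zC _] u v; exact: connV.
- by move=> z /ZP[zC _] u v; exact: connV.
- by move=> f z fT zZ; have [_ h] := lnodeP f; exact: h.
- move=> f z fT zZ pB le; have [/andP[pl ql] _] := lnodeP f.
  have sub : Vt (lnode f) \subset B z.
    have [v [v1 v2]] : exists v, v \in Vt (lnode f) /\ v \in B z.
      by case/orP: pB => h; [exists (p f) | exists (q f)].
    have [//|sub] := laminar v1 v2.
    by have /eqP -> : B z == Vt (lnode f) by rewrite eqEcard sub le.
  by rewrite /Multigraph.in2 !(subsetP sub).
- by move=> z _; exact: Vpar.
- by move=> z /ZP[/CEp].
- by move=> z /ZP[/CEq/setDP[]].
- by move=> z /ZP[/CEq/setDP[]].
- by move=> z /ZP[/CElen].
- move=> z z' zZ z'Z es ne; have := cmp z z' zZ z'Z ne; rewrite /compat es ltnn eqxx.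
  by apply.
- by move=> z /ZP[_ /and4P[/existsP[v /andP[vA dv]] _ _ _]]; exists v.
- by move=> z /ZP[_ /and4P[_ /existsP[v /andP[vA dv]] _ _]]; exists v.
- move=> z f a b /ZP[_ /and4P[_ _ /forallP h _]] fT fB lf aA bA.
  by have /implyP/(_ fT)/forallP/(_ a)/forallP/(_ b)/implyP := h f; apply; rewrite fB lf aA.
- move=> z f a b /ZP[_ /and4P[_ _ _ /forallP h]] fT lf da.
  by have /implyP/(_ fT)/forallP/(_ a)/forallP/(_ b)/implyP := h f; apply; rewrite lf.
- move=> z z' zZ z'Z lt; have ne : z != z' by apply: contraTN lt => /eqP ->; rewrite ltnn.
  by have := cmp z z' zZ z'Z ne (ltnW lt); rewrite /compat lt => /and3P[].
move=> z z' g b c zZ z'Z lt lg bA cA db.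
have ne : z != z' by apply: contraTN lt => /eqP ->; rewrite ltnn.
have := cmp z z' zZ z'Z ne (ltnW lt); rewrite /compat lt => /and3P[_ _ /forallP h].
by have /forallP/(_ b)/forallP/(_ c)/implyP := h g; apply; rewrite lg bA cA db.
Qed.

Lemma sum_scale_below M X : \sum_(n < M) (L n < X) * L n <= 2 * X.
Proof.
have Q2 : 2 <= Q by apply: leq_trans Q1024.
elim: M => [|M IH]; first by rewrite big_ord0.
rewrite big_ord_recr /=; case: ltnP => h; last by rewrite mul0n addn0.
rewrite mul1n; apply: leq_trans (_ : \sum_(i < M) L i + L M <= _).
  by rewrite leq_add2r; apply: leq_sum => i _; rewrite -[X in _ <= X]mul1n leq_mul2r leq_b1 orbT.
have -> : \sum_(i < M) L i + L M = \sum_(i < M.+1) L i by rewrite big_ord_recr.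
rewrite -big_distrr /=; apply: leq_trans (_ : L0 * (2 * Q ^ M) <= _).
  by rewrite leq_mul2l sum_geometric_le ?orbT.
by rewrite mulnCA leq_mul2l (ltnW h).
Qed.

(** Here [2 * (K + 2) <= Q] is spent: the far witnesses of a place, taken at every smaller scale,
    cost no more than its radius. *)
Lemma sum_scale_lt m : \sum_(n < m) L n * (K + 2) <= L m.
Proof.
case: m => [|m]; first by rewrite big_ord0.
rewrite -big_distrl /= -big_distrr /=.
apply: leq_trans (_ : L0 * (2 * Q ^ m) * (K + 2) <= _).
  by rewrite leq_mul2r leq_mul2l sum_geometric_le ?orbT //; apply: leq_trans Q1024.
rewrite -mulnA leq_mul2l; apply/orP; right.
by rewrite expnS mulnAC leq_mul2r QK orbT.
Qed.

(** The constant 6 is 4 for long tree edges (two ends, and a factor 2 for the geometric sum), 1 for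
    far witnesses and 1 for the places, the last two by [places_sum]. *)
Theorem anchors M : (forall e, e \in CE -> sc e < M) ->
  exists (Wg : nat -> {set V}) (Wl : N -> {set V}) (F : N -> nat),
  [/\ forall e, e \in CE -> exists2 w, w \in Wg (sc e) :|: Wl (nd e) & d (p e) w <= 4096 * L (sc e),
     \sum_(n < M) L n * #|Wg n| <= 6 * \sum_(f in TT) len f,
     forall t, #|Wl t| <= F t + 2 * treedeg t &
     forall t, F t * K <= #|[set g | crossV t g]|].
Proof.
move=> scM.
have /fin_all_exists2[Wf Wf1 Wf2] := fine_anchors.
have [|ZZ ZC [cmp hmax]] := @greedy_selection E [set e in CE | loc e && ~~ fine e] sc compat.
  by move=> e e' es; rewrite /compat es ltnn eqxx distC.
have ZC' : ZZ \subset [set e in CE | loc e].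
  by apply: (subset_trans ZC); apply/subsetP => e; rewrite !inE => /and3P[-> ->].
have PS := place_system_greedy ZC' cmp.
have ZP z : z \in ZZ -> z \in CE /\ ~~ fine z.
  by move/(subsetP ZC); rewrite inE => /and3P[].
have hsum := places_sum PS.
pose Wlong n : {set V} := \bigcup_(f in TT) (if 4 * L n < len f then [set p f; q f] else set0).
pose Wdisc n : {set V} := \bigcup_(z in ZZ) (if n < sc z then far_witness z else set0).
pose Wgood n : {set V} := p @: [set z in ZZ | sc z == n].
exists (fun n => Wlong n :|: Wdisc n :|: Wgood n), (fun t => Wf t :|: exc_anchors t), (fun t => #|Wf t|).
have l24 n : 2048 * L n <= 4096 * L n by rewrite leq_mul2r orbT.
split=> //.
- move=> e eC; have [fe|nfe] := boolP (fine e).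
    have [w wW dw] := Wf2 (nd e) e eC erefl fe.
    by exists w; rewrite // !in_setU wW !orbT.
  have [le|nle] := boolP (loc e); last first.
    have [[w wW dw]|[f [w [fT wf lf dw]]]] := loc_fail eC nle.
      by exists w; [rewrite !in_setU wW !orbT | exact: leq_trans dw (l24 _)].
    exists w; last exact: leq_trans dw (l24 _).
    rewrite !in_setU; do 3![apply/orP; left]; apply/bigcupP; exists f => //.
    by rewrite lf !inE.
  have [|eZ|[z zZ [les nc]]] := hmax e; first by rewrite inE eC le nfe.
    exists (p e); last by rewrite distxx.
    by rewrite !in_setU [_ \in Wgood _]imset_f ?orbT // inE eZ eqxx.
  case: (compat_fail les nc) => [[lt [w wW dw]]|[es dw]].
    exists w; last exact: leq_trans dw (l24 _).
    rewrite !in_setU; apply/orP; left; apply/orP; left; apply/orP; right.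
    by apply/bigcupP; exists z => //; rewrite lt.
  exists (p z) => //.
  by rewrite !in_setU [_ \in Wgood _]imset_f ?orbT // inE zZ es eqxx.
- apply: leq_trans (_ : \sum_(n < M) (L n * #|Wlong n| + L n * #|Wdisc n| + L n * #|Wgood n|) <= _).
    apply: leq_sum => n _; rewrite -!mulnDr leq_mul2l; apply/orP; right.
    apply: leq_trans (card_setU_le _ _) _; rewrite leq_add2r.
    exact: card_setU_le _ _.
  rewrite !big_split /=.
  have h1 : \sum_(n < M) L n * #|Wlong n| <= 4 * \sum_(f in TT) len f.
    apply: leq_trans (_ : \sum_(n < M) \sum_(f in TT) 2 * ((L n < len f) * L n) <= _).
      apply: leq_sum => n _; apply: leq_trans (_ : L n * \sum_(f in TT) 2 * (L n < len f) <= _).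
        rewrite leq_mul2l; apply/orP; right; apply: leq_trans (card_bigcup_leq_sum _ _) _.
        apply: leq_sum => f _; case: ifP => h; rewrite ?cards0 //.
        have -> : L n < len f by apply: leq_ltn_trans h; rewrite leq_pmull.
        by rewrite cards2; case: (_ != _).
      by rewrite big_distrr /=; apply: leq_sum => f _; rewrite mulnCA leq_mul2l mulnC leqnn orbT.
    rewrite exchange_big /= big_distrr /=; apply: leq_sum => f _.
    rewrite -big_distrr /= (_ : 4 = 2 * 2) // -mulnA leq_mul2l /=; exact: sum_scale_below.
  have h2 : \sum_(n < M) L n * #|Wdisc n| <= \sum_(z in ZZ) L (sc z).
    apply: leq_trans (_ : \sum_(n < M) \sum_(z in ZZ) (n < sc z) * (L n * (K + 2)) <= _).
      apply: leq_sum => n _; apply: leq_trans (_ : L n * \sum_(z in ZZ) (n < sc z) * (K + 2) <= _).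
        rewrite leq_mul2l; apply/orP; right; apply: leq_trans (card_bigcup_leq_sum _ _) _.
        apply: leq_sum => z /ZP[_ nf]; case: ifP => h; rewrite ?cards0 // mul1n.
        exact: card_far_witness.
      by rewrite big_distrr /=; apply: leq_sum => z _; rewrite mulnCA.
    rewrite exchange_big; apply: leq_sum => z zZ.
    apply: leq_trans (sum_scale_lt (sc z)).
    have lt : sc z < M by apply: scM; have [] := ZP z zZ.
    rewrite (big_ord_widen _ (fun n => L n * (K + 2)) (ltnW lt)) [X in _ <= X]big_mkcond /=.
    by apply: leq_sum => n _; case: ifP; rewrite ?mul1n.
  have h3 : \sum_(n < M) L n * #|Wgood n| <= \sum_(z in ZZ) L (sc z).
    apply: leq_trans (_ : \sum_(n < M) \sum_(z in ZZ) (sc z == n) * L (sc z) <= _).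
      apply: leq_sum => n _; apply: leq_trans (_ : L n * #|[set z in ZZ | sc z == n]| <= _).
        by rewrite leq_mul2l leq_imset_card orbT.
      rewrite -sum_bool_card big_distrr /=; apply: leq_sum => z _.
      by case: eqP => [->|_]; rewrite ?muln0 // muln1 mul1n.
    rewrite exchange_big; apply: leq_sum => z zZ; rewrite -big_distrl /=.
    rewrite -[X in _ <= X]mul1n leq_mul2r; apply/orP; right.
    have lt : sc z < M by apply: scM; have [] := ZP z zZ.
    rewrite (bigD1 (Ordinal lt)) //= eqxx big1 // => n ne; apply/eqP; rewrite eqb0.
    by apply: contra ne => /eqP h; apply/eqP/val_inj.
  move: h1 h2 h3 hsum; move: (\sum_(z in ZZ) _) (\sum_(f in TT) _) (\sum_(n < M) _) (\sum_(n < M) _) (\sum_(n < M) _).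
  clear; lia.
move=> t; apply: leq_trans (card_setU_le _ _) _.
by rewrite leq_add2l card_exc_anchors.
Qed.

End Anchors.

End Anchor.
Import Anchor.

(** * Counting the net points near a given point *)

Module Label.
Local Open Scope nat_scope.

Section Labels.
Variables (V E I : finType) (p q : E -> V) (x : V -> I -> bool) (TT : {set E}).
Variables (r0 Q D G M : nat) (Nn : nat -> {set V}).
Notation d := (dist x).
Notation len e := (dist x (p e) (q e)).
Notation u n := (r0 * Q ^ n).
Notation conn := (conn p q).
Notation lnk := (lnk p q).
Hypothesis r0pos : 0 < r0.
Hypothesis Q1024 : 1024 <= Q.
Hypothesis QD : 160 * D <= Q.
Hypothesis Dpos : 0 < D.
Hypothesis GD : 42 * D <= G.
Hypothesis connT : forall u v, conn (mem TT) u v.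
Hypothesis separated : forall n, n < M -> {in Nn n &, forall c c', c != c' -> 32 * u n <= d c c'}.

Lemma u_pos n : 0 < u n.
Proof. by rewrite muln_gt0 r0pos expn_gt0 (leq_trans _ Q1024). Qed.

Lemma u_lt n n' : n' < n -> 160 * D * u n' <= u n.
Proof.
move=> lt; rewrite mulnCA leq_mul2l; apply/orP; right.
rewrite -(subnK lt) addnS -addSn expnD; apply: leq_mul => //.
rewrite expnS; apply: (leq_trans QD).
by rewrite leq_pmulr // expn_gt0 (leq_trans _ Q1024).
Qed.

(* A long label is charged to the long tree edge near it.  Fat labels come in groups
   of at least [G] separated members; the tree joins the members of a group, so the
   pieces near them have large total size, and the coarsening bounds the sum of these
   sizes over all groups and scales. *)
Definition long_labels n := [set c in Nn n | [exists f in TT, exists b,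
  [&& (b == p f) || (b == q f), d c b <= 4 * u n & u n < len f]]].
Definition short_labels n := Nn n :\: long_labels n.
Definition fat_labels n :=
  [set c in short_labels n | G <= #|[set c' in short_labels n | d c c' <= 32 * D * u n]|].

(** Labels are [32 * u n] apart and choose an end of a tree edge within [4 * u n], so the choice is
    injective. The 4 is two ends times 2 for the geometric sum over scales below the edge length. *)
Lemma sum_long : \sum_(n < M) u n * #|long_labels n| <= 4 * \sum_(f in TT) len f.
Proof.
have bound n : n < M -> #|long_labels n| <= \sum_(f in TT) 2 * (u n < len f).
  move=> nM.
  pose W : {set V} := \bigcup_(f in TT) (if u n < len f then [set p f; q f] else set0).
  apply: leq_trans (_ : #|W| <= _); last first.
    apply: leq_trans (card_bigcup_leq_sum _ _) _; apply: leq_sum => f _; case: ifP; rewrite ?cards0 //.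
    by rewrite cards2; case: (_ != _).
  pose g c := odflt c [pick b in W | d c b <= 4 * u n].
  have gP c : c \in long_labels n -> g c \in W /\ d c (g c) <= 4 * u n.
    rewrite inE => /andP[_ /existsP[f /andP[fT /existsP[b /and3P[hb db lf]]]]].
    rewrite /g; case: pickP => [b' /andP[-> ->] //|/(_ b)]; rewrite db andbT => /negP[].
    by apply/bigcupP; exists f => //; rewrite lf !inE.
  rewrite -(card_in_imset (f := g) (D := long_labels n)).
    by apply: subset_leq_card; apply/subsetP => _ /imsetP[c /gP[h _] ->].
  move=> c c' hc hc' e; apply/eqP; apply: contraT => ne.
  have [cN c'N] : c \in Nn n /\ c' \in Nn n by move: hc hc'; rewrite !inE => /andP[-> _] /andP[].
  have := separated nM cN c'N ne; have := (gP _ hc).2; have := (gP _ hc').2; rewrite -e.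
  have := dist_tri x (g c) c c'; rewrite (distC x (g c) c'); have := u_pos n.
  move: (u n); clear; lia.
apply: leq_trans (_ : \sum_(n < M) \sum_(f in TT) 2 * ((u n < len f) * u n) <= _).
  apply: leq_sum => n _; apply: leq_trans (_ : u n * \sum_(f in TT) 2 * (u n < len f) <= _).
    by rewrite leq_mul2l bound ?orbT.
  by rewrite big_distrr /=; apply: leq_sum => f _; rewrite mulnCA leq_mul2l mulnC leqnn orbT.
rewrite exchange_big /= big_distrr /=; apply: leq_sum => f _.
rewrite -big_distrr /= (_ : 4 = 2 * 2) // -mulnA leq_mul2l /=; exact: sum_scale_below.
Qed.

Variable Z : 'I_M -> {set V}.
Hypothesis Zfat : forall n, Z n \subset fat_labels n.
Hypothesis Zsep : forall n, {in Z n &, forall c c', c != c' -> 64 * D * u n < d c c'}.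
Hypothesis Zmax : forall n : 'I_M, {in fat_labels n, forall c, exists2 a, a \in Z n & d a c <= 64 * D * u n}.

(** Labels within [32 * D * u n] of a centre go there first, unambiguously since centres are more
    than [64 * D * u n] apart; this gives each group its [G] members. The second clause covers the
    remaining fat labels. *)
Definition owner (n : 'I_M) c : option V :=
  if [pick a in Z n | d a c <= 32 * D * u n] is Some a then Some a
  else if c \in fat_labels n then [pick a in Z n | d a c <= 64 * D * u n] else None.
Definition group (n : 'I_M) a : {set V} := [set c in short_labels n | owner n c == Some a].

Lemma group_near (n : 'I_M) a c : c \in group n a -> d a c <= 64 * D * u n.
Proof.
rewrite inE => /andP[_]; rewrite /owner; case: pickP => [a' /andP[_ h] /eqP[<-]|_].
  by apply: (leq_trans h); rewrite leq_mul2r leq_mul2r !orbT.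
by case: ifP => // _; case: pickP => // a' /andP[_ h] /eqP[<-].
Qed.

Lemma group_uniq (n : 'I_M) a a' c : c \in group n a -> c \in group n a' -> a = a'.
Proof. by rewrite !inE => /andP[_ /eqP ->] /andP[_ /eqP[]]. Qed.

Lemma group_short (n : 'I_M) a c : c \in group n a -> c \in short_labels n.
Proof. by rewrite inE => /andP[]. Qed.

Lemma group_sep (n : 'I_M) a a' c c' : c \in group n a -> c' \in group n a' -> c != c' -> 32 * u n <= d c c'.
Proof.
move=> /group_short/setDP[h _] /group_short/setDP[h' _].
exact: (separated (ltn_ord n)).
Qed.

Lemma group_card (n : 'I_M) a : a \in Z n -> G <= #|group n a|.
Proof.
move=> aZ; have := subsetP (Zfat n) a aZ; rewrite inE => /andP[_ h].
apply: (leq_trans h); apply: subset_leq_card; apply/subsetP => c /setIdP[cS dc].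
rewrite inE cS /= /owner; case: pickP => [a' /andP[a'Z da']|/(_ a)]; last by rewrite aZ dc.
apply/eqP; congr Some; apply/eqP; apply: contraT => ne.
have := Zsep a'Z aZ ne; have := dist_tri x c a' a; rewrite (distC x c a).
by rewrite -!(mulnA _ D) in dc da' *; move: (D * u n) dc da'; clear; lia.
Qed.

Lemma fat_cover (n : 'I_M) : fat_labels n \subset \bigcup_(a in Z n) group n a.
Proof.
apply/subsetP => c cF.
have cS : c \in short_labels n by move: cF; rewrite inE => /andP[].
have [a aZ ha] := Zmax cF.
have [a' oa a'Z] : exists2 a', owner n c = Some a' & a' \in Z n.
  rewrite /owner; case: pickP => [a' /andP[h _]|_]; first by exists a'.
  rewrite cF; case: pickP => [a' /andP[h _]|/(_ a)]; first by exists a'.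
  by rewrite aZ ha.
by apply/bigcupP; exists a' => //; rewrite inE cS oa eqxx.
Qed.

Definition gset (j : E + 'I_M * V) : {set V} :=
  match j with inl e => [set p e; q e] | inr z => \bigcup_(c in group z.1 z.2) ball x c (8 * u z.1) end.
Definition gsize (j : E + 'I_M * V) : nat :=
  match j with inl e => len e | inr z => 160 * D * u z.1 end.
Definition gsel (z : 'I_M * V) j :=
  (gsize j <= u z.1) && [exists c in group z.1 z.2, exists v in gset j, d c v <= 4 * u z.1].
Definition events : {set 'I_M * V} := [set z | z.2 \in Z z.1].
Definition agenda := sort (fun z z' : 'I_M * V => z.1 <= z'.1) (enum events).

Lemma gset_diam j : {in gset j &, forall v w, d v w <= gsize j}.
Proof.
case: j => [e|[n a]] v w /=.
  by rewrite !inE => /orP[] /eqP-> /orP[] /eqP->; rewrite ?distxx // distC.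
case/bigcupP=> c /group_near h1 + /bigcupP[c' /group_near h2].
rewrite !in_ball => h3 h4; have := dist_tri x c v w; have := dist_tri x a c w; have := dist_tri x c' a w.
rewrite (distC x v c) (distC x c a) -!(mulnA _ D) in h1 h2 *.
have : u n <= D * u n by rewrite leq_pmull.
move: h1 h2 h3 h4; move: (D * u n) (u n); clear; lia.
Qed.

Lemma gsel_gset z j : gsel z j -> gset j \subset gset (inr z).
Proof.
case/andP=> sz /existsP[c /andP[cU /existsP[v /andP[vj dv]]]].
apply/subsetP => w wj; apply/bigcupP; exists c => //; rewrite in_ball.
have := gset_diam vj wj; have := dist_tri x v c w; move: (u _) sz dv; clear; lia.
Qed.

Notation cover := (cover TT gsize gsel).
Notation weight := (weight TT gsize gsel).

(** Around each member [c] of the group the tree crosses all levels below [4 * u]. The crossing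
    pieces have size at most [u]: [c] is short, pieces of smaller scales are negligible, and those
    fused at the same scale are too far away. So a piece serves one member only, the weight is at
    least [4 * 42 * D * u], and 33 * 160 <= 32 * 4 * 42. *)
Lemma event_collapses s1 z s2 : agenda = s1 ++ z :: s2 ->
  4 * u z.1 * #|group z.1 z.2| <= weight (cover s1) z /\ collapses TT gsize gsel (cover s1) z.
Proof.
move=> es; have [zE s1P] := sorted_key_prefix (key := fun z : 'I_M * V => z.1) es.
case: z es zE s1P => n a es; rewrite inE /= => aZ s1P.
have u0 := u_pos n.
have cU := group_card aZ.
have U2 : 1 < #|group n a| by apply: leq_trans cU; apply: leq_trans GD; move: Dpos; clear; lia.
have inset s e v w : lnk e v w -> v \in gset (cover s e) /\ w \in gset (cover s e).
  move=> l; split; apply: cover_hset => //; try exact: gsel_gset;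
  case/lnkP: l => [[h1 h2]|[h1 h2]]; by rewrite /= !inE -?h1 -?h2 eqxx ?orbT.
pose cr c s j := [exists v in gset j, exists w in gset j, d c v <= s < d c w].
have wE : 4 * u n * #|group n a| <= weight (cover s1) (n, a).
  have lev c s : c \in group n a -> s < 4 * u n -> exists2 j, j \in picked TT gsel (cover s1) (n, a) & cr c s j.
    move=> cg sn.
    have [c' c'g nc] : exists2 c', c' \in group n a & c' != c.
      have : 0 < #|group n a :\ c| by move: U2; rewrite (cardsD1 c) cg; clear; lia.
      by case/card_gt0P=> c'; rewrite in_setD1 => /andP[h1 h2]; exists c'.
    have far : s < d c c'.
      have := group_sep c'g cg nc; rewrite distC; move: (u n) u0 sn; clear; lia.
    have [||e [v [w [eT le vW wW _]]]] := conn_exit (W := ball x c s) (connT c c').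
    - by rewrite in_ball distxx.
    - by rewrite in_ball -ltnNge.
    rewrite !in_ball -?ltnNge in vW wW.
    have [hv hw] := inset s1 e v w le.
    exists (cover s1 e); last first.
      by apply/existsP; exists v; rewrite hv; apply/existsP; exists w; rewrite hw vW wW.
    have dv : d c v <= 4 * u n by apply: leq_trans vW (ltnW sn).
    rewrite inE imset_f //=; apply/andP; split; last first.
      by apply/existsP; exists c; rewrite cg; apply/existsP; exists v; rewrite hv.
    case E1 : (cover s1 e) => [e'|[n' a']] /=.
      rewrite (cover_inl E1); have /setDP[cN] := group_short cg; rewrite inE cN /=.
      have {}eT : e \in TT by []. 
      move=> /existsPn/(_ e); rewrite eT /= => /existsPn/(_ v).
      by case/lnkP: le => [[h1 _]|[_ h1]]; rewrite h1 eqxx ?orbT dv /= -leqNgt.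
    have /and3P[ev ne le'] := s1P _ (cover_inr E1).
    move: le'; rewrite /= leq_eqVlt => /orP[/eqP en|]; last exact: u_lt.
    have en' : n' = n by exact: val_inj.
    subst n'; move: hv; rewrite E1 => /bigcupP[c2 /= c2g]; rewrite in_ball => dc2.
    have ncc : c != c2.
      apply: contraNneq ne => ec; subst c2.
      by rewrite (group_uniq cg c2g).
    have := group_sep cg c2g ncc; have := dist_tri x v c c2; rewrite (distC x v c2).
    move: (u n) u0 dv dc2; clear; lia.
  apply: leq_trans (_ : \sum_(j in picked TT gsel (cover s1) (n, a)) \sum_(c in group n a) \sum_(s < 4 * u n) cr c s j <= _).
    rewrite exchange_big /= mulnC -sum_nat_const; apply: leq_sum => c cg.
    rewrite exchange_big /= -[X in X <= _](card_ord (4 * u n)) -sum1_card; apply: leq_sum => s _.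
    have [j jp cj] := lev c s cg (ltn_ord s).
    by rewrite (bigD1 j) //= cj.
  apply: leq_sum => j; rewrite inE => /andP[_ /andP[sj _]].
  have [c /andP[cg hc]|none] := pickP (fun c => (c \in group n a) && [exists s : 'I_(4 * u n), cr c s j]); last first.
    rewrite big1 // => c cg; rewrite big1 // => s _; apply/eqP; rewrite eqb0.
    by have := none c; rewrite cg => /existsP h; apply/negP => h2; apply: h; exists s.
  rewrite (bigD1 c) //= [X in _ + X]big1 ?addn0.
    by apply: level_crossings; exact: gset_diam.
  move=> c' /andP[c'g ne]; rewrite big1 // => s _; apply/eqP; rewrite eqb0; apply/negP.
  case/existsP=> v /andP[vj /existsP[w /andP[_ /andP[vs _]]]].
  case/existsP: hc => s' /existsP[v' /andP[v'j /existsP[w' /andP[_ /andP[v's _]]]]].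
  have := group_sep cg c'g; rewrite eq_sym => /(_ ne).
  have := gset_diam v'j vj; have := dist_tri x v' c c'; have := dist_tri x v v' c'.
  rewrite (distC x v c'); rewrite /= in sj.
  have := leq_trans v's (ltnW (ltn_ord s')); have := leq_trans vs (ltnW (ltn_ord s)).
  move: sj u0; move: (gsize j) (u n); clear; lia.
split=> //; rewrite /collapses /=.
apply: leq_trans (_ : 32 * (4 * u n * #|group n a|) <= _); last by rewrite leq_mul2l wE.
apply: leq_trans (_ : 32 * (4 * u n * (42 * D)) <= _).
  by move: (u n) => m; clear; lia.
by rewrite !leq_mul2l (leq_trans GD cU) !orbT.
Qed.

Lemma sum_fat : \sum_(n < M) u n * #|fat_labels n| <= 9 * \sum_(f in TT) len f.
Proof.
have uA : uniq agenda by rewrite sort_uniq enum_uniq.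
have hw := coarsening_weight TT gsize gsel uA.
have h1 : \sum_(z in events) 4 * (u z.1 * #|group z.1 z.2|) <= 33 * \sum_(e in TT) len e.
  apply: leq_trans hw; rewrite -big_enum /=.
  have pe : perm_eq (enum events) agenda by rewrite perm_sym perm_sort.
  rewrite (perm_big _ pe) /= [X in _ <= X]big_mkcond /=.
  rewrite big_seq [X in _ <= X]big_seq; apply: leq_sum => z zA.
  have [s1 [s2 es]] : exists s1 s2, agenda = s1 ++ z :: s2.
    by case/splitPr: zA => s1 s2; exists s1, s2.
  have [h1 h2] := event_collapses es.
  have -> : before TT gsize gsel agenda z = cover s1.
    have zs1 : z \notin s1.
      by move: uA; rewrite es cat_uniq => /and3P[_ /hasPn/(_ z (mem_head _ _))].
    by rewrite /before es index_cat (negPf zs1) /= eqxx addn0 take_size_cat.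
  by rewrite h2 mulnA.
have h2 : \sum_(n < M) u n * #|fat_labels n| <= \sum_(z in events) u z.1 * #|group z.1 z.2|.
  have -> : \sum_(z in events) u z.1 * #|group z.1 z.2| = \sum_(n < M) \sum_(a in Z n) u n * #|group n a|.
    by rewrite pair_big_dep; apply: eq_bigl => z; rewrite inE.
  apply: leq_sum => n _; rewrite -big_distrr leq_mul2l /=; apply/orP; right.
  apply: leq_trans (subset_leq_card (fat_cover n)) _.
  elim/big_rec2: _ => [|j k S _ h]; first by rewrite cards0.
  by apply: leq_trans (card_setU_le _ _) _; rewrite leq_add2l.
move: h1 h2; rewrite -big_distrr /=; move: (\sum_(z in events) _) (\sum_(f in TT) _) (\sum_(n < M) _); clear; lia.
Qed.

End Labels.

(** A set of small diameter lies near each of its members, so with more than [G] short labels in it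
    each of them would be fat. The 13 is 4 for long labels plus 9 for fat ones. *)
Theorem labels (V E I : finType) (p q : E -> V) (x : V -> I -> bool) (TT : {set E})
    (r0 Q D G M : nat) (Nn : nat -> {set V}) :
    0 < r0 -> 1024 <= Q -> 160 * D <= Q -> 0 < D -> 42 * D <= G ->
    (forall u v, conn p q (mem TT) u v) ->
    (forall n, n < M -> {in Nn n &, forall c c', c != c' -> 32 * (r0 * Q ^ n) <= dist x c c'}) ->
  exists NN : nat -> {set V},
  [/\ forall n, NN n \subset Nn n,
     \sum_(n < M) r0 * Q ^ n * #|NN n| <= 13 * \sum_(f in TT) dist x (p f) (q f) &
     forall n (S : {set V}), S \subset Nn n :\: NN n ->
       {in S &, forall c c', dist x c c' <= 32 * D * (r0 * Q ^ n)} -> #|S| <= G].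
Proof.
move=> r0pos Q1024 QD Dpos GD connT sep.
pose F := fat_labels p q x TT r0 Q D G Nn.
have : forall n : 'I_M, exists2 Z : {set V}, Z \subset F n &
   {in Z &, forall c c', c != c' -> 64 * D * (r0 * Q ^ n) < dist x c c'} /\
   {in F n, forall c, exists2 a, a \in Z & dist x a c <= 64 * D * (r0 * Q ^ n)}.
  move=> n; have [|Z ZF [h1 h2]] := @greedy_selection V (F n) (fun=> 0)
      (fun c c' => 64 * D * (r0 * Q ^ n) < dist x c c').
    by move=> c c' _; rewrite distC.
  exists Z => //; split; first by move=> c c' cZ c'Z ne; exact: h1.
  move=> c cF; case: (h2 c cF) => [cZ|[z zZ [_ hz]]]; first by exists c; rewrite ?distxx.
  by exists z => //; rewrite distC leqNgt.
move=> /fin_all_exists2[Z Zfat Z2].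
have hf := sum_fat r0pos Q1024 QD Dpos GD connT sep Zfat (fun n => (Z2 n).1) (fun n => (Z2 n).2).
have hl := sum_long p q TT r0pos Q1024 sep.
exists (fun n => long_labels p q x TT r0 Q Nn n :|: F n).
split.
- move=> n; rewrite subUset; apply/andP; split; apply/subsetP => c; rewrite !inE; first by case/andP.
  by case/andP=> /andP[].
- apply: leq_trans (_ : \sum_(n < M) (r0 * Q ^ n * #|long_labels p q x TT r0 Q Nn n| + r0 * Q ^ n * #|F n|) <= _).
    apply: leq_sum => n _; rewrite -mulnDr leq_mul2l; apply/orP; right.
    exact: card_setU_le _ _.
  rewrite big_split /= (_ : 13 = 4 + 9) // mulnDl; exact: leq_add hl hf.
move=> n S sub diam; have [c cS|S0] := pickP (mem S); last first.
  by rewrite (eq_card0 S0).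
rewrite leqNgt; apply/negP => big.
have short c' : c' \in S -> c' \in short_labels p q x TT r0 Q Nn n /\ c' \notin F n.
  move=> /(subsetP sub)/setDP[h]; rewrite in_setU negb_or => /andP[h1 h2].
  by rewrite in_setD h1 h.
have [cs /negP cF] := short c cS; apply: cF; rewrite inE cs /=.
apply: leq_trans (ltnW big) _; apply: subset_leq_card; apply/subsetP => c' c'S.
by rewrite inE (short c' c'S).1 diam.
Qed.

End Label.
Import Label.

(** * A cheap spanning tree connected in every cluster *)

Module SpanningTree.
Import Order.TTheory GRing.Theory Num.Theory.
Local Open Scope ring_scope.

Section MergeTree.
Variables (R : realDomainType) (V E : finType) (p q : E -> V).
Implicit Types (W S : {set V}).

Definition crossing S e := (p e \in S) != (q e \in S).

Definition bicoloured (C : finType) W (col : V -> C) : {set E} :=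
  [set e | in2 p q W e && (col (p e) != col (q e))].

Definition saturated (C : finType) W (col : V -> C) S :=
  forall u v, u \in W -> v \in W -> col u = col v -> u \in S -> v \in S.

(* With [n] colours there are at least [n k / 2] bicoloured edges.  Subtract the
   minimal cost from all of them and merge the two colours of a cheapest edge: the
   tree pays [n - 1] times this minimum, the whole graph at least [n k / 2] times. *)
Lemma merge_tree (C : finType) (k : nat) W (n : nat) (col : V -> C) (c : E -> R) :
    (0 < k)%N -> (#|col @: W| <= n)%N ->
    (forall e, e \in bicoloured W col -> 0 <= c e) ->
    (forall S, S \subset W -> S != set0 -> S != W -> saturated W col S ->
       (k <= #|[set e | in2 p q W e && crossing S e]|)%N) ->
  exists tau : {set E}, [/\ tau \subset bicoloured W col, (#|tau| <= #|col @: W|.-1)%N,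
     k%:R * \sum_(e in tau) c e <= 2%:R * \sum_(e in bicoloured W col) c e &
     forall S, S \subset W -> S != set0 -> S != W -> saturated W col S ->
       exists2 e, e \in tau & crossing S e].
Proof.
move=> k0; elim: n col c => [|n IH] col c cn c0 kcut.
  exists set0; split; rewrite ?sub0set ?cards0 // ?big_set0 ?mulr0.
    by rewrite mulr_ge0 ?ler0n // sumr_ge0.
  move=> S SW S0 _ _; case/set0Pn: S0 => v /(subsetP SW) vW.
  by move: cn; rewrite leqn0 cards_eq0 => /eqP h; have := imset_f col vW; rewrite h inE.
pose F := bicoloured W col.
have cross_bi S e : saturated W col S -> in2 p q W e -> crossing S e -> e \in F.
  move=> sat eW; rewrite inE eW; case/andP: (eW) => pW qW; apply: contraNN => /eqP ec.
  apply/eqP; apply/idP/idP => h; [exact: sat pW qW ec h | exact: sat qW pW (esym ec) h].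
have [e0 e0F|F0] := pickP (mem F); last first.
  exists set0; split; rewrite ?sub0set ?cards0 // ?big_set0 ?mulr0.
    by rewrite mulr_ge0 ?ler0n // sumr_ge0.
  move=> S SW S0 SnW sat; have := kcut S SW S0 SnW sat.
  rewrite leqNgt (leq_ltn_trans _ k0) // leqn0 cards_eq0; apply/eqP/setP => e; rewrite !inE.
  by apply/negP => /andP[eW ce]; have := cross_bi S e sat eW ce; have := F0 e; rewrite /= => ->.
have [e1 e1F emin] : exists2 e1, e1 \in F & forall e, e \in F -> c e1 <= c e.
  by have [e1 h1 h2] := Order.TotalTheory.arg_minP c e0F; exists e1.
have /andP[e1W e1c] : in2 p q W e1 && (col (p e1) != col (q e1)) by move: e1F; rewrite inE.
have /andP[p1W q1W] := e1W.
have img2 : (1 < #|col @: W|)%N.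
  have <- : #|[set col (p e1); col (q e1)]| = 2%N by rewrite cards2 e1c.
  by apply: subset_leq_card; rewrite subUset !sub1set !imset_f.
(* Each colour class is a saturated cut with at least [k] edges, and a bicoloured edge is counted by
   at most two classes. *)
have count : (k * #|col @: W| <= 2 * #|F|)%N.
  pose cls a := [set v in W | col v == a].
  apply: (@leq_trans (\sum_(a in col @: W) #|[set e | in2 p q W e && crossing (cls a) e]|)%N).
    rewrite mulnC -sum_nat_const; apply: leq_sum => _ /imsetP[v vW ->].
    apply: kcut.
    - by apply/subsetP => w; rewrite inE => /andP[].
    - by apply/set0Pn; exists v; rewrite inE vW eqxx.
    - apply/eqP => h; move: img2; rewrite ltnNge => /negP; apply.
      apply/card_le1_eqP => _ _ /imsetP[w wW ->] /imsetP[w' w'W ->].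
      by move: wW w'W; rewrite -h !inE => /andP[_ /eqP ->] /andP[_ /eqP ->].
    - by move=> w w' wW w'W e; rewrite !inE w'W wW e.
  apply: (@leq_trans (\sum_(a in col @: W) \sum_(e in F) ((col (p e) == a) + (col (q e) == a)))%N).
    apply: leq_sum => a aI; rewrite -sum1_card.
    rewrite [X in (_ <= X)%N]big_mkcond [X in (X <= _)%N]big_mkcond /=.
    apply: leq_sum => e _; rewrite inE; case: ifP => // /andP[eW].
    case/andP: (eW) => pW qW; rewrite inE eW /= /crossing !inE pW qW /=.
    have [-> | nc] := eqVneq (col (p e)) (col (q e)); first by rewrite eqxx.
    by case: (_ == a); case: (_ == a).
  rewrite exchange_big /= mulnC -sum_nat_const; apply: leq_sum => e _.
  have one b : (\sum_(a in col @: W) (b == a) <= 1)%N.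
    rewrite sum_bool_card; apply/card_le1_eqP => a a'.
    by rewrite !inE => /andP[_ /eqP <-] /andP[_ /eqP <-].
  by rewrite big_split /=; apply: (@leq_add _ _ 1 1); exact: one.
pose col' v := if col v == col (p e1) then col (q e1) else col v.
have col'E v w : col v = col w -> col' v = col' w by rewrite /col' => ->.
have F'F : bicoloured W col' \subset F.
  apply/subsetP => e; rewrite !inE => /andP[-> h] /=.
  by apply: contra h => /eqP h; rewrite (col'E _ _ h).
have satE S : saturated W col' S -> saturated W col S.
  by move=> sat u v uW vW e; apply: sat => //; exact: col'E.
have lt : (#|col' @: W| < #|col @: W|)%N.
  apply: proper_card; apply/properP; split.
    by apply/subsetP => _ /imsetP[v vW ->]; rewrite /col'; case: ifP => _; exact: imset_f.
  exists (col (p e1)); first exact: imset_f.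
  apply/imsetP => -[v _]; rewrite /col'; case: ifP => [_ | /eqP ne] h.
    by rewrite h eqxx in e1c.
  by rewrite h in ne.
have [|||tau [tF tn tc tS]] := IH col' (fun e => c e - c e1).
- by rewrite -ltnS (leq_trans lt).
- by move=> e eF; rewrite subr_ge0 emin // (subsetP F'F).
- by move=> S SW S0 SnW /satE; exact: kcut.
have e1t : e1 \notin tau.
  by apply/negP => /(subsetP tF); rewrite inE /col' eqxx; case: ifP; rewrite ?eqxx ?andbF.
exists (e1 |: tau); split.
- by rewrite subUset sub1set e1F (subset_trans tF F'F).
- by rewrite cardsU1 e1t /=; move: tn lt img2; clear; lia.
- rewrite big_setU1 //=.
  have eT : \sum_(e in tau) c e = \sum_(e in tau) (c e - c e1) + #|tau|%:R * c e1.
    by rewrite sumrB sumr_const mulr_natl subrK.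
  have eF : \sum_(e in F) c e = \sum_(e in F) (c e - c e1) + #|F|%:R * c e1.
    by rewrite sumrB sumr_const mulr_natl subrK.
  have F'le : \sum_(e in bicoloured W col') (c e - c e1) <= \sum_(e in F) (c e - c e1).
    rewrite [X in _ <= X](big_setID (bicoloured W col')) /= (setIidPr F'F) lerDl.
    by apply: sumr_ge0 => e /setDP[eFF _]; rewrite subr_ge0 emin.
  have c1 : 0 <= c e1 by exact: c0.
  have cnt : (k * #|tau|.+1 <= 2 * #|F|)%N.
    apply: leq_trans count; rewrite leq_mul2l; apply/orP; right.
    by move: tn lt img2; clear; lia.
  have cnt' : k%:R * (#|tau|%:R + 1) * c e1 <= 2%:R * #|F|%:R * c e1.
    by apply: ler_wpM2r => //; rewrite natr1 -!natrM ler_nat.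
  rewrite -/F eT eF; move: tc F'le cnt'.
  set a := \sum_(e in tau) (c e - c e1); set b := \sum_(e in bicoloured W col') _.
  set d := \sum_(e in F) (c e - c e1) => h1 h2 h3.
  have -> : k%:R * (c e1 + (a + #|tau|%:R * c e1)) = k%:R * a + k%:R * (#|tau|%:R + 1) * c e1.
    by ring.
  have -> : 2%:R * (d + #|F|%:R * c e1) = 2%:R * d + 2%:R * #|F|%:R * c e1 by ring.
  move: (k%:R * a) (k%:R * _ * _) (2%:R * #|F|%:R * _) h1 h3 => m1 m2 m3; lra.
move=> S SW S0 SnW sat.
have [ce|nce] := boolP (crossing S e1); first by exists e1; rewrite ?inE ?eqxx.
have sat' : saturated W col' S.
  have pq : (p e1 \in S) = (q e1 \in S) by apply/eqP; move: nce; rewrite /crossing negbK.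
  move=> u v uW vW; rewrite /col'; case: eqP => hu; case: eqP => hv h uS.
  - by apply: (sat u v) => //; rewrite hu hv.
  - by apply: (sat (q e1) v) => //; rewrite -pq; exact: (sat u).
  - by apply: (sat (p e1) v) => //; rewrite pq; exact: (sat u).
  - exact: (sat u).
have [e eT ce] := tS S SW S0 SnW sat'.
by exists e; rewrite // inE eT orbT.
Qed.

End MergeTree.

Section LaminarTree.
Variables (R : realDomainType) (V E N : finType) (p q : E -> V).
Variables (Vt : N -> {set V}) (ch : N -> {set N}) (rank : N -> nat) (k : nat) (c : E -> R).
Hypothesis kpos : (0 < k)%N.
Hypothesis c0 : forall e, 0 <= c e.
Hypothesis Vpos : (0 < #|V|)%N.
Hypothesis rank_ch : forall t s, s \in ch t -> (rank s < rank t)%N.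
Hypothesis leafV : forall t, ch t = set0 -> (#|Vt t| <= 1)%N.
Hypothesis chV : forall t v, ch t != set0 -> v \in Vt t -> exists2 s, s \in ch t & v \in Vt s.
Hypothesis ch_sub : forall t s, s \in ch t -> Vt s \subset Vt t.
Hypothesis ch_disj : forall t s s' v, s \in ch t -> s' \in ch t -> v \in Vt s -> v \in Vt s' -> s = s'.
Hypothesis ch_count : (\sum_t #|ch t|.-1 <= #|V|.-1)%N.
Hypothesis cmp : forall t t' v, v \in Vt t -> v \in Vt t' ->
  [\/ t = t', exists2 s, s \in ch t' & Vt t \subset Vt s | exists2 s, s \in ch t & Vt t' \subset Vt s].
Hypothesis top : exists r, Vt r = setT.
Hypothesis kcut : forall t (S : {set V}), S \subset Vt t -> S != set0 -> S != Vt t ->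
  (k <= #|[set e | in2 p q (Vt t) e && crossing p q S e]|)%N.

Let col t v := odflt t [pick s in ch t | v \in Vt s].

Lemma colP t s v : s \in ch t -> v \in Vt s -> col t v = s.
Proof.
move=> sc vs; rewrite /col; case: pickP => [s' /andP[s'c vs']|/(_ s)]; last by rewrite sc vs.
exact: ch_disj s'c sc vs' vs.
Qed.

Let F t := bicoloured p q (Vt t) (col t).

(** The only candidate is the smallest cluster containing both ends. Hence the costs at all nodes
    add up to at most the total cost. *)
Lemma bicoloured_uniq e t t' : e \in F t -> e \in F t' -> t = t'.
Proof.
move=> /setIdP[/andP[pt qt] nt] /setIdP[/andP[pt' qt'] nt'].
have bad s t1 : s \in ch t1 -> p e \in Vt s -> q e \in Vt s -> col t1 (p e) != col t1 (q e) -> False.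
  by move=> sc h1 h2; rewrite (colP sc h1) (colP sc h2) eqxx.
case: (cmp pt pt') => [//|[s sc sub]|[s sc sub]]; exfalso.
  by apply: (bad s t' sc) => //; exact: (subsetP sub).
by apply: (bad s t sc) => //; exact: (subsetP sub).
Qed.

(** [merge_tree] is applied at each node to the quotient by its children. Together the chosen sets
    have at most [#|V|.-1] edges by [ch_count], and connectivity turns this into the exact count. *)
Theorem laminar_tree : exists TT : {set E}, [/\ #|V| = #|TT|.+1,
  forall t, {in Vt t &, forall u v, conn p q (fun f => (f \in TT) && in2 p q (Vt t) f) u v} &
  k%:R * \sum_(e in TT) c e <= 2%:R * \sum_e c e].
Proof.
have /fin_all_exists[tau tauP] t := @merge_tree R V E p q N k (Vt t) _ (col t) c kpos (leqnn _)
   (fun e _ => c0 e) (fun S h1 h2 h3 _ => kcut h1 h2 h3).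
pose TT := \bigcup_t tau t.
have tauT t : tau t \subset TT by exact: bigcup_sup.
have conT : forall t, {in Vt t &, forall u v, conn p q (fun f => (f \in TT) && in2 p q (Vt t) f) u v}.
  move=> t; have [n] := ubnP (rank t); elim: n t => // n IH t rt u v ut vt.
  (* The component of [u] is saturated, since the children are connected by induction on [rank];
     were it proper, an edge of [tau t] would leave it. *)
  pose Cc := [set w in Vt t | conn p q (fun f => (f \in TT) && in2 p q (Vt t) f) u w].
  suff : v \in Cc by rewrite inE => /andP[].
  apply: contraT => vC.
  have [_ _ _ tS] := tauP t.
  have [||||e et] := tS Cc.
  - by apply/subsetP => w; rewrite inE => /andP[].
  - by apply/set0Pn; exists u; rewrite inE ut conn_refl.
  - by apply/eqP => h; rewrite h vt in vC.
  - move=> w w' wt w't ew; rewrite !inE => /andP[_ cw]; rewrite w't.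
    apply: (conn_trans cw).
    have [ch0|chn] := eqVneq (ch t) set0.
      have /card_le1_eqP h := leafV ch0; rewrite (h w w' wt w't); exact: conn_refl.
    have [s sc ws] := chV chn wt; have [s' s'c w's'] := chV chn w't.
    move: ew; rewrite (colP sc ws) (colP s'c w's') => es; subst s'.
    have rs : (rank s < n)%N by apply: leq_trans (rank_ch sc) _; rewrite -ltnS.
    apply: conn_sub (IH s rs w w' ws w's') => f /andP[-> /andP[h1 h2]].
    by rewrite /in2 !(subsetP (ch_sub sc)).
  have [tF _ _ _] := tauP t.
  have /setIdP[eW _] := subsetP tF e et.
  have eT := subsetP (tauT t) e et.
  have pq : conn p q (fun f => (f \in TT) && in2 p q (Vt t) f) (p e) (q e).
    by apply: conn1; rewrite eT eW.
  rewrite /crossing !inE; case/andP: eW => -> -> /=.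
  case: (boolP (conn _ _ _ u (p e))) => h1.
    by rewrite (conn_trans h1 pq).
  case: (boolP (conn _ _ _ u (q e))) => h2 //.
  by move: h1; rewrite (conn_trans h2) // conn_sym.
exists TT; split=> //.
  have h1 : (#|V| <= #|TT|.+1)%N.
    apply: (@connected_count _ _ p q) => u v; have [r hr] := top.
    have := conT r u v; rewrite hr !inE => /(_ isT isT); apply: conn_sub => f.
    by case/andP.
  have h2 : (#|TT| <= #|V|.-1)%N.
    apply: leq_trans ch_count; apply: (@leq_trans (\sum_t #|tau t|)%N).
      rewrite /TT; elim/big_rec2: _ => [|j n U _ h]; first by rewrite cards0.
      by apply: leq_trans (card_setU_le _ _) _; rewrite leq_add2l.
    apply: leq_sum => t _; have [_ h _ _] := tauP t; apply: (leq_trans h).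
    have [ch0|chn] := eqVneq (ch t) set0.
      have := leafV ch0; have := leq_imset_card (col t) (Vt t); rewrite ch0 cards0; clear; lia.
    have sub : col t @: Vt t \subset ch t.
      by apply/subsetP => _ /imsetP[v vt ->]; have [s sc vs] := chV chn vt; rewrite (colP sc vs).
    have := subset_leq_card sub; clear; lia.
  by move: h1 h2 Vpos; clear; lia.
have h1 : \sum_(e in TT) c e <= \sum_t \sum_(e in tau t) c e.
  have -> : \sum_t \sum_(e in tau t) c e = \sum_e \sum_t (if e \in tau t then c e else 0).
    by rewrite exchange_big; apply: eq_bigr => t _; rewrite big_mkcond.
  rewrite big_mkcond; apply: ler_sum => e _; case: ifP => [/bigcupP[t _ et]|_].
    rewrite (bigD1 t) //= et lerDl; apply: sumr_ge0 => t' _; by case: ifP.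
  by apply: sumr_ge0 => t' _; case: ifP.
have h2 : \sum_t \sum_(e in F t) c e <= \sum_e c e.
  have -> : \sum_t \sum_(e in F t) c e = \sum_e \sum_t (if e \in F t then c e else 0).
    by rewrite exchange_big; apply: eq_bigr => t _; rewrite big_mkcond.
  apply: ler_sum => e _.
  have [t et|no] := pickP (fun t => e \in F t); last first.
    by rewrite big1 // => t _; rewrite no.
  rewrite (bigD1 t) //= et big1 ?addr0 // => t' ne; case: ifP => // et'.
  by rewrite (bicoloured_uniq et et') eqxx in ne.
apply: le_trans (_ : k%:R * \sum_t \sum_(e in tau t) c e <= _).
  by rewrite ler_wpM2l ?ler0n.
apply: le_trans (_ : 2%:R * \sum_t \sum_(e in F t) c e <= _); last by rewrite ler_wpM2l ?ler0n.
rewrite !mulr_sumr; apply: ler_sum => t _; have [_ _ h _] := tauP t; exact: h.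
Qed.

End LaminarTree.

End SpanningTree.
Import SpanningTree.

(** * Inner products, Bessel's inequality and energies in spans *)

Module Energy.
Import Order.TTheory GRing.Theory Num.Theory.
Local Open Scope ring_scope.

Section InnerProduct.
Variables (F : realFieldType) (h : nat).
Implicit Types (u v w : 'I_h -> F).

Definition dot u v : F := \sum_i u i * v i.

Lemma dotC u v : dot u v = dot v u.
Proof. by apply: eq_bigr => i _; rewrite mulrC. Qed.

Lemma dot_ge0 u : 0 <= dot u u.
Proof. by apply: sumr_ge0 => i _; rewrite -expr2 sqr_ge0. Qed.

Lemma dot_eq0 u i : dot u u = 0 -> u i = 0.
Proof.
move=> /eqP; rewrite psumr_eq0 => [/allP/(_ i)|j _]; last by rewrite -expr2 sqr_ge0.
by rewrite mem_index_enum -expr2 sqrf_eq0 => /(_ isT)/eqP.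
Qed.

Lemma dot_suml (J : Type) (s : seq J) (P : pred J) (a : J -> F) (f : J -> 'I_h -> F) u v :
    (forall i, u i = \sum_(j <- s | P j) a j * f j i) ->
  dot u v = \sum_(j <- s | P j) a j * dot (f j) v.
Proof.
move=> ue; rewrite /dot; under eq_bigr => i _ do rewrite ue mulr_suml.
rewrite exchange_big; apply: eq_bigr => j _; rewrite mulr_sumr.
by apply: eq_bigr => i _; rewrite mulrA.
Qed.

Lemma dotDl u v w : dot (fun i => u i + v i) w = dot u w + dot v w.
Proof. by rewrite /dot -big_split; apply: eq_bigr => i _; rewrite mulrDl. Qed.

Lemma cauchy_schwarz (J : eqType) (s : seq J) (w f g : J -> F) :
    (forall j, j \in s -> 0 <= w j) ->
  (\sum_(j <- s) w j * (f j * g j)) ^+ 2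
    <= (\sum_(j <- s) w j * f j ^+ 2) * (\sum_(j <- s) w j * g j ^+ 2).
Proof.
move=> w0; set A := \sum_(j <- s) w j * f j ^+ 2; set B := \sum_(j <- s) w j * g j ^+ 2.
set C := \sum_(j <- s) _.
have pos (t : J -> F) j : j \in s -> 0 <= w j * t j ^+ 2.
  by move=> js; rewrite mulr_ge0 ?sqr_ge0 ?w0.
have B0 : 0 <= B by rewrite /B big_seq sumr_ge0 // => j; exact: pos.
have [Bz|Bn] := eqVneq B 0.
  suff -> : C = 0 by rewrite expr0n /= Bz mulr0.
  rewrite /C big_seq big1 // => j js; move: Bz; rewrite /B big_seq => /eqP.
  rewrite psumr_eq0 => [/allP/(_ j js)|i]; last exact: pos.
  rewrite js /= mulf_eq0 sqrf_eq0 => /orP[] /eqP ->; by rewrite ?mul0r ?mulr0.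
have key : 0 <= B * (A * B - C ^+ 2).
  have -> : B * (A * B - C ^+ 2) = \sum_(j <- s) w j * (B * f j - C * g j) ^+ 2.
    have -> : \sum_(j <- s) w j * (B * f j - C * g j) ^+ 2 =
       \sum_(j <- s) (B ^+ 2 * (w j * f j ^+ 2) - 2%:R * B * C * (w j * (f j * g j))
          + C ^+ 2 * (w j * g j ^+ 2)) by apply: eq_bigr => j _; ring.
    rewrite big_split sumrB -!mulr_sumr /= -/A -/B -/C; ring.
  by rewrite big_seq sumr_ge0 // => j; exact: (pos (fun j => B * f j - C * g j)).
by rewrite pmulr_rge0 ?subr_ge0 // lt_def Bn in key.
Qed.

Implicit Types (q : nat -> 'I_h -> F).

(* [x / 0 = 0], so null vectors in the orthogonal family [q] contribute nothing. *)
Definition expands n q v :=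
  forall i, v i = \sum_(j < n) dot v (q j) / dot (q j) (q j) * q j i.

Definition orthogonal_family n q := forall j k, (j < n)%N -> (k < n)%N -> j != k -> dot (q j) (q k) = 0.

Lemma expands_sum n q (J : finType) (C : {set J}) (a : J -> F) (g : J -> 'I_h -> F) v :
    (forall c, c \in C -> expands n q (g c)) ->
  (forall i, v i = \sum_(c in C) a c * g c i) -> expands n q v.
Proof.
move=> gq ve i; rewrite ve.
under eq_bigr => c cC do rewrite (gq c cC i) mulr_sumr.
rewrite exchange_big; apply: eq_bigr => j _ /=.
rewrite (dot_suml (q j) ve) !mulr_suml; apply: eq_bigr => c _.
by rewrite !mulrA.
Qed.

(** The family is left unnormalised, which avoids square roots in [F]; a dependent vector produces a
    null member. *)
Lemma gram_schmidt (g : nat -> 'I_h -> F) n : exists q, orthogonal_family n q /\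
  forall j, (j < n)%N -> expands n q (g j).
Proof.
elim: n => [|n [q [oq eq_]]]; first by exists g; split.
pose w i := g n i - \sum_(j < n) dot (g n) (q j) / dot (q j) (q j) * q j i.
pose q' j := if (j < n)%N then q j else w.
have q'n : q' n = w by rewrite /q' ltnn.
have q'lt j : (j < n)%N -> q' j = q j by rewrite /q' => ->.
have gw i : g n i = w i + \sum_(j < n) dot (g n) (q j) / dot (q j) (q j) * q j i.
  by rewrite /w subrK.
have wq k : (k < n)%N -> dot w (q k) = 0.
  move=> kn; have e1 : dot (g n) (q k) = dot w (q k) + \sum_(j < n) dot (g n) (q j) / dot (q j) (q j) * dot (q j) (q k).
    pose z i := \sum_(j < n) dot (g n) (q j) / dot (q j) (q j) * q j i.
    rewrite -(dot_suml (u := z) (q k) (fun=> erefl)) -dotDl.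
    by apply: eq_bigr => i _; rewrite gw.
  rewrite (bigD1 (Ordinal kn)) //= big1 ?addr0 in e1; last first.
    by move=> j nj; rewrite (oq j k) ?mulr0.
  have [z|nz] := eqVneq (dot (q k) (q k)) 0.
    by rewrite /dot big1 // => i _; rewrite (dot_eq0 i z) mulr0.
  by move: e1; rewrite divfK // => /eqP; rewrite -subr_eq subrr => /eqP.
exists q'; split.
  move=> j k; rewrite ltnS leq_eqVlt => /orP jn; rewrite ltnS leq_eqVlt => /orP kn.
  case: jn => [/eqP ->|jn]; case: kn => [/eqP ->|kn] ne.
  - by rewrite eqxx in ne.
  - by rewrite q'n q'lt // wq.
  - by rewrite q'n q'lt // dotC wq.
  - by rewrite !q'lt // oq.
have sumq' v i : \sum_(j < n.+1) dot v (q' j) / dot (q' j) (q' j) * q' j i =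
    \sum_(j < n) dot v (q j) / dot (q j) (q j) * q j i + dot v w / dot w w * w i.
  by rewrite big_ord_recr /= q'n; congr (_ + _); apply: eq_bigr => j _; rewrite q'lt.
move=> j; rewrite ltnS leq_eqVlt => /orP[/eqP ->|jn] i; rewrite sumq'.
  rewrite {1}gw addrC; congr (_ + _).
  have -> : dot (g n) w = dot w w.
    pose z i := \sum_(j < n) dot (g n) (q j) / dot (q j) (q j) * q j i.
    have -> : dot (g n) w = dot w w + dot z w.
      by rewrite -dotDl; apply: eq_bigr => k _; rewrite gw.
    rewrite (dot_suml (u := z) w (fun=> erefl)) big1 ?addr0 // => k _.
    by rewrite (dotC (q k) w) wq ?mulr0.
  have [z|nz] := eqVneq (dot w w) 0; last by rewrite divff // mul1r.
  by rewrite (dot_eq0 i z) mulr0.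
suff -> : dot (g j) w = 0 by rewrite !mul0r addr0; exact: eq_.
rewrite (dot_suml w (eq_ j jn)) big1 // => k _.
by rewrite (dotC (q k) w) wq ?mulr0.
Qed.

Variables (E : finType) (U : E -> 'I_h -> F).
Hypothesis orthonormal : forall e e', dot (U e) (U e') = (e == e')%:R.

Lemma bessel v : \sum_e dot (U e) v ^+ 2 <= dot v v.
Proof.
pose z i := \sum_e dot (U e) v * U e i.
have zz : dot z z = \sum_e dot (U e) v ^+ 2.
  rewrite (dot_suml (u := z) z (fun=> erefl)); apply: eq_bigr => e _; rewrite expr2; congr (_ * _).
  rewrite dotC (dot_suml (u := z) (U e) (fun=> erefl)) (bigD1 e) //= orthonormal eqxx mulr1.
  by rewrite big1 ?addr0 // => e' ne; rewrite orthonormal (negPf ne) mulr0.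
have zv : dot z v = \sum_e dot (U e) v ^+ 2.
  by rewrite (dot_suml (u := z) v (fun=> erefl)); apply: eq_bigr => e _; rewrite expr2.
have := dot_ge0 (fun i => v i - z i).
have -> : dot (fun i => v i - z i) (fun i => v i - z i) = dot v v - 2%:R * dot z v + dot z z.
  rewrite /dot mulr_sumr -sumrB -big_split /=; apply: eq_bigr => i _; ring.
rewrite zz zv; move: (\sum_e _) => s; lra.
Qed.

(** [s e] is the squared length of the projection of [U e] to the span, and Bessel for each member
    of an orthogonal basis bounds its sum by the dimension. As [s] does not depend on [v], each edge
    may use its own vector. *)
Lemma span_energy (J : finType) (C : {set J}) (g : J -> 'I_h -> F) : exists s : E -> F,
  [/\ forall e, 0 <= s e, \sum_e s e <= #|C|%:R &
   forall e (a : J -> F) v, (forall i, v i = \sum_(c in C) a c * g c i) ->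
     dot (U e) v ^+ 2 <= s e * dot v v].
Proof.
have [c0 c0C|C0] := pickP (mem C); last first.
  exists (fun=> 0); split=> // [|e a v ve]; first by rewrite big1 // ler0n.
  by rewrite /dot big1 ?expr0n ?mul0r // => i _; rewrite ve big_pred0 ?mulr0.
have [q [oq eq_]] := gram_schmidt (fun j => g (nth c0 (enum C) j)) #|C|.
have gq c : c \in C -> expands #|C| q (g c).
  move=> cC; have := eq_ (index c (enum C)).
  by rewrite cardE index_mem mem_enum cC nth_index ?mem_enum // => /(_ isT).
exists (fun e => \sum_(j < #|C|) dot (U e) (q j) ^+ 2 / dot (q j) (q j)); split.
- by move=> e; apply: sumr_ge0 => j _; rewrite mulr_ge0 ?sqr_ge0 // invr_ge0 dot_ge0.
- apply: (@le_trans _ _ (\sum_(j < #|C|) 1)); last by rewrite sumr_const card_ord.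
  rewrite exchange_big /=; apply: ler_sum => j _.
  rewrite -mulr_suml; have [->|nz] := eqVneq (dot (q j) (q j)) 0; first by rewrite invr0 mulr0.
  by rewrite ler_pdivrMr ?lt_def ?nz ?dot_ge0 // mul1r bessel.
move=> e a v ve; have ev := expands_sum gq ve.
have e1 : dot (U e) v = \sum_(j < #|C|) (dot (q j) (q j))^-1 * (dot (U e) (q j) * dot v (q j)).
  rewrite dotC (dot_suml (U e) ev); apply: eq_bigr => j _; rewrite (dotC (q j) (U e)); ring.
have e2 : dot v v = \sum_(j < #|C|) (dot (q j) (q j))^-1 * dot v (q j) ^+ 2.
  rewrite {1}(dot_suml v ev); apply: eq_bigr => j _; rewrite (dotC (q j) v); ring.
have e3 : \sum_(j < #|C|) dot (U e) (q j) ^+ 2 / dot (q j) (q j)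
   = \sum_(j < #|C|) (dot (q j) (q j))^-1 * dot (U e) (q j) ^+ 2.
  by apply: eq_bigr => j _; rewrite mulrC.
rewrite e1 e2 e3; apply: cauchy_schwarz => j _; by rewrite invr_ge0 dot_ge0.
Qed.

Lemma dot_unit e v : dot (U e) v ^+ 2 <= dot v v.
Proof.
apply: le_trans (bessel v); rewrite (bigD1 e) //= lerDl; apply: sumr_ge0 => e' _; exact: sqr_ge0.
Qed.

End InnerProduct.

Section Energy.
Variables (F : realFieldType) (h : nat) (E : finType) (U : E -> 'I_h -> F).
Hypothesis orthonormal : forall e e', dot (U e) (U e') = (e == e')%:R.

Lemma sum_fibre_le (K : finType) (S : {set E}) (kap : E -> K) (f : K -> E -> F) :
  (forall k e, 0 <= f k e) -> \sum_(e in S) f (kap e) e <= \sum_k \sum_e f k e.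
Proof.
move=> f0; rewrite exchange_big big_mkcond; apply: ler_sum => e _ /=; case: ifP => _.
  by rewrite (bigD1 (kap e)) //= lerDl; apply: sumr_ge0 => k _; exact: f0.
by apply: sumr_ge0 => k _; exact: f0.
Qed.

Lemma card_bigcup_leqM (J V : finType) (W : {set V}) (nb : V -> {set J}) G :
  (forall w : V, #|nb w| <= G)%N -> (#|\bigcup_(w in W) nb w| <= G * #|W|)%N.
Proof.
move=> nbG; apply: leq_trans (card_bigcup_leq_sum _ _) _.
by rewrite mulnC -sum_nat_const; apply: leq_sum => w _.
Qed.

(* The label vectors of each [C1 n], of the neighbourhoods of [Wg n] and of those of
   [Wl t] span spaces of bounded dimension, to which Bessel's inequality applies. *)
Lemma piece_energy (N J V : finType) (M G : nat) (S : {set E}) (nd : E -> N) (sct : N -> 'I_M)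
    (om : N -> F) (b : 'I_M -> F) (lab : E -> {set J}) (g : 'I_M -> J -> 'I_h -> F)
    (Delta : E -> 'I_h -> F) (C1 : 'I_M -> {set J}) (nb : 'I_M -> V -> {set J})
    (Wg : 'I_M -> {set V}) (Wl : N -> {set V}) :
    (forall t, 0 <= om t <= 1) -> (forall n, 0 <= b n) ->
    (forall n (w : V), #|nb n w| <= G)%N ->
    (forall e, e \in S -> exists a : J -> F, forall i,
       Delta e i = \sum_(c in lab e) a c * g (sct (nd e)) c i) ->
    (forall e, e \in S -> dot (Delta e) (Delta e) <= b (sct (nd e))) ->
    (forall e, e \in S -> lab e \subset C1 (sct (nd e)) \/
       exists2 w : V, w \in Wg (sct (nd e)) :|: Wl (nd e) & lab e \subset nb (sct (nd e)) w) ->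
  \sum_(e in S) om (nd e) * dot (U e) (Delta e) ^+ 2 <=
   \sum_n b n * (#|C1 n| + G * #|Wg n|)%:R + \sum_t om t * b (sct t) * (G * #|Wl t|)%:R.
Proof.
move=> om01 b0 nbG span len cover.
have energy := span_energy orthonormal.
have /fin_all_exists[s1 s1P] n := energy _ (C1 n) (g n).
have /fin_all_exists[s2 s2P] n := energy _ (\bigcup_(w in Wg n) nb n w) (g n).
have /fin_all_exists[s3 s3P] t := energy _ (\bigcup_(w in Wl t) nb (sct t) w) (g (sct t)).
have s10 n e : 0 <= s1 n e by have [] := s1P n.
have s20 n e : 0 <= s2 n e by have [] := s2P n.
have s30 t e : 0 <= s3 t e by have [] := s3P t.
have om0 t : 0 <= om t by case/andP: (om01 t).
have widen (D1 D2 : {set J}) n (a : J -> F) i : D1 \subset D2 ->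
    \sum_(c in D1) a c * g n c i = \sum_(c in D2) (if c \in D1 then a c else 0) * g n c i.
  move=> sub; rewrite [RHS](big_setID D1) /= (setIidPr sub) [X in _ = _ + X]big1 ?addr0.
    by apply: eq_bigr => c ->.
  by move=> c /setDP[_ /negPf ->]; rewrite mul0r.
have bound e : e \in S -> om (nd e) * dot (U e) (Delta e) ^+ 2 <=
    b (sct (nd e)) * (s1 (sct (nd e)) e + s2 (sct (nd e)) e) + om (nd e) * b (sct (nd e)) * s3 (nd e) e.
  move=> eS; have [a ae] := span e eS; have dl := len e eS.
  set n := sct (nd e) in ae dl *.
  have d0 := dot_ge0 (Delta e); have /andP[o0 o1] := om01 (nd e).
  have use (D : {set J}) (s : F) : lab e \subset D -> 0 <= s ->
      (forall (a : J -> F) v, (forall i, v i = \sum_(c in D) a c * g n c i) ->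
         dot (U e) v ^+ 2 <= s * dot v v) -> dot (U e) (Delta e) ^+ 2 <= b n * s.
    move=> sub s0 H; apply: le_trans (H (fun c => if c \in lab e then a c else 0) (Delta e) _) _.
      by move=> i; rewrite ae; exact: widen.
    by rewrite mulrC ler_wpM2r.
  have pos1 : 0 <= b n * s1 n e by rewrite mulr_ge0.
  have pos2 : 0 <= b n * s2 n e by rewrite mulr_ge0.
  have pos3 : 0 <= om (nd e) * b n * s3 (nd e) e by rewrite !mulr_ge0.
  have le1 y : dot (U e) (Delta e) ^+ 2 <= y -> om (nd e) * dot (U e) (Delta e) ^+ 2 <= y.
    by move=> hy; apply: le_trans hy; rewrite ler_piMl ?sqr_ge0.
  case: (cover e eS) => [sub|[w wW sub]].
    have [_ _ H] := s1P n; have := le1 _ (use _ _ sub (s10 n e) (H e)).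
    by rewrite mulrDr; move: pos1 pos2 pos3; lra.
  move: wW; rewrite in_setU => /orP[] wW.
    have sub' := subset_trans sub (bigcup_sup w wW).
    have [_ _ H] := s2P n; have := le1 _ (use _ _ sub' (s20 n e) (H e)).
    by rewrite mulrDr; move: pos1 pos2 pos3; lra.
  have sub' := subset_trans sub (bigcup_sup w wW).
  have [_ _ H] := s3P (nd e); have := use _ _ sub' (s30 (nd e) e) (H e).
  move=> hy; rewrite mulrDr; apply: le_trans (_ : om (nd e) * b n * s3 (nd e) e <= _).
    by rewrite -mulrA ler_wpM2l.
  by move: pos1 pos2; lra.
apply: le_trans (ler_sum _ bound) _; rewrite big_split /=; apply: lerD.
  apply: le_trans (sum_fibre_le (f := fun n e => b n * (s1 n e + s2 n e)) S (fun e => sct (nd e)) _) _.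
    by move=> n e; rewrite mulr_ge0 ?addr_ge0.
  apply: ler_sum => n _; rewrite -mulr_sumr ler_wpM2l // big_split natrD /=; apply: lerD.
    by have [] := s1P n.
  have [_ h2 _] := s2P n; apply: (le_trans h2); rewrite ler_nat; exact: card_bigcup_leqM.
apply: le_trans (sum_fibre_le (f := fun t e => om t * b (sct t) * s3 t e) S nd _) _.
  by move=> t e; rewrite !mulr_ge0.
apply: ler_sum => t _; rewrite -mulr_sumr ler_wpM2l ?mulr_ge0 //.
have [_ h2 _] := s3P t; apply: (le_trans h2); rewrite ler_nat; exact: card_bigcup_leqM.
Qed.

End Energy.

End Energy.
Import Energy.

(** * Clusters of a hierarchy *)

Module Ancestry.
Local Open Scope nat_scope.

Section Hierarchy.
Variables (V N : finType) (root : N) (par : N -> N) (leaf : V -> N).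
Hypothesis hier : is_hierarchy root par leaf.
Notation Vt := (Vt par leaf).

Definition children t : {set N} := [set c | is_child root par c t].

Let par_root : par root = root. Proof. by case: hier. Qed.
Let to_root t : exists n, iter n par t == root.
Proof. by have [_ [_ [/(_ t)[n h] _]]] := hier; exists n; rewrite h. Qed.

Definition depth t := ex_minn (to_root t).

Lemma depth_par t : depth (par t) = (depth t).-1.
Proof.
rewrite /depth; case: ex_minnP => m /eqP hm mm; case: ex_minnP => n /eqP hn mn.
have h1 : n <= m.+1 by apply: mn; rewrite iterSr hm.
case: n hn mn h1 => [|n] hn mn h1; last first.
  have h2 : m <= n by apply: mm; rewrite -iterSr hn.
  by move: h1 h2; clear; lia.
have : m <= 0 by apply: mm; rewrite /= in hn; rewrite /= hn par_root.
by rewrite leqn0 => /eqP.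
Qed.

Lemma depth_gt0 t : t != root -> 0 < depth t.
Proof. by rewrite /depth; case: ex_minnP => -[|//] /eqP /= -> _; rewrite eqxx. Qed.

Lemma depth_iter n t : depth (iter n par t) = depth t - n.
Proof. by elim: n => [|n IH]; rewrite ?subn0 // iterS depth_par IH subnS. Qed.

Definition height t := \max_s depth s - depth t.

Lemma height_child t s : s \in children t -> height s < height t.
Proof.
rewrite inE /is_child /height => /andP[/depth_gt0 s0 /eqP e].
have : depth s <= \max_s depth s by exact: leq_bigmax.
by have := depth_par s; rewrite e; move: s0; clear; lia.
Qed.

Lemma mem_Vt v t : (v \in Vt t) = fconnect par (leaf v) t.
Proof. by rewrite inE. Qed.

Lemma fconnectE a t : fconnect par a t -> exists n, t = iter n par a.
Proof. by move/iter_findex => <-; eexists. Qed.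

Lemma Vt_sub t t' : fconnect par t t' -> Vt t \subset Vt t'.
Proof. by move=> c; apply/subsetP => v; rewrite !mem_Vt => h; exact: connect_trans h c. Qed.

Lemma Vt_par t : Vt t \subset Vt (par t).
Proof. exact/Vt_sub/fconnect1. Qed.

Lemma Vt_root : Vt root = setT.
Proof.
apply/setP => v; rewrite mem_Vt inE; have [n /eqP <-] := to_root (leaf v).
exact: fconnect_iter.
Qed.

Lemma ancestors_comparable v t t' : v \in Vt t -> v \in Vt t' ->
  fconnect par t t' \/ fconnect par t' t.
Proof.
rewrite !mem_Vt => /fconnectE[n ->] /fconnectE[m ->].
case: (leqP n m) => h; [left | right].
  by rewrite -(subnK h) iterD; exact: fconnect_iter.
by rewrite -(subnK (ltnW h)) iterD; exact: fconnect_iter.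
Qed.

(** [s] is the child through which the path from [a] arrives. Taking the first arrival at [t]
    ensures that [s] is not the root, which [par] fixes. *)
Lemma last_step a t : fconnect par a t -> a != t ->
  exists s, [/\ s \in children t, fconnect par a s & fconnect par (par a) t].
Proof.
move=> /fconnectE[n0 e0] ne.
have ex : exists n, iter n par a == t by exists n0; rewrite e0.
case: (ex_minnP ex) => -[|n] /eqP hn mn; first by rewrite -hn eqxx in ne.
exists (iter n par a); split; last by rewrite -hn iterSr fconnect_iter.
  rewrite inE /is_child -iterS hn eqxx andbT; apply/eqP => h.
  have : n.+1 <= n by apply: mn; rewrite h -hn iterS h par_root.
  by rewrite ltnn.
exact: fconnect_iter.
Qed.

Lemma ancestor_cases v t t' : v \in Vt t -> v \in Vt t' ->
  [\/ t = t', exists2 s, s \in children t' & Vt t \subset Vt s |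
     exists2 s, s \in children t & Vt t' \subset Vt s].
Proof.
move=> vt vt'; have [->|ne] := eqVneq t t'; first by constructor 1.
case: (ancestors_comparable vt vt') => c.
  by have [s [h1 h2 _]] := last_step c ne; constructor 2; exists s; last exact: Vt_sub.
have ne' : t' != t by rewrite eq_sym.
by have [s [h1 h2 _]] := last_step c ne'; constructor 3; exists s; last exact: Vt_sub.
Qed.

Lemma ancestor_par v t t' : v \in Vt t -> v \in Vt t' -> t != t' ->
  Vt (par t) \subset Vt t' \/ Vt (par t') \subset Vt t.
Proof.
move=> vt vt' ne; case: (ancestors_comparable vt vt') => c; [left | right].
  by have [s [_ _ h]] := last_step c ne; exact: Vt_sub.
by rewrite eq_sym in ne; have [s [_ _ h]] := last_step c ne; exact: Vt_sub.
Qed.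

Lemma laminar_Vt t t' v : v \in Vt t -> v \in Vt t' -> Vt t \subset Vt t' \/ Vt t' \subset Vt t.
Proof. by move=> vt vt'; case: (ancestors_comparable vt vt') => /Vt_sub; auto. Qed.

Lemma leafE t : is_leaf root par t = (children t == set0).
Proof.
apply/forallP/eqP => [h|h c].
  by apply/setP => c; rewrite !inE; apply/negbTE.
by have := in_set0 c; rewrite -h inE => ->.
Qed.

Lemma leaf_children v : children (leaf v) = set0.
Proof.
have [_ [_ [_ [_ [_ h]]]]] := hier.
by apply/eqP; rewrite -leafE; apply/h; exists v.
Qed.

Lemma leaf_Vt t : children t = set0 -> #|Vt t| <= 1.
Proof.
move=> ch0; apply/card_le1_eqP => u v.
have eq w : w \in Vt t -> leaf w = t.
  rewrite mem_Vt => c; apply/eqP; apply: contraT => ne.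
  by have [s [h _ _]] := last_step c ne; rewrite ch0 inE in h.
have [_ [_ [_ [_ [inj _]]]]] := hier.
by move=> /eq eu /eq ev; apply: inj; rewrite eu ev.
Qed.

Lemma child_mem t v : children t != set0 -> v \in Vt t -> exists2 s, s \in children t & v \in Vt s.
Proof.
move=> chn vt; have ne : leaf v != t by apply: contraNneq chn => <-; rewrite leaf_children.
have := vt; rewrite mem_Vt => c; have [s [h1 h2 _]] := last_step c ne.
by exists s; rewrite ?mem_Vt.
Qed.

Lemma child_sub t s : s \in children t -> Vt s \subset Vt t.
Proof. by rewrite inE => /andP[_ /eqP <-]; exact: Vt_par. Qed.

Lemma child_uniq t s s' v : s \in children t -> s' \in children t ->
  v \in Vt s -> v \in Vt s' -> s = s'.
Proof.
move=> sC s'C vs1 vs2; move: sC s'C; rewrite !inE => /andP[sr /eqP es] /andP[s'r /eqP es'].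
have dE : depth s = depth s'.
  have := depth_par s; have := depth_par s'; rewrite es es'.
  by have := depth_gt0 sr; have := depth_gt0 s'r; clear; lia.
have sym a b : a != root -> depth a = depth b -> fconnect par a b -> a = b.
  move=> ar e /fconnectE[n bn]; subst b; move: e; rewrite depth_iter.
  by have := depth_gt0 ar; case: n => [//|n]; clear; lia.
case: (ancestors_comparable vs1 vs2) => c; first exact: sym.
by apply/esym/sym.
Qed.

(** Double counting: the child relation has one pair per non-root node, and subtracting 1 at every
    inner node leaves the number of leaves minus 1. *)
Lemma sum_children : \sum_t #|children t|.-1 <= #|V|.-1.
Proof.
have h1 : \sum_t #|children t| = #|N|.-1.
  have -> : \sum_t #|children t| = \sum_t \sum_c is_child root par c t.
    apply: eq_bigr => t _; rewrite -sum1_card big_mkcond; apply: eq_bigr => c _.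
    by rewrite inE; case: is_child.
  rewrite exchange_big /=.
  have -> : \sum_c \sum_t is_child root par c t = \sum_(c : N) (c != root).
    apply: eq_bigr => c _; rewrite /is_child (bigD1 (par c)) //= eqxx andbT big1 ?addn0 //.
    by move=> t ne; rewrite (eq_sym (par c)) (negPf ne) andbF.
  rewrite (bigD1 root) //= eqxx add0n -(cardC1 root) -sum1_card.
  by apply: eq_big => // c ->.
have [_ [_ [_ [ch2 [inj lf]]]]] := hier.
have lv : #|[set t | children t == set0]| = #|V|.
  have -> : #|V| = #|leaf @: [set: V]| by rewrite card_imset // cardsT.
  apply: eq_card => t; rewrite inE -leafE.
  apply/idP/imsetP => [/lf[v <-]|[v _ ->]]; first by exists v.
  by apply/lf; exists v.
have h2 : \sum_t #|children t| = \sum_t #|children t|.-1 + #|[set t | children t != set0]|.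
  have -> : #|[set t | children t != set0]| = \sum_t (children t != set0).
    by rewrite -sum1_card big_mkcond; apply: eq_bigr => t _; rewrite inE; case: (_ == _).
  rewrite -big_split /=; apply: eq_bigr => t _; rewrite -card_gt0.
  by case: (#|children t|) => // n; rewrite addn1.
have h3 := cardsC [set t | children t == set0].
have e4 : #|~: [set t | children t == set0]| = #|[set t | children t != set0]|.
  by apply: eq_card => t; rewrite !inE.
have n0 : 0 < #|N| by apply/card_gt0P; exists root.
move: h1 h2 h3 n0; rewrite e4 lv; move: #|V| #|N| (#|_|) (\sum_t _) (\sum_t _); clear; lia.
Qed.

End Hierarchy.

End Ancestry.
Import Ancestry.

(** * Nets and chaining *)

Module Chain.
Import Order.TTheory GRing.Theory Num.Theory.
Local Open Scope nat_scope.

Section Chain.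
Variables (V I : finType) (x : V -> I -> bool) (M J rho Q : nat) (EP : 'I_M -> {set V}).
Notation d := (dist x).
Notation r i n := (32 * (2 ^ i * rho * Q ^ n)).

Lemma nets : exists (Nn : nat -> 'I_M -> {set V}) (pr : nat -> 'I_M -> V -> V),
  [/\ forall i n, Nn i n \subset EP n,
    forall i n, i <= J -> {in Nn i n &, forall c c', c != c' -> r i n <= d c c'} &
    forall i n v, i <= J -> v \in EP n -> pr i n v \in Nn i n /\ d v (pr i n v) <= r i n].
Proof.
have /fin_all_exists2[N0 N0E N0P] : forall s : 'I_J.+1 * 'I_M, exists2 Z : {set V}, Z \subset EP s.2 &
   {in Z &, forall c c', c != c' -> r s.1 s.2 <= d c c'} /\
   {in EP s.2, forall v, exists2 c, c \in Z & d v c <= r s.1 s.2}.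
  case=> i n; have [|Z ZE [h1 h2]] := @greedy_selection V (EP n) (fun=> 0)
      (fun c c' => r i n <= d c c'); first by move=> c c' _; rewrite distC.
  exists Z => //; split=> [c c' cZ c'Z ne|v vE]; first exact: h1.
  case: (h2 v vE) => [vZ|[z zZ [_ hz]]]; first by exists v; rewrite ?distxx.
  by exists z => //; rewrite ltnW // ltnNge.
exists (fun i n => N0 (inord i, n)).
exists (fun i n v => odflt v [pick c in N0 (inord i, n) | d v c <= r i n]).
have iE i : i <= J -> nat_of_ord (@inord J i) = i by move=> iJ; rewrite inordK.
split=> [i n|i n iJ|i n v iJ vE]; first exact: N0E.
  by have [] := N0P (inord i, n); rewrite /= iE.
have [_ /(_ v vE)[c cN dc]] := N0P (inord i, n); rewrite /= iE // in dc.
by case: pickP => [c' /andP[]|/(_ c)] //; rewrite cN dc.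
Qed.

Variables (Nn : nat -> 'I_M -> {set V}) (pr : nat -> 'I_M -> V -> V).
Hypothesis NE : forall i n, Nn i n \subset EP n.
Hypothesis prP : forall i n v, i <= J -> v \in EP n -> pr i n v \in Nn i n /\ d v (pr i n v) <= r i n.

(** Each net point is projected from the previous one and not from [v], so that a piece of the chain
    is determined by its first label alone and each label contributes one dimension. *)
Fixpoint chain (n : 'I_M) (i : nat) (v : V) : V :=
  if i is i'.+1 then pr i n (chain n i' v) else pr 0 n v.

Lemma chain_net n i v : i <= J -> v \in EP n -> chain n i v \in Nn i n.
Proof.
move=> + vE; elim: i => [|i IH] iJ; first by have [] := prP iJ vE.
by have [] := prP iJ (subsetP (NE i n) _ (IH (ltnW iJ))).
Qed.

Lemma chain_step n i v : i < J -> v \in EP n -> d (chain n i v) (chain n i.+1 v) <= r i.+1 n.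
Proof.
by move=> iJ vE; have [] := prP iJ (subsetP (NE i n) _ (chain_net (ltnW iJ) vE)).
Qed.

(** The radii double from level to level, so all steps sum to at most twice the last. *)
Lemma chain_near n i v : i <= J -> v \in EP n -> d v (chain n i v) <= 2 * r i n.
Proof.
move=> + vE; elim: i => [|i IH] iJ.
  by have [_ h] := prP iJ vE; apply: (leq_trans h); rewrite leq_pmull.
have h1 := IH (ltnW iJ); have h2 := chain_step iJ vE.
have h3 := dist_tri x (chain n i v) v (chain n i.+1 v).
have e : r i.+1 n = 2 * r i n by rewrite expnS; move: (2 ^ i) (Q ^ n) => a b; clear; lia.
move: h1 h2 h3; rewrite e; move: (r i n) => a; clear; lia.
Qed.

End Chain.

Local Open Scope ring_scope.

Section Vectors.
Variables (F : realFieldType) (V : finType) (h : nat) (x : V -> 'I_h -> bool).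

Definition vec v : 'I_h -> F := fun i => (x v i)%:R.
Definition vdiff u v : 'I_h -> F := fun i => vec u i - vec v i.

Lemma dot_vdiff u v : dot (vdiff u v) (vdiff u v) = (dist x u v)%:R.
Proof.
rewrite /dot /dist -sum1_card natr_sum [RHS]big_mkcond; apply: eq_bigr => i _.
by rewrite inE /vdiff /vec; case: (x u i); case: (x v i); rewrite /= ?subrr ?subr0 ?sub0r ?mulr0 ?mulrNN ?mulr1.
Qed.

Lemma dot_vdiff_sum (u : 'I_h -> F) a (s : nat -> V) n b :
  dot u (vdiff a b) = dot u (vdiff a (s 0%N)) + \sum_(i < n) dot u (vdiff (s i) (s i.+1)) + dot u (vdiff (s n) b).
Proof.
have dD c1 c2 c3 : dot u (vdiff c1 c3) = dot u (vdiff c1 c2) + dot u (vdiff c2 c3).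
  by rewrite /dot -big_split; apply: eq_bigr => i _; rewrite /vdiff /=; ring.
elim: n => [|n IH]; first by rewrite big_ord0 addr0 -dD.
by rewrite IH big_ord_recr /= (dD (s n) (s n.+1) b) !addrA.
Qed.

Lemma sqr_sum_le (n : nat) (a : 'I_n -> F) : (\sum_i a i) ^+ 2 <= n%:R * \sum_i a i ^+ 2.
Proof.
have := @cauchy_schwarz F _ (index_enum 'I_n) (fun=> 1) (fun=> 1) a (fun _ _ => ler01).
under eq_bigr => i _ do rewrite !mul1r.
under [X in _ <= X * _]eq_bigr => i _ do rewrite expr1n mulr1.
under [X in _ <= _ * X]eq_bigr => i _ do rewrite mul1r.
by rewrite sumr_const card_ord.
Qed.

End Vectors.

End Chain.
Import Chain.

(** * The energy of one class of edges *)

Module ClassEnergy.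
Import Order.TTheory GRing.Theory Num.Theory.
Local Open Scope ring_scope.

Lemma energy_combine (F : realFieldType) (J c1 c2 : nat) (y : F) : 0 <= y ->
  5%:R * (2%:R * y + J%:R * (J%:R * (c1%:R * y)) + c2%:R * y + 2%:R * y + J%:R * (J%:R * (c1%:R * y)))
   <= (5 * (4 + c2 + 2 * c1) * J.+1 ^ 2)%:R * y.
Proof.
move=> y0; rewrite (_ : 5%:R * _ = (5 * (4 + c2 + 2 * c1 * J ^ 2))%:R * y); last first.
  by rewrite !natrM !natrD !natrM; ring.
rewrite ler_wpM2r // ler_nat -(mulnA 5) leq_mul2l; apply/orP; right.
have : (J ^ 2 <= J.+1 ^ 2)%N by rewrite leq_exp2r.
have : (0 < J.+1 ^ 2)%N by rewrite expn_gt0.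
move: (J ^ 2)%N (J.+1 ^ 2)%N => a b; clear; nia.
Qed.

(** Both constants have the form [6 * be + 50 * ga] of [piece_total]: [be] prices the exceptional
    labels, [ga] the labels around one anchor. *)
Definition inc_const (C5 : nat) := (6 * 832 + 50 * (84 * C5))%N.
Definition top_const (C5 : nat) := (6 * (160 * 13 * (1 + 42 * C5)) + 50 * (210 * C5))%N.
Definition class_const (C5 : nat) := (5 * (4 + top_const C5 + 2 * inc_const C5))%N.

Section ClassBound.
Variables (F : realFieldType) (V E N : finType) (p q : E -> V).
Variables (root : N) (par : N -> N) (leaf : V -> N) (T : {set N}).
Hypothesis hier : is_hierarchy root par leaf.
Notation Vt := (Vt par leaf).
Variables (h : nat) (U : E -> 'I_h -> F) (x : V -> 'I_h -> bool).
Hypothesis orthonormal : forall e e', dot (U e) (U e') = (e == e')%:R.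
Variables (I2 : finType) (x2 : V -> I2 -> bool) (S : nat).
Hypothesis S0 : (0 < S)%N.
Hypothesis x2E : forall u v, dist x2 u v = (S * dist x u v)%N.
Variables (k K J M rho Q C5 : nat).
Hypothesis k0 : (0 < k)%N.
Hypothesis K0 : (0 < K)%N.
Hypothesis kJ : (k <= 2 ^ J)%N.
Hypothesis rho0 : (0 < rho)%N.
Hypothesis C5E : (2 * 4099 <= C5)%N.
Hypothesis Q1024 : (1024 <= Q)%N.
Hypothesis QK : (2 * (K + 2) <= Q)%N.
Hypothesis QC : (160 * (C5 * 2 ^ J) <= Q)%N.
Hypothesis kconn : forall t, k_edge_connected_on p q k (Vt t).
Hypothesis Vpos : (0 < #|V|)%N.

Let L0 := (32 * (2 ^ J * rho))%N.
Notation L n := (L0 * Q ^ n)%N.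
Notation crossV := (crossV p q Vt).
Notation in2 := (in2 p q).
Notation len2 e := (dist x2 (p e) (q e)).
Notation len e := (dist x (p e) (q e)).

Definition Oe t : {set E} := [set f | in2 (Vt (par t)) f && crossV t f].
Hypothesis HK : forall t, t \in T -> (#|[set g | crossV t g]| * k <= #|Oe t| * K)%N.

Variables (CE : {set E}) (nd : E -> N) (sct : N -> 'I_M).
Hypothesis CEp : forall e, e \in CE -> p e \in Vt (nd e).
Hypothesis CEq : forall e, e \in CE -> q e \in Vt (par (nd e)) :\: Vt (nd e).
Hypothesis CET : forall e, e \in CE -> nd e \in T.
Hypothesis CElen : forall e, e \in CE -> (len2 e <= L (sct (nd e)))%N.
Hypothesis CElen2 : forall e, e \in CE -> (L (sct (nd e)) <= 2 * len2 e)%N.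

Let m t := #|Oe t|.
Definition cnt t := #|[set e in CE | nd e == t]|.
(** The weight left by Cauchy-Schwarz within a node: a squared sum over [cnt t] edges divided by
    [m t] is at most [omega t] times the sum of squares. *)
Definition omega t : F := (cnt t)%:R / (m t)%:R.
Let psi t : F := omega t * (L (sct t))%:R.
Let D2 := (\sum_e len2 e)%N.

Lemma CE_Oe e : e \in CE -> e \in Oe (nd e).
Proof.
move=> eC; have pV := CEp eC; have /setDP[qP qV] := CEq eC.
by rewrite inE /Multigraph.in2 qP (subsetP (Vt_par _ _ _) _ pV) /Anchor.crossV pV (negPf qV).
Qed.

Lemma cnt_le t : (cnt t <= m t)%N.
Proof.
by apply: subset_leq_card; apply/subsetP => e; rewrite inE => /andP[eC /eqP <-]; exact: CE_Oe.
Qed.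

Lemma omega01 t : 0 <= omega t <= 1.
Proof.
rewrite divr_ge0 ?ler0n //=; have [m0|mn] := eqVneq (m t) 0%N.
  by rewrite /omega m0 invr0 mulr0 ler01.
by rewrite ler_pdivrMr ?ltr0n ?lt0n // mul1r ler_nat cnt_le.
Qed.

Lemma omega_m t : omega t * (m t)%:R <= (cnt t)%:R.
Proof.
have [m0|mn] := eqVneq (m t) 0%N; first by rewrite m0 mulr0 ler0n.
by rewrite divfK // pnatr_eq0.
Qed.

Lemma sum_cnt_L : (\sum_t cnt t * L (sct t) <= 2 * D2)%N.
Proof.
have -> : (\sum_t cnt t * L (sct t) = \sum_(e in CE) L (sct (nd e)))%N.
  rewrite (eq_bigr (fun t => \sum_(e in CE | nd e == t) L (sct (nd e)))%N).
    rewrite (partition_big nd predT) //=.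
  move=> t _; rewrite /cnt -sum_nat_const big_set /=; apply: eq_bigr => e.
  by case/andP=> _ /eqP ->.
apply: (@leq_trans (\sum_(e in CE) 2 * len2 e)%N); first by apply: leq_sum => e; exact: CElen2.
rewrite -big_distrr leq_mul2l /=; rewrite /D2 [X in (_ <= X)%N](bigID (mem CE)) /=.
exact: leq_addr.
Qed.

Lemma psi_ge0 t : 0 <= psi t.
Proof. by have /andP[h1 _] := omega01 t; rewrite mulr_ge0 ?ler0n. Qed.

(* The cost of [f] is its length plus [psi t] for every [t] whose [Oe t] contains
   [f], so that one cheap tree bounds both the length and the weighted degrees. *)
Lemma good_tree : exists TT : {set E}, [/\ #|V| = #|TT|.+1,
  forall t, {in Vt t &, forall u v, conn p q (fun f => (f \in TT) && in2 (Vt t) f) u v},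
  k%:R * (\sum_(f in TT) len2 f)%:R <= 6%:R * D2%:R :> F &
  k%:R * \sum_t psi t * (treedeg p q TT Vt par t)%:R <= 6%:R * D2%:R].
Proof.
pose c f : F := (len2 f)%:R + \sum_(t | f \in Oe t) psi t.
have c0 f : 0 <= c f by rewrite addr_ge0 ?ler0n // sumr_ge0 // => t _; exact: psi_ge0.
have kcut t (W : {set V}) : W \subset Vt t -> W != set0 -> W != Vt t ->
    (k <= #|[set e | in2 (Vt t) e && crossing p q W e]|)%N.
  move=> WV W0 WnV; apply: (leq_trans (kconn WV W0 WnV)); apply: subset_leq_card.
  apply/subsetP => e; rewrite in_set [_ \in [set e | _]]in_set /crossing /Multigraph.in2.
  case/orP=> /andP[]; first move=> h1 /setDP[h3 h2]; last move=> /setDP[h3 h2] h1.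
    by rewrite (subsetP WV _ h1) h3 h1 (negPf h2).
  by rewrite (subsetP WV _ h1) h3 h1 (negPf h2).
have [TT [cardT connT costT]] := @laminar_tree F V E N p q Vt (children root par) (height hier) k c
  k0 c0 Vpos (fun t s => @height_child _ _ _ _ _ hier t s) (fun t => @leaf_Vt _ _ _ _ _ hier t)
  (fun t v => @child_mem _ _ _ _ _ hier t v) (@child_sub _ _ root par leaf)
  (fun t s s' v => @child_uniq _ _ _ _ _ hier t s s' v) (sum_children hier)
  (fun t t' v => @ancestor_cases _ _ _ _ _ hier v t t') (ex_intro _ root (Vt_root hier)) kcut.
exists TT.
have swap (A : {set E}) : \sum_(f in A) \sum_(t | f \in Oe t) psi t = \sum_t psi t * #|[set f in A | f \in Oe t]|%:R.
  rewrite (exchange_big_dep predT) //=; apply: eq_bigr => t _.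
  rewrite -sum1_card natr_sum mulr_sumr; apply: eq_big => f; first by rewrite inE.
  by rewrite mulr1.
(* The lengths contribute [D2] and the weights [psi] at most twice that; the factor 2 of
   [laminar_tree] turns 3 into 6. *)
have tot : \sum_f c f <= 3%:R * D2%:R.
  rewrite big_split /= -natr_sum -/D2.
  have -> : \sum_f \sum_(t | f \in Oe t) psi t = \sum_t psi t * (m t)%:R.
    rewrite (eq_bigl (fun f => f \in [set: E])); last by move=> f; rewrite inE.
    rewrite swap; apply: eq_bigr => t _; congr (_ * _%:R).
    by apply: eq_card => f; rewrite !inE.
  have : \sum_t psi t * (m t)%:R <= 2%:R * D2%:R.
    apply: le_trans (_ : (\sum_t cnt t * L (sct t))%:R <= _); last by rewrite -natrM ler_nat sum_cnt_L.
    rewrite natr_sum; apply: ler_sum => t _; rewrite /psi mulrAC [X in _ <= X]natrM ler_wpM2r ?ler0n //.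
    exact: omega_m.
  move: (\sum_t _) => s; lra.
have costc : k%:R * \sum_(f in TT) c f <= 6%:R * D2%:R.
  by move: costT tot; move: (\sum_(e in TT) _) (\sum_f _) => a b; lra.
have split_c : \sum_(f in TT) c f = (\sum_(f in TT) len2 f)%:R + \sum_t psi t * (treedeg p q TT Vt par t)%:R.
  rewrite big_split /= -natr_sum swap; congr (_ + _); apply: eq_bigr => t _; congr (_ * _%:R).
  by apply: eq_card => f; rewrite !inE.
have deg0 : 0 <= \sum_t psi t * (treedeg p q TT Vt par t)%:R.
  by apply: sumr_ge0 => t _; rewrite mulr_ge0 ?psi_ge0 ?ler0n.
rewrite split_c mulrDr in costc.
split=> //; apply: le_trans costc; first by rewrite lerDl mulr_ge0 ?ler0n.
by rewrite lerDr mulr_ge0 ?ler0n.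
Qed.

Let D := (\sum_e len e)%N.

Lemma D2E : D2 = (S * D)%N.
Proof. by rewrite /D2 /D big_distrr; apply: eq_bigr => e _; exact: x2E. Qed.

Let kF : 0 < k%:R :> F. Proof. by rewrite ltr0n. Qed.
Let SF : 0 < S%:R :> F. Proof. by rewrite ltr0n. Qed.
Let dk : F := D%:R / k%:R.

Section WithTree.
Variables (TT : {set E}) (Wg : nat -> {set V}) (Wl : N -> {set V}) (Fn : N -> nat).
Let Len2 := (\sum_(f in TT) len2 f)%N.
Hypothesis treeLen : k%:R * Len2%:R <= 6%:R * D2%:R :> F.
Hypothesis treeDeg : k%:R * \sum_t psi t * (treedeg p q TT Vt par t)%:R <= 6%:R * D2%:R.
Hypothesis WgLen : (\sum_(n < M) L n * #|Wg n| <= 6 * Len2)%N.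
Hypothesis WlE : forall t, (#|Wl t| <= Fn t + 2 * treedeg p q TT Vt par t)%N.
Hypothesis FnE : forall t, (Fn t * K <= #|[set g | crossV t g]|)%N.
Hypothesis connT : forall u v, conn p q (mem TT) u v.
Hypothesis anchored : forall e, e \in CE ->
  exists2 w, w \in Wg (sct (nd e)) :|: Wl (nd e) & (dist x2 (p e) w <= 4096 * L (sct (nd e)))%N.

Lemma div_k (a : F) b : k%:R * a <= b * (S * D)%:R -> a / S%:R <= b * dk.
Proof.
move=> h1; rewrite ler_pdivrMr // -(ler_pM2l kF); apply: (le_trans h1).
rewrite natrM /dk le_eqVlt; apply/orP; left; apply/eqP.
have kn : k%:R != 0 :> F by rewrite pnatr_eq0 -lt0n.
by field.
Qed.

(** The LCH ratio is used here: [Fn t * K] is at most the size of the cut, so [HK] gives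
    [Fn t * k <= m t], and the denominator of [omega] cancels. *)
Lemma psi_Fn t : k%:R * (psi t * (Fn t)%:R) <= (cnt t * L (sct t))%:R.
Proof.
have [tT|tT] := boolP (t \in T); last first.
  have -> : psi t = 0.
    rewrite /psi /omega (_ : cnt t = 0%N) ?mul0r //; apply/eqP; rewrite cards_eq0.
    apply/eqP/setP => e; rewrite !inE; apply/andP => -[/CET eT /eqP et].
    by move: tT; rewrite -et eT.
  by rewrite mul0r mulr0 ler0n.
have Fm : (Fn t * k <= m t)%N.
  rewrite -(leq_pmul2r K0); apply: leq_trans (HK tT).
  by rewrite mulnAC leq_mul2r FnE orbT.
have : omega t * (Fn t * k)%:R <= (cnt t)%:R.
  apply: le_trans (omega_m t); rewrite ler_wpM2l ?ler_nat //.
  by have /andP[] := omega01 t.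
move=> h1; have := ler_wpM2r (ler0n F (L (sct t))) h1; rewrite -natrM; apply: le_trans.
by rewrite /psi natrM le_eqVlt; apply/orP; left; apply/eqP; ring.
Qed.

Lemma sum_psi_Wl : k%:R * \sum_t psi t * (#|Wl t|)%:R <= 14%:R * D2%:R.
Proof.
apply: (@le_trans _ _ (k%:R * \sum_t psi t * (Fn t)%:R + 2%:R * (k%:R * \sum_t psi t * (treedeg p q TT Vt par t)%:R))).
  rewrite [2%:R * _]mulrCA -mulrDr ler_wpM2l ?ler0n // mulr_sumr -big_split /=.
  apply: ler_sum => t _; rewrite mulrCA -mulrDr ler_wpM2l ?psi_ge0 //.
  by rewrite -natrM -natrD ler_nat WlE.
have h1 : k%:R * \sum_t psi t * (Fn t)%:R <= 2%:R * D2%:R.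
  rewrite mulr_sumr; apply: le_trans (ler_sum _ (fun t _ => psi_Fn t)) _.
  by rewrite -natr_sum -natrM ler_nat sum_cnt_L.
by move: treeDeg h1; move: (k%:R * _) (k%:R * _) => a b; lra.
Qed.

(** The 50 is 6 * 6 for the anchors in [Wg], paid by tree length, plus 14 for those in [Wl]; the 14
    is 2 for anchors counted by the cut plus 2 * 6 for ends of crossing tree edges. *)
Lemma piece_total (bn C1c : 'I_M -> nat) (G be ga : nat) :
    (forall n, bn n * G <= ga * L n)%N -> (\sum_n bn n * C1c n <= be * Len2)%N ->
  \sum_n (bn n)%:R / S%:R * (C1c n + G * #|Wg n|)%:R +
   \sum_t omega t * ((bn (sct t))%:R / S%:R) * (G * #|Wl t|)%:R <= (6 * be + 50 * ga)%:R * dk.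
Proof.
move=> hG hb.
have e1 : \sum_n (bn n)%:R / S%:R * (C1c n + G * #|Wg n|)%:R <= (be + 6 * ga)%:R * Len2%:R / S%:R :> F.
  rewrite (_ : \sum_n _ = (\sum_n bn n * C1c n + \sum_n bn n * G * #|Wg n|)%:R / S%:R); last first.
    rewrite -big_split natr_sum mulr_suml; apply: eq_bigr => n _.
    by rewrite mulrAC -natrM mulnDr mulnA.
  rewrite ler_wpM2r ?invr_ge0 ?ler0n // -natrM ler_nat mulnDl; apply: leq_add => //.
  apply: (@leq_trans (ga * \sum_(n < M) L n * #|Wg n|)%N).
    rewrite big_distrr /=; apply: leq_sum => n _; rewrite mulnA leq_mul2r hG orbT //.
  by rewrite (mulnC 6) -mulnA leq_mul2l WgLen orbT.
have e2 : \sum_t omega t * ((bn (sct t))%:R / S%:R) * (G * #|Wl t|)%:R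
    <= ga%:R * (\sum_t psi t * #|Wl t|%:R) / S%:R.
  rewrite mulr_sumr mulr_suml; apply: ler_sum => t _.
  have -> : omega t * ((bn (sct t))%:R / S%:R) * (G * #|Wl t|)%:R =
     omega t * #|Wl t|%:R / S%:R * (bn (sct t) * G)%:R by rewrite !natrM; ring.
  have -> : ga%:R * (psi t * #|Wl t|%:R) / S%:R =
     omega t * #|Wl t|%:R / S%:R * (ga * L (sct t))%:R by rewrite /psi !natrM; ring.
  rewrite ler_wpM2l ?ler_nat // !mulr_ge0 ?invr_ge0 ?ler0n //.
apply: le_trans (lerD e1 e2) _; rewrite -mulrDl; apply: div_k; rewrite -D2E.
have h1 : k%:R * ((be + 6 * ga)%:R * Len2%:R) <= (6 * (be + 6 * ga))%:R * D2%:R :> F.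
  by rewrite mulrCA (mulnC 6 (_ + _)) natrM -(mulrA _ 6%:R) ler_wpM2l ?ler0n.
have h2 : k%:R * (ga%:R * \sum_t psi t * #|Wl t|%:R) <= (14 * ga)%:R * D2%:R.
  by rewrite mulrCA (mulnC 14) natrM -(mulrA _ 14%:R) ler_wpM2l ?ler0n // sum_psi_Wl.
rewrite mulrDr; apply: le_trans (lerD h1 h2) _; rewrite -mulrDl -natrD ler_wpM2r ?ler0n // ler_nat.
by clear; lia.
Qed.


Definition endpoints (n : 'I_M) : {set V} :=
  [set v | [exists e in CE, (sct (nd e) == n) && ((v == p e) || (v == q e))]].

Lemma p_endpoint e : e \in CE -> p e \in endpoints (sct (nd e)).
Proof. by move=> eC; rewrite inE; apply/existsP; exists e; rewrite eC !eqxx. Qed.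

Lemma q_endpoint e : e \in CE -> q e \in endpoints (sct (nd e)).
Proof. by move=> eC; rewrite inE; apply/existsP; exists e; rewrite eC !eqxx orbT. Qed.

Variables (Nn : nat -> 'I_M -> {set V}) (pr : nat -> 'I_M -> V -> V).
Notation r i n := (32 * (2 ^ i * rho * Q ^ n))%N.
Hypothesis NE : forall i n, Nn i n \subset endpoints n.
Hypothesis Nsep : forall i (n : 'I_M), (i <= J)%N -> {in Nn i n &, forall c c', c != c' -> (r i n <= dist x2 c c')%N}.
Hypothesis prP : forall i (n : 'I_M) v, (i <= J)%N -> v \in endpoints n ->
  pr i n v \in Nn i n /\ (dist x2 v (pr i n v) <= r i n)%N.

Notation chain := (chain pr).

Lemma rJ n : r J n = L n. Proof. by rewrite /L0 mulnA. Qed.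

Lemma r_le i n : (i <= J)%N -> (r i n <= L n)%N.
Proof.
by move=> iJ; rewrite -rJ leq_mul2l -!mulnA leq_mul2r leq_pexp2l ?orbT.
Qed.

Lemma chain_p_near i e w : (i <= J)%N -> e \in CE -> (dist x2 (p e) w <= 4096 * L (sct (nd e)))%N ->
  (dist x2 w (chain (sct (nd e)) i (p e)) <= 4099 * L (sct (nd e)))%N.
Proof.
move=> iJ eC dw; have h1 := chain_near NE prP iJ (p_endpoint eC).
have h2 := dist_tri x2 (p e) w (chain (sct (nd e)) i (p e)); rewrite (distC x2 w (p e)) in h2.
have h3 := r_le (sct (nd e)) iJ; move: dw h1 h2 h3.
move: (L (sct (nd e))) (r i (sct (nd e))); clear; lia.
Qed.

Lemma chain_q_near i e w : (i <= J)%N -> e \in CE -> (dist x2 (p e) w <= 4096 * L (sct (nd e)))%N ->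
  (dist x2 w (chain (sct (nd e)) i (q e)) <= 4099 * L (sct (nd e)))%N.
Proof.
move=> iJ eC dw; have h1 := chain_near NE prP iJ (q_endpoint eC).
have h2 := dist_tri x2 (q e) w (chain (sct (nd e)) i (q e)).
have h4 := dist_tri x2 (p e) w (q e); rewrite (distC x2 w (p e)) in h4.
have h5 := CElen eC.
have h3 := r_le (sct (nd e)) iJ; move: dw h1 h2 h3 h4 h5.
move: (L (sct (nd e))) (r i (sct (nd e))); clear; lia.
Qed.

(** [D0] makes the diameter allowed by [labels] equal to [C5 * L n], enough for a neighbourhood of
    radius [4099 * L n]. The 4099 is 4096 to the anchor, 1 for the edge and 2 for the chain. *)
Lemma level_labels i : (i <= J)%N -> exists NN : 'I_M -> {set V},
  (\sum_(n < M) 2 ^ i * rho * Q ^ n * #|NN n| <= 13 * Len2)%N /\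
  forall (n : 'I_M) w, (#|[set c in Nn i n :\: NN n | (dist x2 w c <= 4099 * L n)%N]|
     <= 42 * (C5 * 2 ^ (J - i)))%N.
Proof.
move=> iJ; set D0 := (C5 * 2 ^ (J - i))%N.
pose ext (f : 'I_M -> {set V}) (n : nat) := if (insub n : option 'I_M) is Some n' then f n' else set0.
have extE f (n : 'I_M) : ext f n = f n by rewrite /ext valK.
have D0J : (D0 <= C5 * 2 ^ J)%N by rewrite leq_mul2l leq_pexp2l ?orbT // leq_subr.
have C50 : (0 < C5)%N by apply: leq_trans C5E.
have [|||n nM|NN [NNs NNl NNc]] := @labels V E I2 p q x2 TT (2 ^ i * rho)%N Q D0 (42 * D0)%N M (ext (Nn i)) _ Q1024 _ _ (leqnn _) connT.
- by rewrite muln_gt0 expn_gt0.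
- by apply: leq_trans QC; rewrite leq_mul2l D0J orbT.
- by rewrite muln_gt0 C50 expn_gt0.
- by rewrite -[n]/(nat_of_ord (Ordinal nM)) extE; exact: Nsep.
exists (fun n => NN n); split=> // n w; apply: (NNc n).
  by rewrite extE; apply/subsetP => c /setIdP[].
move=> c c' /setIdP[_ h1] /setIdP[_ h2].
have := dist_tri x2 w c c'; rewrite (distC x2 c w) => h3.
have e : (32 * D0 * (2 ^ i * rho * Q ^ n) = C5 * L n)%N.
  rewrite /D0 /L0 -(subnK iJ) expnD addnK.
  by move: (2 ^ (J - i))%N (2 ^ i)%N (Q ^ n)%N => a b c0; clear; lia.
rewrite e; apply: (@leq_trans (2 * 4099 * L n)%N); last by rewrite leq_mul2r C5E orbT.
by move: h1 h2 h3; move: (L n); clear; lia.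
Qed.

Notation vd := (vdiff F x).

Lemma dot_vd u v : dot (vd u v) (vd u v) = (dist x2 u v)%:R / S%:R.
Proof. by rewrite dot_vdiff x2E natrM mulrAC divff ?mul1r // gt_eqF. Qed.

(** Halving the radius doubles the bound on labels near an anchor and halves the squared norm of a
    piece. The product is [84 * C5 * L n] throughout, so every level costs the same. *)
Lemma increments (side : E -> V) i : (i < J)%N ->
    (forall e, e \in CE -> side e \in endpoints (sct (nd e))) ->
    (forall e w, e \in CE -> (dist x2 (p e) w <= 4096 * L (sct (nd e)))%N ->
      (dist x2 w (chain (sct (nd e)) i (side e)) <= 4099 * L (sct (nd e)))%N) ->
  \sum_(e in CE) omega (nd e) * dot (U e)
     (vd (chain (sct (nd e)) i (side e)) (chain (sct (nd e)) i.+1 (side e))) ^+ 2 <= (inc_const C5)%:R * dk.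
Proof.
move=> iJ sideE near; have [NN [NNl NNc]] := level_labels (ltnW iJ).
pose bn (n : 'I_M) := r i.+1 n.
pose G := (42 * (C5 * 2 ^ (J - i)))%N.
have eL (n : 'I_M) : (bn n * G = 84 * C5 * L n)%N.
  have eJ : (2 ^ J = 2 ^ (J - i) * 2 ^ i)%N by rewrite -expnD subnK // ltnW.
  rewrite /bn /G /L0 eJ expnS.
  by move: (2 ^ (J - i))%N (2 ^ i)%N (Q ^ n)%N => a b c0; clear; lia.
apply: le_trans (piece_total (bn := bn) (C1c := fun n => #|NN n|) (G := G) (be := 832) (ga := 84 * C5) _ _); last first.
- rewrite (_ : 832 = 64 * 13)%N // -mulnA; apply: leq_trans (_ : 64 * \sum_(n < M) 2 ^ i * rho * Q ^ n * #|NN n| <= _)%N.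
    rewrite big_distrr leq_sum // => n _; rewrite /bn expnS.
    by move: (2 ^ i)%N (Q ^ n)%N #|_| => a b c0 /=; clear; lia.
  by rewrite leq_mul2l NNl orbT.
- by move=> n; rewrite eL.
apply: (@piece_energy F h E U orthonormal N V V M G CE nd sct omega (fun n => (bn n)%:R / S%:R)
  (fun e => [set chain (sct (nd e)) i (side e)]) (fun n c => vd c (pr i.+1 n c))
  (fun e => vd (chain (sct (nd e)) i (side e)) (chain (sct (nd e)) i.+1 (side e)))
  NN (fun n w => [set c in Nn i n :\: NN n | (dist x2 w c <= 4099 * L n)%N])
  (fun n => Wg n) Wl).
- exact: omega01.
- by move=> n; rewrite divr_ge0 ?ler0n.
- exact: NNc.
- by move=> e eC; exists (fun=> 1) => j; rewrite big_set1 mul1r.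
- move=> e eC; rewrite dot_vd ler_wpM2r ?invr_ge0 ?ler0n // ler_nat.
  exact: (chain_step NE prP iJ (sideE e eC)).
move=> e eC; have cN := chain_net NE prP (ltnW iJ) (sideE e eC).
have [cNN|cNN] := boolP (chain (sct (nd e)) i (side e) \in NN (sct (nd e))).
  by left; rewrite sub1set.
right; have [w wW dw] := anchored eC; exists w => //.
by rewrite sub1set inE in_setD cNN cN (near e w eC dw).
Qed.

Lemma top_near e : e \in CE ->
  (dist x2 (chain (sct (nd e)) J (p e)) (chain (sct (nd e)) J (q e)) <= 5 * L (sct (nd e)))%N.
Proof.
move=> eC; have h1 := chain_near NE prP (leqnn J) (p_endpoint eC).
have h2 := chain_near NE prP (leqnn J) (q_endpoint eC).
have h3 := CElen eC; rewrite rJ in h1 h2.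
have h4 := dist_tri x2 (p e) (chain (sct (nd e)) J (p e)) (chain (sct (nd e)) J (q e)).
have h5 := dist_tri x2 (q e) (p e) (chain (sct (nd e)) J (q e)).
rewrite (distC x2 (chain (sct (nd e)) J (p e)) (p e)) in h4.
by move: h1 h2 h3 h4 h5; move: (L _); clear; lia.
Qed.

(** A top piece involves two labels. If one is exceptional, the other is exceptional or near it;
    therefore [C1] adds to the exceptional labels those in their neighbourhoods. *)
Lemma top_piece :
  \sum_(e in CE) omega (nd e) * dot (U e)
     (vd (chain (sct (nd e)) J (p e)) (chain (sct (nd e)) J (q e))) ^+ 2 <= (top_const C5)%:R * dk.
Proof.
have [NN [NNl NNc]] := level_labels (leqnn J).
pose bn (n : 'I_M) := (5 * L n)%N.
pose G := (42 * C5)%N.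
pose nb (n : 'I_M) w := [set c in Nn J n :\: NN n | (dist x2 w c <= 4099 * L n)%N].
have nbG n w : (#|nb n w| <= G)%N by have := NNc n w; rewrite subnn expn0 muln1.
pose C1 n := NN n :|: \bigcup_(c in NN n) nb n c.
have C1c n : (#|C1 n| <= (1 + G) * #|NN n|)%N.
  apply: leq_trans (card_setU_le _ _) _.
  by rewrite mulnDl mul1n leq_add2l card_bigcup_leqM.
apply: le_trans (piece_total (bn := bn) (C1c := fun n => #|C1 n|) (G := G)
   (be := 160 * 13 * (1 + G)) (ga := 210 * C5) _ _); last first.
- apply: leq_trans (_ : 160 * (1 + G) * \sum_(n < M) 2 ^ J * rho * Q ^ n * #|NN n| <= _)%N.
    rewrite big_distrr leq_sum // => n _; apply: leq_trans (leq_mul (leqnn _) (C1c n)) _.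
    rewrite /bn /L0; move: (2 ^ J)%N (Q ^ n)%N #|_| (1 + G)%N => a b c0 d0 /=; clear; lia.
  by rewrite (mulnAC 160 13) -(mulnA _ 13) leq_mul2l NNl orbT.
- by move=> n; rewrite /bn /G; move: (L n); clear; lia.
apply: (@piece_energy F h E U orthonormal N V V M G CE nd sct omega (fun n => (bn n)%:R / S%:R)
  (fun e => [set chain (sct (nd e)) J (p e); chain (sct (nd e)) J (q e)]) (fun n c => vec F x c)
  (fun e => vd (chain (sct (nd e)) J (p e)) (chain (sct (nd e)) J (q e)))
  C1 nb (fun n => Wg n) Wl).
- exact: omega01.
- by move=> n; rewrite divr_ge0 ?ler0n.
- exact: nbG.
- move=> e eC; set a := chain _ _ _; set b := chain _ _ _.
  exists (fun c => (c == a)%:R - (c == b)%:R) => j.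
  have [->|ab] := eqVneq a b.
    by rewrite /vdiff subrr big1 // => c _; rewrite subrr mul0r.
  rewrite big_setU1 ?inE // big_set1 !eqxx (eq_sym b a) (negPf ab).
  by rewrite /vdiff subr0 sub0r mul1r mulN1r.
- move=> e eC; rewrite dot_vd ler_wpM2r ?invr_ge0 ?ler0n // ler_nat /bn.
  exact: top_near.
move=> e eC; have pN := chain_net NE prP (leqnn J) (p_endpoint eC).
have qN := chain_net NE prP (leqnn J) (q_endpoint eC).
set n := sct (nd e) in pN qN *.
have near1 : (dist x2 (chain n J (p e)) (chain n J (q e)) <= 4099 * L n)%N.
  by apply: leq_trans (top_near eC) _; rewrite leq_mul2r orbT.
have [pNN|pNN] := boolP (chain n J (p e) \in NN n).
  left; rewrite subUset !sub1set /C1 in_setU pNN /= in_setU.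
  have [//|qNN] := boolP (chain n J (q e) \in NN n).
  by apply/bigcupP; exists (chain n J (p e)) => //; rewrite inE in_setD qNN qN near1.
have [qNN|qNN] := boolP (chain n J (q e) \in NN n).
  left; rewrite subUset !sub1set /C1 !in_setU qNN /= andbT; apply/orP; right.
  by apply/bigcupP; exists (chain n J (q e)) => //; rewrite inE in_setD pNN pN distC near1.
right; have [w wW dw] := anchored eC; exists w => //.
rewrite subUset !sub1set !inE pNN pN qNN qN /=.
by rewrite (chain_p_near (leqnn J) eC dw) (chain_q_near (leqnn J) eC dw).
Qed.

(** The finest radius is [L / 2 ^ J], at most 2 / k times the scaled edge length, so the squared
    norm alone suffices. *)
Lemma remainder (side : E -> V) :
    (forall e, e \in CE -> side e \in endpoints (sct (nd e))) ->
  \sum_(e in CE) omega (nd e) * dot (U e) (vd (side e) (chain (sct (nd e)) 0 (side e))) ^+ 2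
    <= 2%:R * dk.
Proof.
move=> sideE; apply: (@le_trans _ _ (\sum_(e in CE) 2%:R * (len e)%:R / k%:R)); last first.
  rewrite -mulr_suml -mulr_sumr -natr_sum /dk mulrA ler_wpM2r ?invr_ge0 ?ler0n //.
  rewrite ler_wpM2l ?ler0n // ler_nat /D [X in (_ <= X)%N](bigID (mem CE)) /=.
  exact: leq_addr.
apply: ler_sum => e eC; have /andP[o0 o1] := omega01 (nd e).
apply: le_trans (_ : dot (U e) (vd (side e) (chain (sct (nd e)) 0 (side e))) ^+ 2 <= _).
  by rewrite ler_piMl ?sqr_ge0.
apply: le_trans (dot_unit orthonormal e _) _; rewrite dot_vd.
rewrite ler_pdivlMr // mulrAC ler_pdivrMr // -!natrM ler_nat.
have h1 := chain_near NE prP (leq0n J) (sideE e eC).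
have h2 := CElen2 eC; rewrite x2E in h2.
have [_ h3] := prP (leq0n J) (sideE e eC).
apply: (@leq_trans (r 0 (sct (nd e)) * 2 ^ J)%N); first exact: leq_mul.
have -> : (r 0 (sct (nd e)) * 2 ^ J = L (sct (nd e)))%N.
  by rewrite /L0 expn0 mul1n; move: (2 ^ J)%N (Q ^ _)%N => a b; clear; lia.
by rewrite -mulnA (mulnC _ S).
Qed.

Lemma sqr_sum5 (a b c d e : F) :
  (a + b + (c - (d + e))) ^+ 2 <= 5%:R * (a ^+ 2 + b ^+ 2 + c ^+ 2 + d ^+ 2 + e ^+ 2).
Proof.
pose f (i : 'I_5) : F := nth 0 [:: a; b; c; - d; - e] i.
have := sqr_sum_le f; rewrite /f !big_ord_recr !big_ord0 /= !sqrrN !add0r.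
by rewrite (_ : a + b + c - d - e = a + b + (c - (d + e))) //; ring.
Qed.

(* Along the nets, the difference of the two ends splits into two remainders, [J]
   increments on each side, and the difference of the two top labels. *)
Lemma class_energy :
  \sum_(e in CE) omega (nd e) * dot (U e) (vd (p e) (q e)) ^+ 2
   <= (class_const C5 * J.+1 ^ 2)%:R * dk.
Proof.
pose inc (side : E -> V) i e := dot (U e)
     (vd (chain (sct (nd e)) i (side e)) (chain (sct (nd e)) i.+1 (side e))).
pose rem (side : E -> V) e := dot (U e) (vd (side e) (chain (sct (nd e)) 0 (side e))).
pose top e := dot (U e) (vd (chain (sct (nd e)) J (p e)) (chain (sct (nd e)) J (q e))).
have opp u a b : dot u (vd a b) = - dot u (vd b a).
  by rewrite /dot -sumrN; apply: eq_bigr => i _; rewrite /vdiff -mulrN opprB.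
have split_e e : dot (U e) (vd (p e) (q e)) = rem p e + \sum_(i < J) inc p i e
    + (top e - (rem q e + \sum_(i < J) inc q i e)).
  rewrite (dot_vdiff_sum x (U e) (p e) (fun i => chain (sct (nd e)) i (p e)) J (q e)).
  congr (_ + _); rewrite opp.
  rewrite (dot_vdiff_sum x (U e) (q e) (fun i => chain (sct (nd e)) i (q e)) J (chain (sct (nd e)) J (p e))).
  by rewrite opprD addrC -opp.
have bound e : e \in CE -> omega (nd e) * dot (U e) (vd (p e) (q e)) ^+ 2 <=
    5%:R * (omega (nd e) * rem p e ^+ 2 + J%:R * \sum_(i < J) omega (nd e) * inc p i e ^+ 2
      + omega (nd e) * top e ^+ 2 + omega (nd e) * rem q e ^+ 2
      + J%:R * \sum_(i < J) omega (nd e) * inc q i e ^+ 2).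
  move=> eC; have /andP[o0 _] := omega01 (nd e).
  have h1 (s : E -> V) : omega (nd e) * (\sum_(i < J) inc s i e) ^+ 2 <= J%:R * \sum_(i < J) omega (nd e) * inc s i e ^+ 2.
    by rewrite -mulr_sumr [X in _ <= X]mulrCA ler_wpM2l // sqr_sum_le.
  rewrite split_e; apply: le_trans (ler_wpM2l o0 (sqr_sum5 _ _ _ _ _)) _.
  rewrite mulrCA ler_wpM2l ?ler0n // !mulrDr.
  by move: (h1 p) (h1 q); lra.
apply: le_trans (ler_sum _ bound) _; rewrite -mulr_sumr !big_split /= -!mulr_sumr.
have h1 := remainder p_endpoint; have h2 := remainder q_endpoint; have h3 := top_piece.
have hp (i : 'I_J) : \sum_(e in CE) omega (nd e) * inc p i e ^+ 2 <= (inc_const C5)%:R * dk.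
  apply: (increments (ltn_ord i) p_endpoint) => e w eC dw.
  exact: (chain_p_near (ltnW (ltn_ord i)) eC dw).
have hq (i : 'I_J) : \sum_(e in CE) omega (nd e) * inc q i e ^+ 2 <= (inc_const C5)%:R * dk.
  apply: (increments (ltn_ord i) q_endpoint) => e w eC dw.
  exact: (chain_q_near (ltnW (ltn_ord i)) eC dw).
have dk0 : 0 <= dk by rewrite divr_ge0 ?ler0n.
have sumJ (s : E -> V) : (forall i : 'I_J, \sum_(e in CE) omega (nd e) * inc s i e ^+ 2 <= (inc_const C5)%:R * dk) ->
    J%:R * \sum_(e in CE) \sum_(i < J) omega (nd e) * inc s i e ^+ 2 <= J%:R * (J%:R * ((inc_const C5)%:R * dk)).
  move=> hs; rewrite ler_wpM2l ?ler0n // exchange_big /=.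
  apply: le_trans (ler_sum _ (fun i _ => hs i)) _.
  by rewrite sumr_const card_ord -[X in X <= _]mulr_natl.
have h4 := sumJ p hp; have h5 := sumJ q hq.
apply: (@le_trans _ _ (5%:R * (2%:R * dk + J%:R * (J%:R * ((inc_const C5)%:R * dk)) + (top_const C5)%:R * dk + 2%:R * dk
   + J%:R * (J%:R * ((inc_const C5)%:R * dk))))).
  rewrite ler_wpM2l ?ler0n //; rewrite -/(rem p) in h1.
  by repeat apply: lerD.
exact: energy_combine.
Qed.

End WithTree.

Theorem class_bound :
  \sum_(e in CE) omega (nd e) * dot (U e) (vdiff F x (p e) (q e)) ^+ 2
   <= (class_const C5 * J.+1 ^ 2)%:R * (D%:R / k%:R).
Proof.
have [TT [cardT connV h1 h2]] := good_tree.
have connT u v : conn p q (mem TT) u v.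
  have := connV root u v; rewrite (Vt_root hier) !inE => /(_ isT isT).
  by apply: conn_sub => f /andP[].
have L00 : (0 < L0)%N by rewrite !muln_gt0 expn_gt0 rho0.
have sc_eq : {in CE &, forall e e', nd e = nd e' -> sct (nd e) = sct (nd e') :> nat}.
  by move=> e e' _ _ ->.
have [Wg [Wl [Fn [a1 a2 a3 a4]]]] := @anchors V E I2 N p q x2 TT CE (fun e => sct (nd e)) nd Vt par
  L0 Q K L00 Q1024 QK connT cardT connV (laminar_Vt (leaf := leaf) (par := par)) (ex_intro _ root (Vt_root hier))
  (Vt_par par leaf) CEp CEq sc_eq CElen M (fun e _ => ltn_ord _).
have [Nn [pr [NE Nsep prP]]] := nets x2 J rho Q endpoints.
exact: (class_energy h1 h2 a2 a3 a4 connT a1 NE Nsep prP).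
Qed.

End ClassBound.

End ClassEnergy.
Import ClassEnergy.

(** * Edges directed from the node to its parent's cluster *)

Module OrientationEnergy.
Import Order.TTheory GRing.Theory Num.Theory.
Local Open Scope ring_scope.

Lemma sqr_sum_set (F : realFieldType) (E : finType) (A : {set E}) (a : E -> F) :
  (\sum_(e in A) a e) ^+ 2 <= #|A|%:R * \sum_(e in A) a e ^+ 2.
Proof.
have := @cauchy_schwarz F _ (enum A) (fun=> 1) (fun=> 1) a (fun _ _ => ler01).
rewrite !big_enum /=.
under eq_bigr => i _ do rewrite !mul1r.
under [X in _ <= X * _]eq_bigr => i _ do rewrite expr1n mulr1.
under [X in _ <= _ * X]eq_bigr => i _ do rewrite mul1r.
by rewrite sumr_const.
Qed.

Section Orientation.
Variables (F : realFieldType) (V E N : finType) (p q : E -> V).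
Variables (root : N) (par : N -> N) (leaf : V -> N) (T : {set N}).
Hypothesis hier : is_hierarchy root par leaf.
Notation Vt := (Vt par leaf).
Variables (h : nat) (U : E -> 'I_h -> F) (x : V -> 'I_h -> bool).
Hypothesis orthonormal : forall e e', dot (U e) (U e') = (e == e')%:R.
Variables (k K C5 : nat).
Hypothesis k0 : (0 < k)%N.
Hypothesis K0 : (0 < K)%N.
Hypothesis C5E : (2 * 4099 <= C5)%N.
Hypothesis kconn : forall t, k_edge_connected_on p q k (Vt t).
Hypothesis Vpos : (0 < #|V|)%N.
Notation Oe := (Oe p q par leaf).
Hypothesis HK : forall t, t \in T -> (#|[set g | crossV p q Vt t g]| * k <= #|Oe t| * K)%N.
Notation len e := (dist x (p e) (q e)).
Notation vd := (vdiff F x).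

Definition level_count (k : nat) : nat := up_log 2 k.
(** The argument lists the lower bounds on [Q = 2 ^ W] required by [class_bound]; its last summand
    makes [W] exceed [2 * J], the spread of [lg] over the mid edges of a node. *)
Definition class_count (k K C5 : nat) : nat :=
  up_log 2 (1024 + 2 * (K + 2) + 160 * (C5 * 2 ^ level_count k) + 2 * (2 ^ level_count k * 2 ^ level_count k)).

Let J := level_count k.
Let Sc := (32 * 2 ^ J)%N.
Let W := class_count k K C5.
Let Q := (2 ^ W)%N.
Let D := (\sum_e len e)%N.

Lemma Q_ge : (1024 + 2 * (K + 2) + 160 * (C5 * 2 ^ J) + 2 * (2 ^ J * 2 ^ J) <= Q)%N.
Proof. exact: up_logP. Qed.

Lemma JW : (2 * J < W)%N.
Proof.
have : (2 ^ (2 * J).+1 <= 2 ^ W)%N.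
  apply: leq_trans Q_ge; rewrite expnS (mul2n J) -addnn expnD; exact: leq_addl.
by rewrite leq_exp2l.
Qed.

Let W0 : (0 < W)%N. Proof. exact: leq_ltn_trans JW. Qed.

(* Repeating every coordinate multiplies all distances by [Sc], which makes the radii
   of the nets integral. *)
Definition copies (v : V) (i : 'I_h * 'I_Sc) : bool := x v i.1.

Lemma dist_copies u v : dist copies u v = (Sc * dist x u v)%N.
Proof.
have -> : dist copies u v = #|setX (diff x u v) [set: 'I_Sc]|.
  by apply: eq_card => -[i j]; rewrite !inE /= andbT.
by rewrite cardsX cardsT card_ord mulnC.
Qed.

Definition Os t : {set E} := [set e | (p e \in Vt t) && (q e \in Vt (par t) :\: Vt t)].
Let m t := #|Oe t|.
Let Lt t := (\sum_(e in Os t) len e)%N.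
(* The mid edges of a node have lengths within a factor [k ^ 2] of each other, so
   those of one residue class of [lg] modulo [W] have the same [lg]. *)
Definition long t := [set e in Os t | (k * Lt t < len e * m t)%N].
Definition short t := [set e in Os t :\: long t | (k * len e * m t <= Lt t)%N].
Definition mid t := Os t :\: long t :\: short t.

(** Of two nodes whose clusters share [p e], one has its parent's cluster inside the cluster of the
    other, which would then contain [q e]. *)
Lemma Os_uniq e t t' : e \in Os t -> e \in Os t' -> t = t'.
Proof.
case/setIdP=> pt /setDP[qp qt] /setIdP[pt' /setDP[qp' qt']].
apply/eqP; apply: contraT => ne.
case: (ancestor_par hier pt pt' ne) => /subsetP sub.
  by rewrite (sub _ qp) in qt'.
by rewrite (sub _ qp') in qt.
Qed.

Lemma Os_Oe t : Os t \subset Oe t.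
Proof.
apply/subsetP => e /setIdP[pt /setDP[qp qt]].
by rewrite inE /Multigraph.in2 qp (subsetP (Vt_par _ _ _) _ pt) /crossV pt (negPf qt).
Qed.

Definition nd e := odflt root [pick t in T | e \in Os t].

Lemma ndE t e : t \in T -> e \in Os t -> nd e = t.
Proof.
move=> tT et; rewrite /nd; case: pickP => [t' /andP[_ et']|/(_ t)]; last by rewrite tT et.
exact: Os_uniq et' et.
Qed.

Definition lg e := trunc_log 2 (len e).
Definition CE (c : nat) := [set e | [exists t in T, e \in mid t] && (lg e %% W == c)%N].

Lemma midP t e : e \in mid t ->
  [/\ e \in Os t, (len e * m t <= k * Lt t)%N & (Lt t < k * len e * m t)%N].
Proof.
case/setDP=> /setDP[eO nl] ns; split=> //.
  by move: nl; rewrite /long in_set eO /= -leqNgt.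
by move: ns; rewrite /short in_set in_setD eO nl /= -ltnNge.
Qed.

Lemma mid_len t e : e \in mid t -> (0 < len e)%N.
Proof.
by case/midP=> _ _; case: (len e) => // ; rewrite muln0.
Qed.

Lemma lg_bounds e : (0 < len e)%N -> (2 ^ lg e <= len e < 2 ^ (lg e).+1)%N.
Proof. by move=> e0; have := trunc_log_bounds (isT : 1 < 2)%N e0. Qed.

Lemma mid_lg_le t e e' : e \in mid t -> e' \in mid t -> (lg e <= lg e' + 2 * J)%N.
Proof.
move=> em e'm; have /andP[l1 _] := lg_bounds (mid_len em).
have /andP[_ l2] := lg_bounds (mid_len e'm).
have [eO h1 _] := midP em; have [_ _ h2] := midP e'm.
have m0 : (0 < m t)%N.
  by apply/card_gt0P; exists e; exact: (subsetP (Os_Oe t)).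
have h3 : (len e <= k * k * len e')%N.
  rewrite -(leq_pmul2r m0); apply: (leq_trans h1).
  by rewrite -!mulnA leq_mul2l mulnA (ltnW h2) orbT.
have kJ : (k <= 2 ^ J)%N by exact: up_logP.
have h4 : (2 ^ lg e < 2 ^ (2 * J + (lg e').+1))%N.
  apply: (leq_ltn_trans l1); apply: (leq_ltn_trans h3).
  rewrite (mul2n J) -addnn !expnD; apply: (@leq_ltn_trans (2 ^ J * 2 ^ J * len e')%N).
    by rewrite leq_mul2r leq_mul ?orbT.
  by rewrite ltn_pmul2l // muln_gt0 !expn_gt0.
by rewrite ltn_exp2l // addnS ltnS addnC in h4.
Qed.

Lemma mid_lg_eq t e e' : e \in mid t -> e' \in mid t -> (lg e %% W = lg e' %% W)%N -> lg e = lg e'.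
Proof.
move=> em e'm; have := mid_lg_le em e'm; have := mid_lg_le e'm em; have := JW.
move: (lg e) (lg e') => a b jw h1 h2 eq.
have ea := divn_eq a W; have eb := divn_eq b W.
have : (a %/ W = b %/ W)%N.
  apply/eqP; rewrite eqn_leq -ltnS -(ltn_pmul2r W0) -[in X in _ && X]ltnS -[in X in _ && X](ltn_pmul2r W0) !mulSn.
  move: (a %/ W * W)%N (b %/ W * W)%N (a %% W)%N (b %% W)%N ea eb eq => aw bw r r' ea eb eq.
  by move: ea eb eq jw h1 h2; clear; lia.
by rewrite {2}ea {2}eb => ->; rewrite eq.
Qed.

Lemma CEP c e : e \in CE c -> [/\ nd e \in T, e \in mid (nd e) & (lg e %% W = c)%N].
Proof.
case/setIdP=> /existsP[t /andP[tT et]] /eqP ec.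
by have [eO _ _] := midP et; rewrite (ndE tT eO).
Qed.

Notation vdist e := (dot (U e) (vd (p e) (q e))).

Lemma class_c c :
  \sum_(e in CE c) omega F p q par leaf (CE c) nd (nd e) * vdist e ^+ 2
    <= (class_const C5 * J.+1 ^ 2)%:R * (D%:R / k%:R).
Proof.
pose M := (\max_e lg e).+1.
(* All edges of the class at one node have the same [lg], so any of them gives the scale; nodes
   without such edges get 0. *)
pose sct t : 'I_M := inord (odflt 0%N (omap (fun e => lg e %/ W)%N [pick e in CE c | nd e == t])).
have sctE e : e \in CE c -> sct (nd e) = (lg e %/ W)%N :> nat.
  move=> eC; rewrite /sct; case: pickP => [e' /andP[e'C /eqP ne] | /(_ e)]; last by rewrite eC eqxx.
  have [_ em er] := CEP eC; have [_ e'm e'r] := CEP e'C; rewrite ne in e'm.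
  rewrite /=; have -> : lg e' = lg e by apply: mid_lg_eq e'm em _; rewrite er e'r.
  rewrite inordK // ltnS; apply: (leq_trans (leq_div _ _)).
  exact: (@leq_bigmax _ lg e).
have Q2 := Q_ge.
(* With [rho = 2 ^ c.+1] the radius is the scaled power of two above the length, which lies between
   the scaled length and twice it. *)
have LE e : e \in CE c -> (32 * (2 ^ J * 2 ^ c.+1) * Q ^ sct (nd e) = Sc * 2 ^ (lg e).+1)%N.
  move=> eC; rewrite (sctE e eC) mulnA -mulnA -expnM -expnD; congr (_ * 2 ^ _)%N.
  have [_ _ er] := CEP eC; rewrite addSn addnC mulnC; congr _.+1.
  by rewrite -er -divn_eq.
have Sc0 : (0 < Sc)%N by rewrite muln_gt0 expn_gt0.
have [h1 [h2 h3]] : (1024 <= Q /\ (2 * (K + 2) <= Q /\ 160 * (C5 * 2 ^ J) <= Q))%N.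
  move: Q2; move: (2 * (K + 2))%N (160 * (C5 * 2 ^ J))%N (2 * (2 ^ J * 2 ^ J))%N => a b d0 Q2.
  by split; [|split]; apply: leq_trans Q2; clear; lia.
have rho0 : (0 < 2 ^ c.+1)%N by rewrite expn_gt0.
apply: (@class_bound F V E N p q root par leaf T hier h U x orthonormal _ copies Sc Sc0 dist_copies
  k K J M (2 ^ c.+1) Q C5 k0 K0 (@up_logP 2 k isT) rho0 C5E _ _ _ kconn Vpos HK (CE c) nd sct).
- exact: h1.
- exact: h2.
- exact: h3.
- by move=> e /CEP[_ /midP[/setIdP[]]].
- by move=> e /CEP[_ /midP[/setIdP[]]].
- by move=> e /CEP[].
- move=> e eC; rewrite dist_copies LE // leq_mul2l; have [_ em _] := CEP eC.
  by have /andP[_ /ltnW ->] := lg_bounds (mid_len em); rewrite orbT.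
move=> e eC; rewrite dist_copies LE // mulnCA leq_mul2l expnS; have [_ em _] := CEP eC.
by rewrite leq_mul2l; have /andP[-> _] := lg_bounds (mid_len em); rewrite !orbT.
Qed.

Lemma vdist_sqr e : vdist e ^+ 2 <= (len e)%:R.
Proof. by apply: le_trans (dot_unit orthonormal e _) _; rewrite dot_vdiff. Qed.

(** Cauchy-Schwarz suffices for a part smaller by a factor [k] in number or in total length: long
    edges are few by Markov's inequality, short ones have small total length. *)
Lemma part_bound t (A : {set E}) :
    (#|A| * (\sum_(e in A) len e) * k <= m t * Lt t)%N ->
  (m t)%:R^-1 * (\sum_(e in A) vdist e) ^+ 2 <= (Lt t)%:R / k%:R.
Proof.
move=> hA; have [m0|mn] := eqVneq (m t) 0%N.
  by rewrite m0 invr0 mul0r divr_ge0 ?ler0n.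
rewrite mulrC ler_pdivrMr ?ltr0n ?lt0n // mulrAC ler_pdivlMr ?ltr0n //.
apply: le_trans (_ : (#|A| * (\sum_(e in A) len e))%:R * k%:R <= _); last first.
  by rewrite -!natrM ler_nat (mulnC (Lt t)).
rewrite ler_wpM2r ?ler0n //; apply: le_trans (sqr_sum_set _ _) _.
rewrite natrM ler_wpM2l ?ler0n // natr_sum; apply: ler_sum => e _; exact: vdist_sqr.
Qed.

Lemma long_bound t : (m t)%:R^-1 * (\sum_(e in long t) vdist e) ^+ 2 <= (Lt t)%:R / k%:R.
Proof.
apply: part_bound.
have sub : (\sum_(e in long t) len e <= Lt t)%N.
  rewrite [X in (_ <= X)%N](big_setID (long t)) /= (setIidPr _) ?leq_addr //.
  by apply/subsetP => e /setIdP[].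
have h1 : (#|long t| * (k * Lt t) <= (\sum_(e in long t) len e) * m t)%N.
  rewrite -sum_nat_const big_distrl; apply: leq_sum => e /setIdP[_]; exact: ltnW.
apply: (@leq_trans (#|long t| * Lt t * k)%N); first by rewrite leq_mul2r leq_mul2l sub !orbT.
rewrite -mulnA (mulnC (Lt t)); apply: (leq_trans h1).
by rewrite mulnC leq_mul2l sub orbT.
Qed.

Lemma short_bound t : (m t)%:R^-1 * (\sum_(e in short t) vdist e) ^+ 2 <= (Lt t)%:R / k%:R.
Proof.
apply: part_bound.
have sm : (#|short t| <= m t)%N.
  apply: subset_leq_card; apply: subset_trans (Os_Oe t).
  by apply/subsetP => e /setIdP[/setDP[]].
have h1 : (k * (\sum_(e in short t) len e) * m t <= #|short t| * Lt t)%N.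
  by rewrite -sum_nat_const big_distrr big_distrl; apply: leq_sum => e /setIdP[].
apply: (@leq_trans (k * (\sum_(e in short t) len e) * m t)%N).
  by rewrite -mulnA mulnC (mulnC k) leq_mul2l sm orbT.
by apply: (leq_trans h1); rewrite leq_mul2r sm orbT.
Qed.

(** Cauchy-Schwarz twice: over the [W] residue classes, giving the factor [W], and within a class,
    giving [omega]. *)
Lemma mid_bound t : t \in T -> (m t)%:R^-1 * (\sum_(e in mid t) vdist e) ^+ 2 <=
  W%:R * \sum_(c < W) \sum_(e in CE c | nd e == t) omega F p q par leaf (CE c) nd (nd e) * vdist e ^+ 2.
Proof.
move=> tT.
pose mc c := [set e in CE c | nd e == t].
have mcE c e : (e \in mc c) = (e \in mid t) && (lg e %% W == c)%N.
  apply/setIdP/andP => [[eC /eqP ne]|[em ec]].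
    by have [_ em ->] := CEP eC; rewrite -ne.
  have [eO _ _] := midP em; split; last by rewrite (ndE tT eO).
  by rewrite inE ec andbT; apply/existsP; exists t; rewrite tT.
have -> : \sum_(e in mid t) vdist e = \sum_(c < W) \sum_(e in mc c) vdist e.
  have -> : \sum_(c < W) \sum_(e in mc c) vdist e =
     \sum_(c < W) \sum_(e in mid t) (if (lg e %% W == c)%N then vdist e else 0).
    by apply: eq_bigr => c _; rewrite -big_mkcondr; apply: eq_bigl => e; rewrite mcE.
  rewrite [RHS]exchange_big /=; apply: eq_bigr => e _ /=.
  rewrite (bigD1 (Ordinal (ltn_pmod (lg e) W0))) //= eqxx big1 ?addr0 // => c ne.
  case: ifP => // /eqP h1; case/negP: ne; apply/eqP/val_inj; by rewrite /= h1.
have minv : 0 <= (m t)%:R^-1 :> F by rewrite invr_ge0 ler0n.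
apply: le_trans (ler_wpM2l minv (sqr_sum_le _)) _.
rewrite mulrCA ler_wpM2l ?ler0n // mulr_sumr; apply: ler_sum => c _.
apply: le_trans (ler_wpM2l minv (sqr_sum_set _ _)) _.
rewrite mulrA mulr_sumr (eq_bigl (fun e => (e \in CE c) && (nd e == t))); last first.
  by move=> e; rewrite inE.
apply: ler_sum => e /andP[_ /eqP ->].
by rewrite /omega (mulrC (m t)%:R^-1).
Qed.

Theorem orientation_bound :
  \sum_(t in T) (m t)%:R^-1 * (\sum_(e in Os t) vdist e) ^+ 2
   <= (6 + 3 * (W ^ 2 * (class_const C5 * J.+1 ^ 2)))%:R * (D%:R / k%:R).
Proof.
have sumL : (\sum_(t in T) Lt t <= D)%N.
  rewrite /Lt /D; under eq_bigr => t _ do rewrite big_mkcond.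
  rewrite exchange_big; apply: leq_sum => e _ /=.
  have [t0 t0e|no] := pickP (fun t => e \in Os t); last first.
    by rewrite big1 // => t _; rewrite no.
  rewrite (bigID (pred1 t0)) /= [X in (_ + X)%N]big1 ?addn0.
    rewrite big_mkcondr; apply: (@leq_trans (\sum_(t in [set t0]) len e)%N); last by rewrite big_set1.
    rewrite big_mkcond [X in (_ <= X)%N]big_mkcond; apply: leq_sum => t _.
    by rewrite inE; case: (t \in T); case: (t == t0); case: (e \in Os t).
  move=> t /andP[_ ne]; case: ifP => // te.
  by rewrite (Os_uniq te t0e) eqxx in ne.
have sq3 (a b c : F) : (a + (b + c)) ^+ 2 <= 3%:R * (a ^+ 2 + b ^+ 2 + c ^+ 2).
  rewrite -subr_ge0 (_ : _ - _ = (a - b) ^+ 2 + (b - c) ^+ 2 + (a - c) ^+ 2); last by ring.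
  by rewrite !addr_ge0 ?sqr_ge0.
pose mid_t t := \sum_(c < W) \sum_(e in CE c | nd e == t) omega F p q par leaf (CE c) nd (nd e) * vdist e ^+ 2.
have per_t t : t \in T -> (m t)%:R^-1 * (\sum_(e in Os t) vdist e) ^+ 2 <=
    6%:R / k%:R * (Lt t)%:R + 3%:R * W%:R * mid_t t.
  move=> tT.
  have -> : \sum_(e in Os t) vdist e = \sum_(e in long t) vdist e + (\sum_(e in short t) vdist e + \sum_(e in mid t) vdist e).
    rewrite (big_setID (long t)) /= (setIidPr _); last by apply/subsetP => e /setIdP[].
    congr (_ + _); rewrite (big_setID (short t)) /= (setIidPr _) //.
    by apply/subsetP => e /setIdP[].
  have minv : 0 <= (m t)%:R^-1 :> F by rewrite invr_ge0 ler0n.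
  apply: le_trans (ler_wpM2l minv (sq3 _ _ _)) _.
  rewrite mulrCA !mulrDr.
  have h1 := long_bound t; have h2 := short_bound t; have h3 := mid_bound tT.
  rewrite -/(mid_t t) in h3.
  have -> : 6%:R / k%:R * (Lt t)%:R = 3%:R * ((Lt t)%:R / k%:R) + 3%:R * ((Lt t)%:R / k%:R) :> F by ring.
  by rewrite -mulrA; apply: lerD; [apply: lerD|]; rewrite ler_wpM2l ?ler0n.
apply: le_trans (ler_sum _ per_t) _; rewrite big_split /= -!mulr_sumr -natr_sum.
have hm : \sum_(t in T) mid_t t <= W%:R * ((class_const C5 * J.+1 ^ 2)%:R * (D%:R / k%:R)).
  rewrite /mid_t exchange_big /=.
  apply: (@le_trans _ _ (\sum_(c < W) (class_const C5 * J.+1 ^ 2)%:R * (D%:R / k%:R))); last first.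
    by rewrite sumr_const card_ord -[X in X <= _]mulr_natl.
  apply: ler_sum => c _; apply: le_trans (class_c c).
  rewrite [X in _ <= X](partition_big nd (mem T)) //=.
  by move=> e /CEP[].
have hL : 6%:R / k%:R * (\sum_(t in T) Lt t)%:R <= 6%:R * (D%:R / k%:R) :> F.
  rewrite -mulrA ler_wpM2l ?ler0n // mulrC ler_wpM2r ?invr_ge0 ?ler0n // ler_nat //.
have hm' : 3%:R * W%:R * \sum_(t in T) mid_t t <= 3%:R * W%:R * (W%:R * ((class_const C5 * J.+1 ^ 2)%:R * (D%:R / k%:R))).
  by rewrite ler_wpM2l ?mulr_ge0 ?ler0n.
apply: le_trans (lerD hL hm') _.
move: (class_const C5 * J.+1 ^ 2)%N (D%:R / k%:R) => b y.
suff -> : (6 + 3 * (W ^ 2 * b))%:R * y = 6%:R * y + 3%:R * W%:R * (W%:R * (b%:R * y)) by [].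
by rewrite -mulnn natrD !natrM; ring.
Qed.

End Orientation.

End OrientationEnergy.
Import OrientationEnergy.

(** * Logarithmic bound on the number of classes *)

Module Logarithm.
Local Open Scope R_scope.

Lemma INR_exp2 n : INR (2 ^ n)%N = 2 ^ n.
Proof. by elim: n => [|n IH]; rewrite // expnS mult_INR IH. Qed.

Lemma ln_ge0 y : 1 <= y -> 0 <= ln y.
Proof.
case=> [y1|<-]; last by rewrite ln_1; exact: Rle_refl.
by rewrite -ln_1; left; apply: ln_increasing => //; Lra.lra.
Qed.

(** The argument of the logarithm is at most [1040 + 320 * C5] times k^2 / lam, because
    [2 ^ level_count k <= 2 * k]; the factor 2 accounts for 1 / ln 2 < 2. *)
Lemma class_count_le (k K C5 : nat) (lam : R) :
  (1 < k)%N -> 0 < lam -> lam < 1 -> INR K <= INR k / lam + 1 ->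
  INR (class_count k K C5) <=
    (5 + 2 * ln (INR (1040 + 320 * C5)%N)) * (1 + ln (INR k) + ln (/ lam)).
Proof.
move=> k1 l0 l1 hK.
have k2 : 2 <= INR k by apply: (le_INR 2); apply/leP.
have il1 : 1 < / lam by rewrite -Rinv_1; apply: Rinv_lt_contravar; Lra.lra.
pose Y := INR k * INR k * / lam.
have kk : 4 <= INR k * INR k by Lra.nra.
have kY : INR k <= Y by rewrite /Y; Lra.nra.
have Y1 : 1 <= Y by Lra.lra.
have klY : INR k / lam <= Y.
  have : 0 <= (INR k * / lam) * (INR k - 1).
    by apply: Rmult_le_pos; [apply: Rmult_le_pos|]; Lra.lra.
  by rewrite /Y /Rdiv; Lra.lra.
have kkY : INR k * INR k <= Y by rewrite /Y; Lra.nra.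
pose j := INR (2 ^ level_count k)%N.
have jk : j <= 2 * INR k.
  have /leP/le_INR : (2 ^ level_count k <= 2 * k)%N.
    have := @prime.up_log_gtn 2 k isT k1; rewrite -/(level_count k).
    case: (level_count k) => [|n] /= h; first by rewrite expn0 muln_gt0 /= ltnW.
    by rewrite expnS leq_mul2l /= ltnW.
  by rewrite mult_INR.
have j0 : 0 <= j by exact: pos_INR.
pose n0 := INR (1040 + 320 * C5)%N.
have c50 : 0 <= INR C5 by exact: pos_INR.
have n0E : n0 = 1040 + 320 * INR C5.
  by rewrite /n0 plus_INR mult_INR !INR_IZR_INZ.
set N := (1024 + 2 * (K + 2) + 160 * (C5 * 2 ^ level_count k) + 2 * (2 ^ level_count k * 2 ^ level_count k))%N.
have NE : INR N = 1024 + 2 * (INR K + 2) + 160 * (INR C5 * j) + 2 * (j * j).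
  have gen a b c t s u : INR (a + b * (t + b) + c * (s * u) + b * (u * u))%N =
      INR a + INR b * (INR t + INR b) + INR c * (INR s * INR u) + INR b * (INR u * INR u).
    by rewrite !(plus_INR, mult_INR).
  by rewrite /N gen (INR_IZR_INZ 1024) (INR_IZR_INZ 160) (INR_IZR_INZ 2).
have NY : INR N <= n0 * Y.
  rewrite NE n0E.
  have : j * j <= 4 * (INR k * INR k) by Lra.nra.
  have : INR C5 * j <= INR C5 * (2 * Y) by apply: Rmult_le_compat_l; Lra.lra.
  by Lra.lra.
have N1 : (1 < N)%N by rewrite /N -!addnA addSn ltnS addSn.
have hN : 2 ^ (class_count k K C5).-1 < INR N.
  rewrite -INR_exp2; apply: lt_INR; apply/ltP; exact: (@prime.up_log_gtn 2 N isT N1).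
have ln2 : / 2 < ln 2 by exact: ln_lt_2.
have h1 : INR (class_count k K C5).-1 * ln 2 < ln n0 + (2 * ln (INR k) + ln (/ lam)).
  have -> : INR (class_count k K C5).-1 * ln 2 = ln (2 ^ (class_count k K C5).-1).
    by rewrite -Rpower_pow ?ln_exp //; Lra.lra.
  have -> : ln n0 + (2 * ln (INR k) + ln (/ lam)) = ln (n0 * Y).
    by rewrite /Y !ln_mult; try Lra.nra; Lra.lra.
  apply: ln_increasing; first by apply: pow_lt; Lra.lra.
  by Lra.lra.
have lk : 0 <= ln (INR k) by apply: ln_ge0; Lra.lra.
have ll : 0 <= ln (/ lam) by apply: ln_ge0; Lra.lra.
have ln0 : 0 <= ln n0 by apply: ln_ge0; Lra.lra.
have hW : INR (class_count k K C5) <= INR (class_count k K C5).-1 + 1.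
  by case: (class_count k K C5) => [|n]; rewrite ?S_INR /=; Lra.lra.
have w0 : 0 <= INR (class_count k K C5).-1 by exact: pos_INR.
have h2 : INR (class_count k K C5).-1 <= 2 * (ln n0 + (2 * ln (INR k) + ln (/ lam))) by Lra.nra.
rewrite -/n0; apply: Rle_trans hW _; Lra.nra.
Qed.

End Logarithm.
Import Logarithm.

(** * Both orientations together *)

Module TotalEnergy.
Import Order.TTheory GRing.Theory Num.Theory.
Local Open Scope ring_scope.

Section BothOrientations.
Variables (F : realFieldType) (V E N : finType) (src tgt : E -> V).
Variables (root : N) (par : N -> N) (leaf : V -> N) (T : {set N}).
Hypothesis hier : is_hierarchy root par leaf.
Notation Vt := (Vt par leaf).
Variables (h : nat) (U : E -> 'I_h -> F) (x : V -> 'I_h -> bool).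
Hypothesis orthonormal : forall e e', dot (U e) (U e') = (e == e')%:R.
Variables (k K C5 : nat).
Hypothesis k0 : (0 < k)%N.
Hypothesis K0 : (0 < K)%N.
Hypothesis C5E : (2 * 4099 <= C5)%N.
Hypothesis kconn : forall t, k_edge_connected_on src tgt k (Vt t).
Hypothesis Vpos : (0 < #|V|)%N.
Notation Ot := (Ot src tgt par leaf).
Notation Pt := (Pt src tgt par leaf).
Hypothesis HK : forall t, t \in T -> (#|Pt t| * k <= #|Ot t| * K)%N.
Notation vd := (vdiff F x).

Lemma OtE t : Ot t = Oe src tgt par leaf t.
Proof.
apply/setP => e; rewrite [LHS]in_set [RHS]in_set /in2 /crossV !in_setD.
have sub v : (v \in Vt t) ==> (v \in Vt (par t)).
  by apply/implyP; exact: (subsetP (Vt_par par leaf t)).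
move: (sub (src e)) (sub (tgt e)).
by case: (src e \in Vt t); case: (tgt e \in Vt t);
  case: (src e \in Vt (par t)); case: (tgt e \in Vt (par t)).
Qed.

Lemma OeC t : Oe tgt src par leaf t = Oe src tgt par leaf t.
Proof. by apply/setP => e; rewrite [LHS]in_set [RHS]in_set /in2 /crossV andbC [X in _ && X]andbC eq_sym andbC. Qed.

Lemma PtE t : Pt t = [set g | crossV src tgt Vt t g].
Proof.
apply/setP => e; rewrite [LHS]in_set [RHS]in_set /crossV !in_setC.
by case: (src e \in Vt t); case: (tgt e \in Vt t).
Qed.

Lemma crossVC t : [set g | crossV tgt src Vt t g] = [set g | crossV src tgt Vt t g].
Proof. by apply/setP => e; rewrite [LHS]in_set [RHS]in_set /crossV eq_sym. Qed.

Lemma cut_edgesC (A B : {set V}) : cut_edges tgt src A B = cut_edges src tgt A B.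
Proof.
by apply/setP => e; rewrite [LHS]in_set [RHS]in_set orbC andbC [X in _ || X]andbC.
Qed.

Lemma kconnC t : k_edge_connected_on tgt src k (Vt t).
Proof.
by move=> W WV W0 WnV; rewrite cut_edgesC; exact: kconn.
Qed.

Lemma Ot_split t (a : E -> F) : \sum_(e in Ot t) a e =
  \sum_(e in Os src tgt par leaf t) a e + \sum_(e in Os tgt src par leaf t) a e.
Proof.
have dis : [disjoint Os src tgt par leaf t & Os tgt src par leaf t].
  rewrite -setI_eq0; apply/eqP/setP => e; rewrite in_setI in_set0.
  by apply/negP => /andP[/setIdP[h1 _] /setIdP[_ /setDP[_]]]; rewrite h1.
have -> : Ot t = Os src tgt par leaf t :|: Os tgt src par leaf t.
  apply/setP => e; rewrite in_setU /Os /Defs.Ot; move: (Vt (par t) :\: Vt t) (Vt t) => A B.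
  by rewrite [LHS]in_set [X in _ = X || _]in_set [X in _ = _ || X]in_set; congr (_ || _); rewrite andbC.
rewrite (big_setID (Os src tgt par leaf t)) /= setUK setDUl setDv set0U.
by rewrite (setDidPl _) // disjoint_sym.
Qed.

(** The outer 4 is 2 from splitting the square of a sum of two terms, times the two orientations;
    the second one is the first with [src] and [tgt] exchanged. *)
Theorem energy_bound :
  \sum_(t in T) (#|Ot t|%:R)^-1 * (\sum_(e in Ot t) dot (U e) (vd (src e) (tgt e))) ^+ 2
   <= (4 * (6 + 3 * (class_count k K C5 ^ 2 * (class_const C5 * (level_count k).+1 ^ 2))))%:R
      * ((\sum_e dist x (src e) (tgt e))%:R / k%:R).
Proof.
have HK1 t : t \in T -> (#|[set g | crossV src tgt Vt t g]| * k <= #|Oe src tgt par leaf t| * K)%N.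
  by move=> tT; rewrite -OtE -PtE; exact: HK.
have HK2 t : t \in T -> (#|[set g | crossV tgt src Vt t g]| * k <= #|Oe tgt src par leaf t| * K)%N.
  by rewrite crossVC OeC; exact: HK1.
have b1 := orientation_bound hier x orthonormal k0 K0 C5E kconn Vpos HK1.
have b2 := orientation_bound hier x orthonormal k0 K0 C5E kconnC Vpos HK2.
have eD : (\sum_e dist x (tgt e) (src e) = \sum_e dist x (src e) (tgt e))%N.
  by apply: eq_bigr => e _; exact: distC.
rewrite eD in b2.
have opp e : dot (U e) (vd (src e) (tgt e)) = - dot (U e) (vd (tgt e) (src e)).
  by rewrite /dot -sumrN; apply: eq_bigr => i _; rewrite /vdiff -mulrN opprB.
have per_t t : (#|Ot t|%:R)^-1 * (\sum_(e in Ot t) dot (U e) (vd (src e) (tgt e))) ^+ 2 <=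
   2%:R * ((#|Oe src tgt par leaf t|%:R)^-1 * (\sum_(e in Os src tgt par leaf t) dot (U e) (vd (src e) (tgt e))) ^+ 2)
   + 2%:R * ((#|Oe tgt src par leaf t|%:R)^-1 * (\sum_(e in Os tgt src par leaf t) dot (U e) (vd (tgt e) (src e))) ^+ 2).
  rewrite OeC -OtE Ot_split.
  rewrite [X in _ + X](eq_bigr (fun e => - dot (U e) (vd (tgt e) (src e)))); last by move=> e _; exact: opp.
  rewrite sumrN; move: (\sum_(e in _) _) (\sum_(e in _) _) => a b.
  rewrite !(mulrCA 2%:R) -mulrDr ler_wpM2l ?invr_ge0 ?ler0n // -subr_ge0.
  by rewrite (_ : _ - _ = (a + b) ^+ 2) ?sqr_ge0 //; ring.
apply: le_trans (ler_sum _ (fun t _ => per_t t)) _; rewrite big_split /= -!mulr_sumr.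
move: b1 b2; set B := (6 + _)%N; set y := (_ / _); move: (\sum_(t in T) _) (\sum_(t in T) _) => s1 s2 b1 b2.
by rewrite natrM -mulrA; move: (B%:R * y) b1 b2 => z; lra.
Qed.

End BothOrientations.

End TotalEnergy.
Import TotalEnergy.

(** * Transfer to the real numbers of the statement *)

Lemma sumRE (I : finType) (P : pred I) (f : I -> R) : sumR P f = (\sum_(i | P i) f i)%R.
Proof. by []. Qed.

Lemma dotE (h : nat) (u v : 'I_h -> R) : sumR predT (fun i => u i * v i) = dot u v.
Proof. by []. Qed.

Lemma INR_bool (b : bool) : (b%:R)%R = (if b then 1 else 0) :> R.
Proof. by case: b. Qed.

(** The number of net levels plus 1 is at most the number of classes by [JW], so everything is a
    multiple of the fourth power of [class_count], which is linear in the logarithms. *)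
Lemma polylog_bound (C5 : nat) : (2 * 4099 <= C5)%N -> exists C : R,
  forall (k K : nat) (lam : R), (1 < k)%N -> 0 < lam -> lam < 1 -> INR K <= INR k / lam + 1 ->
  INR (4 * (6 + 3 * (class_count k K C5 ^ 2 * (class_const C5 * (level_count k).+1 ^ 2))))%N
   <= C * (1 + ln (INR k) + ln (/ lam)) ^ 4.
Proof.
move=> C5E; pose c1 := 5 + 2 * ln (INR (1040 + 320 * C5)%N).
pose cc := INR (class_const C5).
exists (24 + 12 * cc * c1 ^ 4) => k K lam k1 l0 l1 hK.
set Z := 1 + ln (INR k) + ln (/ lam).
have il1 : 1 < / lam by rewrite -Rinv_1; apply: Rinv_lt_contravar; Lra.lra.
have k2 : 2 <= INR k by apply: (le_INR 2); apply/leP.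
have lk : 0 <= ln (INR k) by apply: ln_ge0; Lra.lra.
have ll : 0 <= ln (/ lam) by apply: ln_ge0; Lra.lra.
have Z1 : 1 <= Z by rewrite /Z; Lra.lra.
pose w := INR (class_count k K C5).
have hw : w <= c1 * Z by exact: class_count_le.
have w0 : 0 <= w by exact: pos_INR.
have hj : INR (level_count k).+1 <= w.
  apply: le_INR; apply/leP; apply: leq_ltn_trans (JW k K C5).
  by rewrite mul2n -addnn leq_addr.
pose j := INR (level_count k).+1.
have j0 : 0 <= j by exact: pos_INR.
have cc0 : 0 <= cc by exact: pos_INR.
have gen a b c (W y z : nat) : INR (a * (b + c * (W ^ 2 * (y * z ^ 2))))%N =
    INR a * (INR b + INR c * (INR W * INR W * (INR y * (INR z * INR z)))).
  by rewrite -!mulnn !(plus_INR, mult_INR).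
rewrite gen -/cc -/w -/j (INR_IZR_INZ 4) (INR_IZR_INZ 6) (INR_IZR_INZ 3).
have h1 : w * w * (cc * (j * j)) <= cc * (c1 * Z) ^ 4.
  have w2 : w * w <= (c1 * Z) * (c1 * Z) by apply: Rmult_le_compat.
  have j2 : j * j <= (c1 * Z) * (c1 * Z).
    by apply: Rmult_le_compat => //; apply: Rle_trans hj hw.
  have -> : cc * (c1 * Z) ^ 4 = (c1 * Z) * (c1 * Z) * (cc * ((c1 * Z) * (c1 * Z))) by rewrite /=; Lra.lra.
  apply: Rmult_le_compat => //.
  - exact: Rmult_le_pos.
  - by apply: Rmult_le_pos => //; exact: Rmult_le_pos.
  - exact: Rmult_le_compat_l.
rewrite Rpow_mult_distr in h1.
have Z4 : 1 <= Z ^ 4 by apply: pow_R1_Rle.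
have -> : IZR (Z.of_nat 4) = 4 by []. have -> : IZR (Z.of_nat 6) = 6 by []. have -> : IZR (Z.of_nat 3) = 3 by [].
by move: (w * w * _) (Z ^ 4) (c1 ^ 4) Z4 h1 => t z4 c4 Z4 h1; Lra.lra.
Qed.

Theorem mainTheorem15 :
  exists (C : R) (c : nat),
  forall (V E : finType) (src tgt : E -> V),
  (forall e, src e != tgt e) ->
  forall k : nat, (1 < k)%N -> k_edge_connected src tgt k ->
  forall lam : R, (0 < lam) -> (lam < 1) ->
  forall (N : finType) (root : N) (par : N -> N) (leaf : V -> N) (T : {set N}),
  is_LCH src tgt root par leaf k lam T ->
  forall h : nat, (0 < h)%N ->
  forall X : 'I_h -> V -> R, (forall i v, X i v = 0 \/ X i v = 1) ->
  let D := sumR predT (fun e : E => sumR predT (fun i => (Xe src tgt X e i) ^ 2)) in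
  (0 < D) ->
  forall U : E -> 'I_h -> R, semiorthogonal U ->
  (sumR (fun t => t \in T)
     (fun t => / INR #|Ot src tgt par leaf t| *
        (sumR (fun e => e \in Ot src tgt par leaf t)
           (fun e => sumR predT (fun i => U e i * Xe src tgt X e i))) ^ 2)
   / D
   <= (C * (1 + ln (INR k) + ln (/ lam)) ^ c) / INR k).
Proof.
(* Kept opaque: unfolding a unary numeral of this size is expensive. *)
have [C5 C5E] : exists C5, (2 * 4099 <= C5)%N by exists (2 * 4099)%N.
have [C hC] := polylog_bound C5E.
exists C, 4%N => V E src tgt _ k k1 _ lam l0 l1 N root par leaf T [hier [_ [kconn hT]]] h _ X X01 D D0 U Uo.
pose x v i := X i v == 1.
have XE i v : X i v = ((x v i)%:R)%R.
  rewrite /x; case: (X01 i v) => ->; last by rewrite eqxx.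
  by rewrite (_ : (0 == 1 :> R) = false) //; apply/eqP => /esym; exact: R1_neq_R0.
have XeE e i : Xe src tgt X e i = vdiff R x (src e) (tgt e) i.
  by rewrite /Xe !XE.
have DE : D = ((\sum_e dist x (src e) (tgt e))%N%:R)%R.
  rewrite /D sumRE GRing.natr_sum; apply: eq_bigr => e _.
  rewrite -(dot_vdiff R) -dotE; apply: eq_bigr => i _.
  by rewrite XeE /= Rmult_1_r.
have k0 : (0 < k)%N by apply: ltnW.
have kR : 0 < INR k by apply: lt_0_INR; apply/ltP.
have Vpos : (0 < #|V|)%N.
  have [e _|E0] := pickP E; first by apply/card_gt0P; exists (src e).
  by move: D0; rewrite DE big_pred0 // => /Rlt_irrefl.
have orth e e' : dot (U e) (U e') = ((e == e')%:R)%R.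
  by rewrite -dotE Uo INR_bool.
(* The lower bound on [K] yields [HK], the upper one keeps the number of classes logarithmic. *)
have [K [K1 K2]] : exists K : nat, INR k / lam <= INR K /\ INR K <= INR k / lam + 1.
  have y0 : 0 <= INR k / lam by apply: Rmult_le_pos; [Lra.lra | left; apply: Rinv_0_lt_compat].
  have [u1 u2] := archimed (INR k / lam).
  have upos : Z.le Z0 (up (INR k / lam)) by apply: le_IZR; Lra.lra.
  exists (Z.to_nat (up (INR k / lam))); rewrite (INR_IZR_INZ (Z.to_nat _)) Znat.Z2Nat.id //.
  by split; Lra.lra.
have K0 : (0 < K)%N.
  apply/ltP; apply: INR_lt; apply: Rlt_le_trans K1.
  by apply: Rmult_lt_0_compat => //; apply: Rinv_0_lt_compat.
have HK t : t \in T -> (#|Pt src tgt par leaf t| * k <= #|Ot src tgt par leaf t| * K)%N.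
  move=> tT; apply/leP; apply: INR_le; rewrite !mult_INR.
  have hO := hT t tT; have hP := pos_INR #|Pt src tgt par leaf t|.
  have il0 : 0 < / lam by exact: Rinv_0_lt_compat.
  have kl0 : 0 <= INR k * / lam by apply: Rmult_le_pos; Lra.lra.
  apply: (Rle_trans _ ((lam * INR #|Pt src tgt par leaf t|) * (INR k * / lam))).
    have e1 : lam * / lam = 1 by apply: Rinv_r; Lra.lra.
    have -> : lam * INR #|Pt src tgt par leaf t| * (INR k * / lam) =
      INR #|Pt src tgt par leaf t| * INR k * (lam * / lam) by Lra.lra.
    by rewrite e1 Rmult_1_r; right.
  apply: Rmult_le_compat => //; last exact: Rge_le.
  by apply: Rmult_le_pos; Lra.lra.
have /RleP key := energy_bound hier x orth k0 K0 C5E kconn Vpos HK.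
have hCk := hC k K lam k1 l0 l1 K2.
set B := (4 * _)%N in key hCk.
set S := sumR _ _.
have SE : S <= INR B * (D / INR k).
  rewrite DE !INRE RdivE; apply: Rle_trans key; right; apply: eq_bigr => t tT.
  rewrite RpowE INRE; congr (_ * _ ^+ 2)%R; apply: eq_bigr => e eO.
  by rewrite -dotE; apply: eq_bigr => i _; rewrite XeE.
apply: (Rle_trans _ (INR B / INR k)).
  apply: (Rmult_le_reg_r D) => //.
  have -> : S / D * D = S by rewrite /Rdiv Rmult_assoc Rinv_l ?Rmult_1_r //; Lra.lra.
  by have -> : INR B / INR k * D = INR B * (D / INR k) by rewrite /Rdiv; Lra.lra.
by apply: Rmult_le_compat_r => //; left; exact: Rinv_0_lt_compat.
Qed.
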